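(* Let $Sp(1,1)$ and $O_o(3,3)$ be endowed with the kinetic energy metrics associated with their Möbius actions on $Sp_1$ and $SO_3$, respectively. Then: a) The subgroup $Sp_1\times Sp_1$ is totally geodesic in $Sp(1,1)$. b) A geodesic in $SO_3\times SO_3$ (with the induced metric) is a geodesic in $O_o(3,3)$ if and only if it remains in one of the factors, that is, it is contained in $SO_3\times\{h\}$ for some $h\in SO_3$ or in $\{g\}\times SO_3$ for some $g\in SO_3$.
   Context: $Sp(1,1)$ is the group of invertible $2\times2$ quaternionic matrices (acting by left multiplication on column vectors in the right $\mathbb{H}$-vector space $\mathbb{H}^2$) preserving the form $\overline x\xi-\overline y\eta$; $Sp_1$ is the group of unit quaternions. $O_o(3,3)$ is the identity component of the group of real $6\times6$ matrices preserving $x^T\xi-y^T\eta$ on $\mathbb{R}^3\times\mathbb{R}^3$. The subgroups $Sp_1\times Sp_1\subset Sp(1,1)$ and $SO_3\times SO_3\subset O_o(3,3)$ are the maximal compact subgroups of block diagonal matrices $\operatorname{diag}(g,h)\equiv(g,h)$. Let $(G,M)=(Sp(1,1),Sp_1)$ or $(O_o(3,3),SO_3)$. The Möbius action of $G$ on $M$ is $\begin{pmatrix}A&B\\C&D\end{pmatrix}\ast U=(AU+B)(CU+D)^{-1}$, with $1\times1$ quaternionic blocks or $3\times3$ real blocks, respectively. $M$ carries the Riemannian metric induced by its inclusion in $\mathbb{H}$ or $\mathbb{R}^{3\times3}$ with the real inner product $\langle X,Y\rangle=\operatorname{Re}(\operatorname{tr}(\overline X^TY))$; let $\mu$ be its volume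 measure. For $g\in G$ and $X\in T_gG$, put $\widetilde X(q)=\left.\frac{d}{dt}\right|_0\gamma(t)\ast q\in T_{g\ast q}M$ where $\gamma$ is any smooth curve in $G$ with $\gamma(0)=g$, $\gamma'(0)=X$. The kinetic energy metric on $G$ is the Riemannian metric $\langle X,Y\rangle=\int_M\langle\widetilde X(q),\widetilde Y(q)\rangle\,d\mu(q)$, $X,Y\in T_gG$. *)

(* Defs.v *)
From HB Require Import structures.
From mathcomp Require Import all_boot all_order all_algebra.
From mathcomp Require Import all_classical all_reals all_analysis.
From mathcomp Require Import ring lra.

Set Implicit Arguments.
Unset Strict Implicit.
Unset Printing Implicit Defensive.

Import Order.TTheory GRing.Theory Num.Theory.
Import numFieldNormedType.Exports.

Local Open Scope classical_set_scope.
Local Open Scope ring_scope.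

(* Quat a b c d is a + b i + c j + d k. *)
Record quat (R : realType) := Quat { q0 : R ; q1 : R ; q2 : R ; q3 : R }.
Arguments Quat {R}.

Section QuatTheory.
Variable R : realType.
Implicit Types x y z : quat R.

Definition quat_to x : R * R * R * R := (q0 x, q1 x, q2 x, q3 x).
Definition quat_of (t : R * R * R * R) : quat R :=
  Quat t.1.1.1 t.1.1.2 t.1.2 t.2.
Lemma quat_toK : cancel quat_to quat_of. Proof. by case. Qed.

HB.instance Definition _ := Choice.copy (quat R) (can_type quat_toK).

Lemma quatP x y :
  q0 x = q0 y -> q1 x = q1 y -> q2 x = q2 y -> q3 x = q3 y -> x = y.
Proof. by case: x y => [? ? ? ?] [? ? ? ?] /= -> -> -> ->. Qed.

Definition addq x y :=
  Quat (q0 x + q0 y) (q1 x + q1 y) (q2 x + q2 y) (q3 x + q3 y).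
Definition oppq x := Quat (- q0 x) (- q1 x) (- q2 x) (- q3 x).
Definition mulq x y :=
  Quat (q0 x * q0 y - q1 x * q1 y - q2 x * q2 y - q3 x * q3 y)
       (q0 x * q1 y + q1 x * q0 y + q2 x * q3 y - q3 x * q2 y)
       (q0 x * q2 y - q1 x * q3 y + q2 x * q0 y + q3 x * q1 y)
       (q0 x * q3 y + q1 x * q2 y - q2 x * q1 y + q3 x * q0 y).
Definition scaleq (a : R) x := Quat (a * q0 x) (a * q1 x) (a * q2 x) (a * q3 x).
Definition conjq x := Quat (q0 x) (- q1 x) (- q2 x) (- q3 x).
Definition sqnormq x : R := q0 x ^+ 2 + q1 x ^+ 2 + q2 x ^+ 2 + q3 x ^+ 2.
Definition normq x : R := Num.sqrt (sqnormq x).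
Definition invq x := scaleq (sqnormq x)^-1 (conjq x).

Ltac qring := repeat case=> ? ? ? ?; apply: quatP => /=; ring.

Lemma addqA : associative addq. Proof. by qring. Qed.
Lemma addqC : commutative addq. Proof. by qring. Qed.
Lemma add0q : left_id (Quat 0 0 0 0) addq. Proof. by qring. Qed.
Lemma addNq : left_inverse (Quat 0 0 0 0) oppq addq. Proof. by qring. Qed.

HB.instance Definition _ :=
  GRing.isZmodule.Build (quat R) addqA addqC add0q addNq.

Lemma mulqA : associative mulq. Proof. by qring. Qed.
Lemma mul1q : left_id (Quat 1 0 0 0) mulq. Proof. by qring. Qed.
Lemma mulq1 : right_id (Quat 1 0 0 0) mulq. Proof. by qring. Qed.
Lemma mulqDl : left_distributive mulq +%R. Proof. by qring. Qed.
Lemma mulqDr : right_distributive mulq +%R. Proof. by qring. Qed.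
Lemma oneq_neq0 : Quat 1 0 0 0 != 0 :> quat R.
Proof. by apply/eqP => -[] /eqP; rewrite oner_eq0. Qed.

HB.instance Definition _ := GRing.Zmodule_isNzRing.Build (quat R)
  mulqA mul1q mulq1 mulqDl mulqDr oneq_neq0.

Lemma sqnormq_ge0 x : 0 <= sqnormq x.
Proof. by rewrite /sqnormq !addr_ge0 // sqr_ge0. Qed.

Lemma sqnormq_eq0 x : sqnormq x = 0 -> x = 0.
Proof.
move/eqP; rewrite /sqnormq !paddr_eq0 ?addr_ge0 ?sqr_ge0 // !sqrf_eq0.
by case/andP=> /andP[/andP[/eqP ? /eqP ?] /eqP ?] /eqP ?; apply: quatP.
Qed.

Lemma mulVq : {in [pred x : quat R | x != 0],
  left_inverse 1 (invq : quat R -> quat R) *%R}.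
Proof.
move=> x; rewrite inE => x0.
have n0 : sqnormq x != 0 by apply: contra_neq x0 => /sqnormq_eq0.
case: x n0 {x0} => a b c d; rewrite /invq /sqnormq /= => n0.
by apply: quatP => /=; field.
Qed.

Lemma mulqV : {in [pred x : quat R | x != 0],
  right_inverse 1 (invq : quat R -> quat R) *%R}.
Proof.
move=> x; rewrite inE => x0.
have n0 : sqnormq x != 0 by apply: contra_neq x0 => /sqnormq_eq0.
case: x n0 {x0} => a b c d; rewrite /invq /sqnormq /= => n0.
by apply: quatP => /=; field.
Qed.

Lemma unitqP x y : y * x = 1 /\ x * y = 1 -> [pred x : quat R | x != 0] x.
Proof.
case=> yx _ /=; apply: contraTneq (oner_neq0 (quat R)) => x0.
by rewrite -yx x0 mulr0 eqxx.
Qed.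

Lemma invq_out : {in [predC [pred x : quat R | x != 0]], invq =1 id}.
Proof.
move=> x; rewrite !inE negbK => /eqP ->.
by apply: quatP; rewrite /= ?oppr0 mulr0.
Qed.

HB.instance Definition _ := GRing.NzRing_hasMulInverse.Build (quat R)
  mulVq mulqV unitqP invq_out.

Lemma scaleqA (a b : R) x : scaleq a (scaleq b x) = scaleq (a * b) x.
Proof. by move: x; qring. Qed.
Lemma scale1q : left_id 1 scaleq. Proof. by qring. Qed.
Lemma scaleqDr : right_distributive scaleq +%R.
Proof. by move=> a; qring. Qed.
Lemma scaleqDl x : {morph scaleq^~ x : a b / a + b}.
Proof. by move=> a b; move: x; qring. Qed.

HB.instance Definition _ := GRing.Zmodule_isLmodule.Build R (quat R)
  scaleqA scale1q scaleqDr scaleqDl.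

Lemma ler_normqD x y : normq (x + y) <= normq x + normq y.
Proof.
rewrite -[leRHS]ger0_norm ?addr_ge0 ?sqrtr_ge0 // -sqrtr_sqr ler_sqrt ?sqr_ge0 //.
rewrite sqrrD !sqr_sqrtr ?sqnormq_ge0 // /normq -sqrtrM ?sqnormq_ge0 //.
set p := q0 x * q0 y + q1 x * q1 y + q2 x * q2 y + q3 x * q3 y.
have -> : sqnormq (x + y) = sqnormq x + p *+ 2 + sqnormq y.
  by rewrite /sqnormq /p /=; ring.
rewrite lerD2r lerD2l lerMn2r /= (le_trans (ler_norm p)) // -sqrtr_sqr.
rewrite ler_sqrt ?mulr_ge0 ?sqnormq_ge0 // -subr_ge0.
have -> : sqnormq x * sqnormq y - p ^+ 2 =
    (q0 x * q1 y - q1 x * q0 y) ^+ 2 + (q0 x * q2 y - q2 x * q0 y) ^+ 2 +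
    (q0 x * q3 y - q3 x * q0 y) ^+ 2 + (q1 x * q2 y - q2 x * q1 y) ^+ 2 +
    (q1 x * q3 y - q3 x * q1 y) ^+ 2 + (q2 x * q3 y - q3 x * q2 y) ^+ 2.
  by rewrite /sqnormq /p; ring.
by rewrite !addr_ge0 // sqr_ge0.
Qed.

Lemma normqZ (a : R) x : normq (a *: x) = `|a| * normq x.
Proof.
have E : sqnormq (a *: x) = a ^+ 2 * sqnormq x by rewrite /sqnormq /=; ring.
by rewrite /normq E sqrtrM ?sqr_ge0 // sqrtr_sqr.
Qed.

Lemma normq_eq0 x : normq x = 0 -> x = 0.
Proof.
move/eqP; rewrite sqrtr_eq0 => n0; apply: sqnormq_eq0.
by apply/le_anti; rewrite n0 sqnormq_ge0.
Qed.

HB.instance Definition _ := Lmodule_isNormed.Build R (quat R)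
  ler_normqD normqZ normq_eq0.

End QuatTheory.

(* The type of 2 x 2 quaternionic matrices, regarded as a real normed
   space. It is an alias because 'M[quat R]_2 already carries the (canonical)
   structure of a module over quat R. The choice of norm is immaterial. *)
Definition qmat (R : realType) := 'M[quat R]_2.

Section QMatTheory.
Variable R : realType.
Implicit Types P Q : qmat R.

HB.instance Definition _ := GRing.Zmodule.copy (qmat R) 'M[quat R]_2.

Definition scaleqm (a : R) P : qmat R := \matrix_(i, j) (a *: P i j).
Definition normqm P : R := \sum_i \sum_j `|P i j|.

Lemma scaleqmA (a b : R) P : scaleqm a (scaleqm b P) = scaleqm (a * b) P.
Proof. by apply/matrixP => i j; rewrite !mxE scalerA. Qed.
Lemma scale1qm : left_id 1 scaleqm.
Proof. by move=> P; apply/matrixP => i j; rewrite !mxE scale1r. Qed.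
Lemma scaleqmDr : right_distributive scaleqm +%R.
Proof. by move=> a P Q; apply/matrixP => i j; rewrite !mxE scalerDr. Qed.
Lemma scaleqmDl P : {morph scaleqm^~ P : a b / a + b}.
Proof. by move=> a b; apply/matrixP => i j; rewrite !mxE scalerDl. Qed.

HB.instance Definition _ := GRing.Zmodule_isLmodule.Build R (qmat R)
  scaleqmA scale1qm scaleqmDr scaleqmDl.

Lemma ler_normqmD P Q : normqm (P + Q) <= normqm P + normqm Q.
Proof.
rewrite /normqm -big_split ler_sum // => i _ /=.
by rewrite -big_split ler_sum // => j _ /=; rewrite mxE ler_normD.
Qed.

Lemma normqmZ (a : R) P : normqm (a *: P) = `|a| * normqm P.
Proof.
rewrite /normqm mulr_sumr; apply: eq_bigr => i _.
by rewrite mulr_sumr; apply: eq_bigr => j _; rewrite mxE normrZ.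
Qed.

Lemma normqm_eq0 P : normqm P = 0 -> P = 0.
Proof.
move=> P0; apply/matrixP => i j; rewrite mxE; apply/normr0_eq0.
have /psumr_eq0P := P0 => /(_ (fun i _ => sumr_ge0 _ (fun j _ => normr_ge0 _))).
by move=> /(_ i isT) /psumr_eq0P; apply.
Qed.

HB.instance Definition _ := Lmodule_isNormed.Build R (qmat R)
  ler_normqmD normqmZ normqm_eq0.

End QMatTheory.

(* In finite dimension, f is C^(k.+1) on the open set U iff it is continuous
   there and all its directional derivatives exist and are C^k. *)
Fixpoint class_C (R : realType) (V W : normedModType R) (k : nat)
    (U : set V) (f : V -> W) : Prop :=
  (forall x, U x -> {for x, continuous f}) /\
  if k is k'.+1 then
    forall v, (forall x, U x -> derivable f x v) /\
              class_C k' U (fun x => 'D_v f x)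
  else True.

Definition smooth_on (R : realType) (V W : normedModType R)
  (U : set V) (f : V -> W) : Prop := forall k, class_C k U f.

Definition partial (R : realType) (W : normedModType R) (d : nat) (i : 'I_d)
  (f : 'rV[R]_d -> W) (x : 'rV[R]_d) : W := 'D_(delta_mx 0 i) f x.

(* psi restricted to U is a smooth parametrization of an open part of the
   embedded submanifold S: an injective immersion which is a homeomorphism
   onto a relatively open subset of S. Since a d-dimensional submanifold only
   has (nonempty) parametrizations by open subsets of R^d, the dimension of S
   need not be mentioned. *)
Definition local_param (R : realType) (E : normedModType R) (d : nat)
    (S : set E) (U : set 'rV[R]_d) (psi : 'rV[R]_d -> E) : Prop :=
  [/\ open U,
      smooth_on U psi,
      {in U &, injective psi},
      forall x v, U x -> 'D_v psi x = 0 -> v = 0 &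
      forall U' : set 'rV[R]_d, open U' -> U' `<=` U ->
        exists2 W : set E, open W & psi @` U' = S `&` W].

(* A Riemannian metric on a submanifold of E is given by a function g with
   g p X Y the inner product of X, Y in T_p S; its values at vectors which
   are not tangent to S are irrelevant. *)
Definition gram (R : realType) (E : normedModType R) (g : E -> E -> E -> R)
    (d : nat) (psi : 'rV[R]_d -> E) (x : 'rV[R]_d) : 'M[R]_d :=
  \matrix_(i, j) g (psi x) (partial i psi x) (partial j psi x).

(* The Christoffel symbol Gamma^k_ij of the Levi-Civita connection. *)
Definition christoffel (R : realType) (E : normedModType R)
    (g : E -> E -> E -> R) (d : nat) (psi : 'rV[R]_d -> E) (x : 'rV[R]_d)
    (k i j : 'I_d) : R :=
  2^-1 * \sum_l invmx (gram g psi x) k l *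
    (partial i (fun y => gram g psi y j l) x
     + partial j (fun y => gram g psi y i l) x
     - partial l (fun y => gram g psi y i j) x).

(* c is a geodesic of (S, g) on the open interval I for the Levi-Civita
   connection: the equation of geodesics holds in all local coordinates. *)
Definition geodesic (R : realType) (E : normedModType R) (S : set E)
    (g : E -> E -> E -> R) (I : set R) (c : R -> E) : Prop :=
  [/\ open I, is_interval I, smooth_on I c & forall t, I t -> S (c t)] /\
  forall (d : nat) (U : set 'rV[R]_d) (psi : 'rV[R]_d -> E),
    local_param S U psi ->
    forall (J : set R) (x : R -> 'rV[R]_d),
      open J -> J `<=` I -> smooth_on J x ->
      (forall t, J t -> U (x t) /\ c t = psi (x t)) ->
      forall t (k : 'I_d), J t ->
        derive1n 2 x t 0 k + \sum_i \sum_j christoffel g psi (x t) k i j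
                                     * derive1 x t 0 i * derive1 x t 0 j = 0.

(* The metric induced on S by g is given by the same function g. *)
Definition totally_geodesic (R : realType) (E : normedModType R)
    (S G : set E) (g : E -> E -> E -> R) : Prop :=
  S `<=` G /\ forall I c, geodesic S g I c -> geodesic G g I c.

Definition borel (T : ptopologicalType) := g_sigma_algebraType (@open T).

Definition vec3 (R : realType) (z : R * R * R) : 'rV[R]_3 :=
  \row_i nth 0 [:: z.1.1; z.1.2; z.2] i.

Definition lebesgue3 (R : realType) : set (R * R * R) -> \bar R :=
  ((lebesgue_measure \x lebesgue_measure) \x lebesgue_measure)%E.

(* mu is the Riemannian volume measure of the 3-dimensional submanifold M of F
   with the metric induced by the inner product ip of F (regarded as a Borel
   measure on F, concentrated on M). *)
Definition volume_measure (R : realType) (F : normedModType R) (M : set F)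
    (ip : F -> F -> R) (mu : {measure set (borel F) -> \bar R}) : Prop :=
  mu (~` M) = 0%E /\
  forall (U : set 'rV[R]_3) (phi : 'rV[R]_3 -> F), local_param M U phi ->
  forall B : set (borel F), measurable B ->
    mu (B `&` phi @` U) =
    (\int[@lebesgue3 R]_(z in [set z | U (vec3 z) /\ B (phi (vec3 z))])
       (Num.sqrt (\det (gram (fun=> ip) phi (vec3 z))))%:E)%E.

Section Kinetic.
Variables (R : realType) (E F : normedModType R).
Variables (G : set E) (M : set F) (act : E -> F -> F).
Variables (ip : F -> F -> R) (mu : {measure set (borel F) -> \bar R}).

Definition curves_at (g X : E) : set (R -> E) :=
  [set c | exists2 e : R, 0 < e &
    [/\ smooth_on `]-e, e[ c, forall t, t \in `]-e, e[ -> G (c t),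
        c 0 = g & derive1 c 0 = X]].

(* The vector field q |-> X~(q) along the action of g; it does not depend on
   the curve c representing X in T_g G, which is picked by choice. *)
Definition tilde (g X : E) (q : F) : F :=
  let c := get (curves_at g X) in derive1 (fun t => act (c t) q) 0.

Definition kinetic (g X Y : E) : R :=
  \int[mu]_(q in M) ip (tilde g X q) (tilde g Y q).

End Kinetic.

Section Quaternionic.
Variable R : realType.

Definition Sp1 : set (quat R) := [set q | conjq q * q = 1].

Definition qform (u v : 'cV[quat R]_2) : quat R :=
  conjq (u 0 0) * v 0 0 - conjq (u 1 0) * v 1 0.

Definition Sp11 : set (qmat R) :=
  [set P | (exists Q : 'M[quat R]_2, P *m Q = 1%:M /\ Q *m P = 1%:M) /\
           forall u v : 'cV[quat R]_2, qform (P *m u) (P *m v) = qform u v].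

Definition qdiag (g h : quat R) : qmat R :=
  \matrix_(i, j) if i == j then (if i == 0 then g else h) else 0.

Definition Sp1xSp1 : set (qmat R) := [set qdiag g h | g in Sp1 & h in Sp1].

Definition qmoebius (P : qmat R) (u : quat R) : quat R :=
  (P 0 0 * u + P 0 1) * (P 1 0 * u + P 1 1)^-1.

Definition qip (x y : quat R) : R := q0 (conjq x * y).

End Quaternionic.

Section Real.
Variable R : realType.

Definition SO3 : set 'M[R]_3 := [set g | g^T *m g = 1%:M /\ \det g = 1].

Definition rform (u v : 'cV[R]_(3 + 3)) : 'M[R]_1 :=
  (usubmx u)^T *m usubmx v - (dsubmx u)^T *m dsubmx v.

Definition O33 : set 'M[R]_(3 + 3) :=
  [set P | forall u v, rform (P *m u) (P *m v) = rform u v].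

Definition Oo33 : set 'M[R]_(3 + 3) := connected_component O33 1%:M.

Definition rdiag (g h : 'M[R]_3) : 'M[R]_(3 + 3) := block_mx g 0 0 h.

Definition SO3xSO3 : set 'M[R]_(3 + 3) := [set rdiag g h | g in SO3 & h in SO3].

Definition rmoebius (P : 'M[R]_(3 + 3)) (U : 'M[R]_3) : 'M[R]_3 :=
  (ulsubmx P *m U + ursubmx P) *m invmx (dlsubmx P *m U + drsubmx P).

Definition rip (X Y : 'M[R]_3) : R := \tr (X^T *m Y).

End Real.

(* Main.v *)
Require Import Defs.
From HB Require Import structures.
From mathcomp Require Import all_boot all_order all_algebra.
From mathcomp Require Import all_classical all_reals all_analysis.
From mathcomp Require Import ring lra measurable_realfun.

Set Implicit Arguments.
Unset Strict Implicit.
Unset Printing Implicit Defensive.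

Import Order.TTheory GRing.Theory Num.Theory.
Import numFieldNormedType.Exports.

Local Open Scope classical_set_scope.
Local Open Scope ring_scope.

(* Differentiating the kinetic energy under the integral sign and lowering the index in the
   geodesic equation, a curve [c] is a geodesic iff, for every [X] tangent at [c(t)], the integral
   over [q] in [M] of the inner product of [X~(q)] with the second derivative of [c(t) * q] vanishes.
   Along [c = (g, h)] one has [c * q = g q h^-1], and [X = c (X1, B; B^*, X2)] gives
   [X~(q) = g (X1 q + B - q B^* q - q X2) h^-1]. The contribution of [X1, X2] vanishes iff [c] is a
   geodesic of the subgroup, so that only the contribution of [B] matters.

   On [Sp_1], [B - q B^* q] is even in [q] while the acceleration of [c(t) * q] is odd, whence a).

   On [SO_3], left translations give the first two moments of the entries of [q]. If
   [g' = g hat(u)] and [h' = h hat(w)], the identity [q^T hat(u) q = hat(u q)] reduces the integral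
   to second moments, and it is a nonzero multiple of [u B w^T]. Hence [c] is a geodesic of the large
   group iff [u = 0] or [w = 0] at each time; as geodesics of the subgroup have constant [u] and
   [w], one of them then vanishes identically, whence b).

   The measures are known only through charts: their finiteness, positivity and invariance are
   obtained from one Cayley chart and its translates. *)

(** * Smooth functions *)

(** [geodesic] is a condition in every local parametrization. Drawing a conclusion from it requires
    an explicit chart through each point of the curve, with a smooth lift of the curve; proving it
    means facing an unknown chart. Cayley charts are therefore built for [SO3xSO3], [Oo33] and
    [Sp1xSp1], whereas for [Sp11] the linearized relations satisfied by tangent vectors suffice.

    The Christoffel symbols contain the inverse Gram matrix, so lowering the index presupposes that
    X~ = 0 only for X = 0. This is checked along the subgroup only, where the squared length of X is
    the volume of M times |X1|^2 + |X2|^2 + k |B|^2, with k = 4/3 for SO_3 and k = 3 for Sp_1.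

    The two cases part ways because -1 lies in Sp_1 but not in SO_3: the pairing of q B^* q with the
    mixed term g' q h'^* of the acceleration has degree three in q, hence is odd, and SO_3 has no
    symmetry q -> -q to kill it. The identity for q^T hat(u) q makes it quadratic, so that moments
    of order at most two suffice. *)

Section LinearProps.
Variables (R : realType) (V W : lmodType R) (L : V -> W).
Hypothesis Ll : linear L.
Lemma lin0 : L 0 = 0.
Proof. by have := Ll (-1) 0 0; rewrite scaler0 addr0 scaleN1r addNr. Qed.
Lemma linD x y : L (x + y) = L x + L y.
Proof. by have := Ll 1 x y; rewrite !scale1r. Qed.
Lemma linZ s x : L (s *: x) = s *: L x.
Proof. by have := Ll s x 0; rewrite lin0 !addr0. Qed.
Lemma linN x : L (- x) = - L x.
Proof. by rewrite -scaleN1r linZ scaleN1r. Qed.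
End LinearProps.

Section ClassC.
Variable R : realType.
Implicit Types V W : normedModType R.

Lemma class_C_cont V W k (U : set V) (f : V -> W) x :
  class_C k U f -> U x -> {for x, continuous f}.
Proof. by case: k => [|k] [+ _]; apply. Qed.

Lemma class_C_derivable V W k (U : set V) (f : V -> W) x v :
  class_C k.+1 U f -> U x -> derivable f x v.
Proof. by case=> _ /(_ v)[d _] /d. Qed.
Lemma class_C_derive V W k (U : set V) (f : V -> W) v :
  class_C k.+1 U f -> class_C k U ('D_v f).
Proof. by case=> _ /(_ v)[]. Qed.

Lemma class_C_pred V W k (U : set V) (f : V -> W) :
  class_C k.+1 U f -> class_C k U f.
Proof.
elim: k f => [|k IH] f; first by case.
by move=> [fc fd]; split=> // v; split; [case: (fd v)|apply/IH; case: (fd v)].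
Qed.

Lemma class_C_subset V W k (U U' : set V) (f : V -> W) :
  U' `<=` U -> class_C k U f -> class_C k U' f.
Proof.
move=> UU; elim: k f => [|k IH] f [fc fd].
  by split=> // x /UU; exact: fc.
split=> [x /UU|v]; first exact: fc.
by have [d c] := fd v; split=> [x /UU|]; [exact: d|exact: IH].
Qed.

(** Agreement on an open set is agreement near each of its points, so continuity and directional
    derivatives pass from [f] to [g]. This is how a derivative gets replaced by a formula valid on
    [U] in the closure lemmas below. *)
Lemma class_C_eq V W k (U : set V) (f g : V -> W) :
  open U -> (forall x, U x -> f x = g x) -> class_C k U f -> class_C k U g.
Proof.
move=> oU fg.
have nfg x : U x -> {near x, f =1 g}.
  by move=> Ux; near=> y; apply: fg; near: y; exact: open_nbhs_nbhs.
have cfg x : U x -> {for x, continuous f} -> {for x, continuous g}.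
  move=> Ux; rewrite /prop_for /continuous_at -(fg _ Ux); apply: cvg_trans.
  apply: near_eq_cvg; near=> y; apply: fg; near: y; exact: open_nbhs_nbhs.
elim: k f g {fg} nfg cfg => [|k IH] f g nfg cfg [fc fd].
  by split=> // x Ux; exact/cfg/fc.
split=> [x Ux|v]; first exact/cfg/fc.
have [d c] := fd v; split=> [x Ux|].
  exact: (near_eq_derivable (nfg x Ux) (d _ Ux)).
have e x : U x -> 'D_v f x = 'D_v g x by move=> Ux; exact: near_eq_derive (nfg x Ux).
apply: IH c => x Ux.
  by near=> y; apply: e; near: y; exact: open_nbhs_nbhs.
rewrite /prop_for /continuous_at -(e _ Ux); apply: cvg_trans.
apply: near_eq_cvg; near=> y; apply: e; near: y; exact: open_nbhs_nbhs.
Unshelve. all: by end_near. Qed.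

Lemma class_C_cst V W k (U : set V) (c : W) : class_C k U (fun _ : V => c).
Proof.
elim: k c => [|k IH] c; first by split=> // x _; exact: cst_continuous.
split=> [x _|v]; first exact: cst_continuous.
split=> [x _|]; first exact: derivable_cst.
by rewrite [X in class_C _ _ X](_ : _ = fun=> 0) //; apply/funext => x; rewrite derive_cst.
Qed.

Lemma class_CD V W k (U : set V) (f g : V -> W) : open U ->
  class_C k U f -> class_C k U g -> class_C k U (fun x => f x + g x).
Proof.
move=> oU; elim: k f g => [|k IH] f g [fc fd] [gc gd].
  by split=> // x Ux; apply: cvgD; [exact: fc|exact: gc].
split=> [x Ux|v]; first by apply: cvgD; [exact: fc|exact: gc].
have [df cf] := fd v; have [dg cg] := gd v.
split=> [x Ux|]; first by apply: derivableD; auto.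
apply: class_C_eq (IH _ _ cf cg) => // x Ux.
by rewrite deriveD //; auto.
Qed.

Lemma class_C_sum V W k (U : set V) (T : Type) (r : seq T) (P : pred T)
    (f : T -> V -> W) : open U ->
  (forall i, P i -> class_C k U (f i)) ->
  class_C k U (fun x => \sum_(i <- r | P i) f i x).
Proof.
move=> oU fC; elim: r => [|a r IH].
  by under eq_fun do rewrite big_nil; exact: class_C_cst.
under eq_fun do rewrite big_cons.
by case: (boolP (P a)) => // Pa; apply: class_CD => //; exact: fC.
Qed.

(** Derivability in the direction [v] gives continuity along the line through [x] in that direction,
    which is what the product rule uses. *)
Lemma derivable_cvg V W (f : V -> W) x v :
  derivable f x v -> f (h *: v + x) @[h --> 0^'] --> f x.
Proof.
move=> fd; suff : {for 0, continuous (fun h : R => f (h *: v + x))}.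
  by move=> /continuous_withinNx; rewrite scale0r add0r.
exact/differentiable_continuous/derivable1_diffP/(derivable1P _ _ _).1.
Qed.

(** Continuity is a separate clause because the normed spaces are arbitrary; on matrices and
    quaternions it follows from linearity ([lcm_mx], [lcm_quat]). *)
Definition linear_continuous_map V W (L : V -> W) := linear L /\ continuous L.

Section LinearMap.
Variables (V W : normedModType R) (L : V -> W).
Hypothesis Llin : linear_continuous_map L.

Lemma lcmD x y : L (x + y) = L x + L y.
Proof. by have := Llin.1 1 x y; rewrite !scale1r. Qed.

Lemma lcm0 : L 0 = 0.
Proof. by have /(congr1 (fun z => z - L 0)) := lcmD 0 0; rewrite addr0 addrK subrr. Qed.

Lemma lcmZ a x : L (a *: x) = a *: L x.
Proof. by have := Llin.1 a x 0; rewrite lcm0 !addr0. Qed.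

Lemma lcmB x y : L (x - y) = L x - L y.
Proof. by rewrite lcmD -scaleN1r lcmZ scaleN1r. Qed.

Lemma lcm_sum (T : Type) (r : seq T) (P : pred T) (f : T -> V) :
  L (\sum_(i <- r | P i) f i) = \sum_(i <- r | P i) L (f i).
Proof. by apply: (big_morph L lcmD lcm0). Qed.

Lemma lcm_cvg (T : Type) (F : set_system T) {FF : Filter F} (f : T -> V) a :
  f @ F --> a -> (fun t => L (f t)) @ F --> L a.
Proof. by move=> fa; apply: (@continuous_cvg _ _ _ F FF f L a) => //; exact: Llin.2. Qed.

Lemma is_derive_lcm V' (g : V' -> V) x v dg :
  is_derive x v g dg -> is_derive x v (L \o g) (L dg).
Proof.
move=> [dgx <-].
have H : h^-1 *: (((L \o g) \o shift x) (h *: v) - (L \o g) x) @[h --> 0^'] --> L ('D_v g x).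
  rewrite (_ : (fun h => _) = L \o (fun h => h^-1 *: ((g \o shift x) (h *: v) - g x))).
    by apply: lcm_cvg; exact: dgx.
  by apply/funext => h /=; rewrite lcmZ lcmB.
apply: DeriveDef; first by apply/cvg_ex; eexists; exact: H.
exact: cvg_lim.
Qed.

Lemma class_C_lcm V' k (U : set V') (f : V' -> V) : open U ->
  class_C k U f -> class_C k U (fun x => L (f x)).
Proof.
move=> oU; elim: k f => [|k IH] f [fc fd].
  by split=> // x Ux; apply: lcm_cvg; exact: fc.
split=> [x Ux|v]; first by apply: lcm_cvg; exact: fc.
have [d c] := fd v.
have H x : U x -> is_derive x v (L \o f) (L ('D_v f x)).
  by move=> Ux; exact: (is_derive_lcm (derivableP (d _ Ux))).
split=> [x /H[]//|].
by apply: class_C_eq (IH _ c) => // x /H[].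
Qed.

Lemma class_C_lin k (U : set V) : class_C k U L.
Proof.
apply: (@class_C_subset _ _ _ setT) => //.
case: k => [|k]; first by split=> // x _; exact: Llin.2.
split=> [x _|v]; first exact: Llin.2.
have H x : is_derive x v L (L v).
  by have := @is_derive_lcm _ id x v v (is_derive_id _ _).
split=> [x _|]; first by case: (H x).
rewrite (_ : (fun _ => _) = fun=> L v); first exact: class_C_cst.
by apply/funext => x; case: (H x).
Qed.

(* Derivatives of [f \o L] are computed from the same difference quotients. *)
Lemma derive_affine W' (f : W -> W') a x v :
  'D_v (fun x => f (L x + a)) x = 'D_(L v) f (L x + a) /\
  (derivable (fun x => f (L x + a)) x v <-> derivable f (L x + a) (L v)).
Proof.
rewrite /derive /derivable.
have -> // : (fun h => h^-1 *: (((fun x => f (L x + a)) \o shift x) (h *: v) - f (L x + a))) =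
  (fun h => h^-1 *: ((f \o shift (L x + a)) (h *: L v) - f (L x + a))).
by apply/funext => h /=; rewrite lcmD lcmZ addrA.
Qed.
End LinearMap.

(** By [derive_affine], the derivative of the composite along [v] is a composite of the same kind,
    with [f] replaced by its derivative along [L v]; the induction closes without a chain rule. *)
Lemma class_C_affine V V' W k (U : set V') (U' : set V) (L : V' -> V) (f : V -> W) a :
  linear_continuous_map L ->
  (forall x, U x -> U' (L x + a)) ->
  class_C k U' f -> class_C k U (fun x => f (L x + a)).
Proof.
move=> LL UU.
have cL : continuous (fun x => L x + a).
  by move=> x; apply: cvgD; [exact: LL.2|exact: cvg_cst].
elim: k f => [|k IH] f [fc fd].
  split=> // x Ux; apply: (@continuous_comp _ _ _ (fun x => L x + a) f); [exact: cL|exact/fc/UU].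
split=> [x Ux|v].
  apply: (@continuous_comp _ _ _ (fun x => L x + a) f); [exact: cL|exact/fc/UU].
have [d c] := fd (L v).
split=> [x Ux|]; first exact: ((derive_affine LL f a x v).2.2 (d _ (UU _ Ux))).
have -> : 'D_v (fun x => f (L x + a)) = fun x => 'D_(L v) f (L x + a).
  by apply/funext => x; rewrite (derive_affine LL f a x v).1.
exact: IH c.
Qed.

Definition bilinear_continuous_map V1 V2 W (B : V1 -> V2 -> W) :=
  [/\ forall x, linear (B x), forall y, linear (B^~ y) &
      continuous (fun z : V1 * V2 => B z.1 z.2)].

Section BilinearMap.
Variables (V1 V2 W : normedModType R) (B : V1 -> V2 -> W).
Hypothesis Bbil : bilinear_continuous_map B.

Lemma bcm_lcml x : linear_continuous_map (B x).
Proof.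
case: Bbil => Bl _ Bc; split=> [|y]; first exact: Bl.
apply: (@continuous_comp _ _ _ (fun y => (x, y)) (fun z => B z.1 z.2)).
  by apply: cvg_pair; [exact: cvg_cst|exact: cvg_id].
exact: Bc.
Qed.

Lemma bcm_lcmr y : linear_continuous_map (B^~ y).
Proof.
case: Bbil => _ Br Bc; split=> [|x]; first exact: Br.
apply: (@continuous_comp _ _ _ (fun x => (x, y)) (fun z => B z.1 z.2)).
  by apply: cvg_pair; [exact: cvg_id|exact: cvg_cst].
exact: Bc.
Qed.

Lemma bcm_cvg (T : Type) (F : set_system T) {FF : Filter F} (f : T -> V1) (g : T -> V2) a b :
  f @ F --> a -> g @ F --> b -> (fun t => B (f t) (g t)) @ F --> B a b.
Proof.
move=> fa gb; case: Bbil => _ _ Bc.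
exact: (@continuous2_cvg _ _ _ _ F FF f g B a b (Bc (a, b)) fa gb).
Qed.

(** The usual splitting of the difference quotient, for any continuous bilinear map: scalings,
    matrix products and quaternion products are all instances. *)
Lemma is_derive_bcm V (f : V -> V1) (g : V -> V2) x v df dg :
  is_derive x v f df -> is_derive x v g dg ->
  is_derive x v (fun y => B (f y) (g y)) (B df (g x) + B (f x) dg).
Proof.
move=> [dfx <-] [dgx <-].
have gc : g (h *: v + x) @[h --> 0^'] --> g x.
  exact: derivable_cvg dgx.
have H : h^-1 *: (((fun y => B (f y) (g y)) \o shift x) (h *: v) - B (f x) (g x)) @[h --> 0^']
    --> B ('D_v f x) (g x) + B (f x) ('D_v g x).
  rewrite (_ : (fun h => _) = (fun h =>
      B (h^-1 *: ((f \o shift x) (h *: v) - f x)) (g (h *: v + x)) +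
      B (f x) (h^-1 *: ((g \o shift x) (h *: v) - g x)))).
    by apply: cvgD; apply: bcm_cvg => //; apply: cvg_cst.
  apply/funext => h /=.
  rewrite (lcmZ (bcm_lcmr _)) (lcmZ (bcm_lcml _)) (lcmB (bcm_lcmr _)) (lcmB (bcm_lcml _)).
  by rewrite -scalerDr addrA subrK.
apply: DeriveDef; first by apply/cvg_ex; eexists; exact: H.
exact: cvg_lim.
Qed.

Lemma class_C_bcm V k (U : set V) (f : V -> V1) (g : V -> V2) : open U ->
  class_C k U f -> class_C k U g -> class_C k U (fun x => B (f x) (g x)).
Proof.
move=> oU; elim: k f g => [|k IH] f g fC gC.
  by split=> // x Ux; apply: bcm_cvg; [case: fC => + _; exact|case: gC => + _; exact].
split=> [x Ux|v].
  by apply: bcm_cvg; [case: fC => + _; exact|case: gC => + _; exact].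
have H x : U x -> is_derive x v (fun y => B (f y) (g y)) (B ('D_v f x) (g x) + B (f x) ('D_v g x)).
  move=> Ux; exact: is_derive_bcm (derivableP (class_C_derivable fC Ux)) (derivableP (class_C_derivable gC Ux)).
split=> [x /H[]//|].
apply: (@class_C_eq _ _ _ _ (fun x => B ('D_v f x) (g x) + B (f x) ('D_v g x))) => //.
  by move=> x /H[].
apply: class_CD => //; apply: IH => //; try exact: class_C_pred; exact: class_C_derive.
Qed.
End BilinearMap.

Lemma bilinear_continuous_mulr : bilinear_continuous_map (fun x y : R => x * y).
Proof.
split=> [x a y z|y a x z|].
- by rewrite mulrDr; congr (_ + _); rewrite /GRing.scale /=; ring.
- by rewrite mulrDl; congr (_ + _); rewrite /GRing.scale /=; ring.
- exact: mul_continuous.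
Qed.

Lemma bilinear_continuous_scaler W : bilinear_continuous_map (fun (x : R) (y : W) => x *: y).
Proof.
split=> [x a y z|y a x z|].
- by rewrite scalerDr !scalerA mulrC.
- by rewrite scalerDl scalerA.
- exact: scale_continuous.
Qed.

Lemma class_CM V k (U : set V) (f g : V -> R) : open U ->
  class_C k U f -> class_C k U g -> class_C k U (fun x => f x * g x).
Proof. exact/class_C_bcm/bilinear_continuous_mulr. Qed.

Lemma class_CN V W k (U : set V) (f : V -> W) : open U ->
  class_C k U f -> class_C k U (fun x => - f x).
Proof.
move=> oU; apply: class_C_lcm => //; split; last exact: opp_continuous.
by move=> a x y; rewrite opprD scalerN.
Qed.

Lemma class_CB V W k (U : set V) (f g : V -> W) : open U ->
  class_C k U f -> class_C k U g -> class_C k U (fun x => f x - g x).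
Proof. by move=> oU fC gC; apply: class_CD => //; exact: class_CN. Qed.

Lemma class_C_prod V k (U : set V) (T : Type) (r : seq T) (P : pred T)
    (f : T -> V -> R) : open U ->
  (forall i, P i -> class_C k U (f i)) ->
  class_C k U (fun x => \prod_(i <- r | P i) f i x).
Proof.
move=> oU fC; elim: r => [|a r IH].
  by under eq_fun do rewrite big_nil; exact: class_C_cst.
under eq_fun do rewrite big_cons.
by case: (boolP (P a)) => // Pa; apply: class_CM => //; exact: fC.
Qed.

(** The derivative is [- f^-1 * f^-1 * 'D_v f], whose factors are covered by the induction
    hypothesis. *)
Lemma class_CV V k (U : set V) (f : V -> R) : open U ->
  (forall x, U x -> f x != 0) ->
  class_C k U f -> class_C k U (fun x => (f x)^-1).
Proof.
move=> oU f0; elim: k => [|k IH] fC.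
  by split=> // x Ux; apply: cvgV; [exact: f0|case: fC => + _; exact].
split=> [x Ux|v]; first by apply: cvgV; [exact: f0|case: fC => + _; exact].
split=> [x Ux|].
  by apply: derivableV; [exact: f0|exact: class_C_derivable fC Ux].
apply: (@class_C_eq _ _ _ _ (fun x => - ((f x)^-1 * (f x)^-1 * 'D_v f x))) => //.
  move=> x Ux; rewrite deriveV ?f0 //; last exact: class_C_derivable fC Ux.
  by rewrite scaleNr /GRing.scale /= -exprVn expr2.
apply: class_CN => //; apply: class_CM => //; last exact: class_C_derive.
by apply: class_CM => //; apply: IH; exact: class_C_pred.
Qed.
End ClassC.

Lemma cvg_sum (R : realType) (V : normedModType R) (T : Type) (F : set_system T)
    {FF : Filter F} (I : Type) (r : seq I) (P : pred I) (f : I -> T -> V) (a : I -> V) :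
  (forall i, P i -> f i x @[x --> F] --> a i) ->
  \sum_(i <- r | P i) f i x @[x --> F] --> \sum_(i <- r | P i) a i.
Proof.
move=> fa; elim: r => [|i r IH].
  by rewrite big_nil; under eq_fun do rewrite big_nil; exact: cvg_cst.
rewrite big_cons; under eq_fun do rewrite big_cons.
by case: (boolP (P i)) => // Pi; apply: cvgD => //; exact: fa.
Qed.

(** * Smooth functions with matrix values *)

Section ClassCMatrix.
Variable R : realType.
Implicit Types V W : normedModType R.

Lemma lcm_coord m n i j : linear_continuous_map (fun A : 'M[R]_(m, n) => A i j).
Proof. by split=> [a A B|]; [rewrite !mxE|exact: coord_continuous]. Qed.

Lemma mx_sum_coord m n (A : 'M[R]_(m, n)) :
  A = \sum_i \sum_j A i j *: delta_mx i j.
Proof. exact: matrix_sum_delta. Qed.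

Lemma cvg_mx (T : Type) (F : set_system T) {FF : Filter F} m n (f : T -> 'M[R]_(m, n)) (A : 'M[R]_(m, n)) :
  (forall i j, f x i j @[x --> F] --> A i j) -> f @ F --> A.
Proof.
move=> fA; rewrite (mx_sum_coord A).
have -> : f = fun x => \sum_i \sum_j f x i j *: delta_mx i j.
  by apply/funext => x; exact: mx_sum_coord.
apply: cvg_sum => i _; apply: cvg_sum => j _.
exact: (lcm_cvg (bcm_lcmr (bilinear_continuous_scaler _) _) (fA i j)).
Qed.

Lemma class_C_mx V k (U : set V) m n (f : V -> 'M[R]_(m, n)) : open U ->
  (forall i j, class_C k U (fun x => f x i j)) -> class_C k U f.
Proof.
move=> oU fC.
have -> : f = fun x => \sum_i \sum_j f x i j *: delta_mx i j.
  by apply/funext => x; exact: mx_sum_coord.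
apply: class_C_sum => // i _; apply: class_C_sum => // j _.
exact: (class_C_lcm (bcm_lcmr (bilinear_continuous_scaler _) (delta_mx i j)) oU (fC i j)).
Qed.

Lemma class_C_coord V k (U : set V) m n (f : V -> 'M[R]_(m, n)) i j : open U ->
  class_C k U f -> class_C k U (fun x => f x i j).
Proof. exact: (class_C_lcm (lcm_coord i j)). Qed.

Lemma class_C_mulmx V k (U : set V) m n p (f : V -> 'M[R]_(m, n)) (g : V -> 'M[R]_(n, p)) :
  open U -> class_C k U f -> class_C k U g -> class_C k U (fun x => f x *m g x).
Proof.
move=> oU fC gC; apply: class_C_mx => // i j.
under eq_fun do rewrite mxE.
by apply: class_C_sum => // l _; apply: class_CM => //; exact: class_C_coord.
Qed.

Lemma class_C_det V k (U : set V) n (f : V -> 'M[R]_n) : open U ->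
  class_C k U f -> class_C k U (fun x => \det (f x)).
Proof.
move=> oU fC; apply: class_C_sum => // s _; apply: class_CM => //; first exact: class_C_cst.
by apply: class_C_prod => // i _; exact: class_C_coord.
Qed.

(** Cramer's rule: the entries of the adjugate and the determinant are polynomials in the
    entries. *)
Lemma class_C_invmx V k (U : set V) n (f : V -> 'M[R]_n) : open U ->
  (forall x, U x -> f x \in unitmx) ->
  class_C k U f -> class_C k U (fun x => invmx (f x)).
Proof.
move=> oU fU fC; apply: (@class_C_eq _ _ _ _ _ (fun x => (\det (f x))^-1 *: \adj (f x))) => //.
  by move=> x /fU fx; rewrite /invmx fx.
apply: class_C_mx => // i j.
under eq_fun do rewrite !mxE.
apply: class_CM => //.
  apply: class_CV => //; last exact: class_C_det.
  by move=> x /fU; rewrite unitmxE unitfE.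
apply: class_CM => //; first exact: class_C_cst.
apply: class_C_det => //; apply: class_C_mx => // a b.
by under eq_fun do rewrite !mxE; exact: class_C_coord.
Qed.

Lemma bilinear_continuous_mulmx m n p :
  bilinear_continuous_map (fun (A : 'M[R]_(m, n)) (B : 'M[R]_(n, p)) => A *m B).
Proof.
split=> [A a B C|B a A C|[A B]].
- by rewrite mulmxDr scalemxAr.
- by rewrite mulmxDl scalemxAl.
- apply: cvg_mx => i j.
  rewrite mxE; under eq_fun do rewrite mxE.
  apply: cvg_sum => k _; apply: cvgM.
    apply: (lcm_cvg (lcm_coord i k)); exact: cvg_fst.
  apply: (lcm_cvg (lcm_coord k j)); exact: cvg_snd.
Qed.

Lemma lcm_fst V W : linear_continuous_map (fst : V * W -> V).
Proof. by split=> // x; exact: cvg_fst. Qed.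

Lemma lcm_snd V W : linear_continuous_map (snd : V * W -> W).
Proof. by split=> // x; exact: cvg_snd. Qed.

Lemma lcm_inl V W : linear_continuous_map (fun x : V => (x, 0 : W)).
Proof.
split=> [a x y|x].
  by apply: injective_projections => //=; rewrite scaler0 addr0.
by apply: cvg_pair; [exact: cvg_id|exact: cvg_cst].
Qed.

Lemma ler_mx_coord m n (A : 'M[R]_(m, n)) i j : `|A i j| <= `|A|.
Proof. by rewrite [leRHS]mx_normrE; exact: (le_bigmax _ (fun ij => `|A ij.1 ij.2|) (i, j)). Qed.

Lemma ler_mx_norm m n (A : 'M[R]_(m, n)) c : 0 <= c ->
  (forall i j, `|A i j| <= c) -> `|A| <= c.
Proof. by move=> c0 Ac; rewrite [leLHS]mx_normrE; apply: bigmax_le => // -[i j] _; exact: Ac. Qed.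
End ClassCMatrix.

(** * Mean value theorem, chain rule and symmetry of second derivatives *)

Section MeanValue.
Variable R : realType.
Implicit Types V : normedModType R.

Lemma lcm_scalel V (v : V) : linear_continuous_map (fun s : R => s *: v).
Proof. exact: bcm_lcmr (bilinear_continuous_scaler _) v. Qed.

(** The mean value theorem for [s |-> f (s *: v + x)]. Both signs of [h] are allowed, which is why
    the intermediate point is located by absolute values. *)
Lemma mean_value_dir V (f : V -> R) x v (h : R) :
  (forall s : R, `|s| <= `|h| -> derivable f (s *: v + x) v) ->
  exists2 s : R, `|s| <= `|h| & f (h *: v + x) - f x = h * 'D_v f (s *: v + x).
Proof.
move=> fd.
pose g (s : R) := f (s *: v + x).
have gd (s : R) : `|s| <= `|h| -> is_derive s 1 g ('D_v f (s *: v + x)).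
  move=> sh; have [e d] := derive_affine (lcm_scalel v) f x s 1.
  rewrite scale1r in e d; apply: DeriveDef; [exact: d.2 (fd _ sh)|exact: e].
have gc (s : R) : `|s| <= `|h| -> {for s, continuous g}.
  by move=> /gd[gs _]; apply/differentiable_continuous/derivable1_diffP.
have [h0|h0] := leP 0 h.
  have [s|| s sI e] := @MVT_segment R g (fun s => 'D_v f (s *: v + x)) 0 h h0.
  - rewrite in_itv /= => /andP[s0 sh]; apply: gd.
    by rewrite !ger0_norm // ltW.
  - apply: continuous_in_subspaceT => s; rewrite inE /= in_itv /= => /andP[s0 sh].
    by apply: gc; rewrite !ger0_norm.
  - exists s; first by move: sI; rewrite in_itv /= => /andP[s0 sh]; rewrite !ger0_norm.
    by move: e; rewrite /g scale0r add0r subr0 mulrC.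
have [s|| s sI e] := @MVT_segment R g (fun s => 'D_v f (s *: v + x)) h 0 (ltW h0).
- rewrite in_itv /= => /andP[s0 sh]; apply: gd.
  by rewrite !ler0_norm ?lerN2 // ltW.
- apply: continuous_in_subspaceT => s; rewrite inE /= in_itv /= => /andP[s0 sh].
  by apply: gc; rewrite !ler0_norm ?lerN2 // ltW.
- exists s.
    by move: sI; rewrite in_itv /= => /andP[s0 sh]; rewrite !ler0_norm ?lerN2 // ltW.
  move: e; rewrite /g scale0r add0r sub0r => e.
  by rewrite -opprB e mulrN opprK mulrC.
Qed.

(** Go from [x] to [h + x] by changing one coordinate at a time and apply the mean value theorem to
    each step. As [class_C] only speaks of directional derivatives, this first-order expansion is
    the source of the chain rule. *)
Lemma C1_increment d (U : set 'rV[R]_d) (f : 'rV[R]_d -> R) x e : open U ->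
  class_C 1 U f -> U x -> 0 < e ->
  exists2 r, 0 < r & forall h, `|h| < r ->
    `|f (h + x) - f x - \sum_i h 0 i * partial i f x| <= e * `|h|.
Proof.
move=> oU fC Ux e0.
(* Each of the [d] coordinate steps costs at most [e'] times the norm of [h]; [d.+1] keeps the
   divisor nonzero when [d = 0]. *)
pose e' := e / d.+1%:R.
have e'0 : 0 < e' by rewrite divr_gt0.
have : \forall y \near x, U y /\ forall i, `|partial i f x - partial i f y| <= e'.
  near=> y; split; first by near: y; exact: open_nbhs_nbhs.
  move=> i; move: i; near: y; apply: filter_forall => i.
  have := class_C_cont (class_C_derive (delta_mx 0 i) fC) Ux.
  by move=> /cvgrPdist_le /(_ _ e'0).
move=> /nbhs_normP[r /= r0 rU]; exists r => // h hr.
have rP y : `|y| <= `|h| -> U (y + x) /\ forall i, `|partial i f x - partial i f (y + x)| <= e'.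
  move=> yh; apply: rU; rewrite /= opprD addrCA subrr addr0 normrN.
  exact: le_lt_trans hr.
(* The first [k] coordinates of [h], completed by zeros. *)
pose hk k : 'rV[R]_d := \row_j (if (j < k)%N then h 0 j else 0).
have step k : (k <= d)%N ->
    `|f (hk k + x) - f x - \sum_(i < d | (i < k)%N) h 0 i * partial i f x| <= k%:R * (e' * `|h|).
  elim: k => [|k IH] kd.
    rewrite big_pred0 // (_ : hk 0%N = 0) ?add0r ?subrr ?subr0 ?normr0 ?mul0r //.
    by apply/rowP => j; rewrite !mxE.
  have {}IH := IH (ltnW kd).
  pose i0 := Ordinal kd.
  have hS : hk k.+1 = h 0 i0 *: delta_mx 0 i0 + hk k.
    apply/rowP => j; rewrite !mxE eqxx /= -val_eqE /= ltnS leq_eqVlt.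
    case: eqP => [jk|_] /=; last by rewrite mulr0 add0r.
    by rewrite (_ : j = i0) ?ltnn ?mulr1 ?addr0 //; exact: val_inj.
  have nb (s : R) : `|s| <= `|h 0 i0| -> `|s *: delta_mx 0 i0 + hk k| <= `|h|.
    move=> sh; apply: ler_mx_norm => // i j; rewrite !mxE ord1 eqxx /=.
    have [->|ji] := eqVneq j i0.
      by rewrite ltnn addr0 mulr1 (le_trans sh) // ler_mx_coord.
    rewrite mulr0 add0r; case: ifP => _; first exact: ler_mx_coord.
    by rewrite normr0.
  have [s|s sh es] := @mean_value_dir _ f (hk k + x) (delta_mx 0 i0) (h 0 i0).
    move=> sh; apply: class_C_derivable fC _.
    by rewrite addrA; case: (rP _ (nb _ sh)).
  rewrite (bigD1 i0) //= (eq_bigl (fun i : 'I_d => (i < k)%N)); last first.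
    move=> i /=; rewrite ltnS leq_eqVlt -val_eqE /=.
    by case: ltngtP => //= ->; rewrite ltnn.
  rewrite hS -[_ + _ + x]addrA.
  have E (a b c p q : R) : a - b - (p + q) = (a - c - p) + (c - b - q) by ring.
  rewrite (E _ _ (f (hk k + x))).
  move: IH; set IHs := (X in `|X| <= _) => IH.
  apply: le_trans (ler_normD _ _) _.
  rewrite -nat1r mulrDl mul1r; apply: lerD => //.
  rewrite es -mulrBr normrM mulrC; apply: ler_pM (normr_ge0 _) (normr_ge0 _) _ (ler_mx_coord h 0 i0).
  by rewrite addrA distrC; case: (rP _ (nb _ sh)).
have := step d (leqnn d).
rewrite (_ : hk d = h); last by apply/rowP => j; rewrite !mxE ltn_ord.
have -> : \sum_(i < d | (i < d)%N) h 0 i * partial i f x = \sum_i h 0 i * partial i f x.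
  by apply: eq_bigl => i; rewrite ltn_ord.
move/le_trans; apply; rewrite mulrA ler_wpM2r //.
by rewrite /e' mulrCA ger_pMr // ler_pdivrMr // mul1r ler_nat.
Unshelve. all: by end_near. Qed.

(** If the quotient [D s] of [x] replaces its derivative in the claimed value, the difference from
    the quotient of [f \o x] is the error of [C1_increment] divided by [s]; it tends to 0 because
    [D s] stays bounded. *)
Lemma is_derive_chain d (U : set 'rV[R]_d) (f : 'rV[R]_d -> R) (x : R -> 'rV[R]_d) t :
  open U -> class_C 1 U f -> U (x t) -> derivable x t 1 ->
  is_derive t 1 (f \o x) (\sum_i (derive1 x t) 0 i * partial i f (x t)).
Proof.
move=> oU fC Ux xd.
pose D (s : R) := s^-1 *: (x (s *: 1 + t) - x t).
have cD : D s @[s --> 0^'] --> derive1 x t by rewrite derive1E; exact: xd.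
have cx : x (s *: 1 + t) @[s --> 0^'] --> x t.
  exact: derivable_cvg xd.
pose q (s : R) := s^-1 *: (((f \o x) \o shift t) (s *: 1) - (f \o x) t).
have H : q s @[s --> 0^'] --> \sum_i (derive1 x t) 0 i * partial i f (x t).
  have -> : q = (fun s => (q s - \sum_i D s 0 i * partial i f (x t)) +
      \sum_i D s 0 i * partial i f (x t)) by apply/funext => s; rewrite subrK.
  rewrite -[X in _ --> X]add0r; apply: cvgD; last first.
    apply: cvg_sum => i _; apply: cvgM; last exact: cvg_cst.
    have := lcm_cvg (lcm_coord R (0 : 'I_1) i) cD; exact.
  apply/cvgr0Pnorm_le => e e0.
  (* Near 0 the norm of [D s] is at most that of the derivative plus 1, so this relative error
     becomes an absolute error [e]. *)
  pose e' := e / (`|derive1 x t| + 1).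
  have e'0 : 0 < e' by rewrite divr_gt0 // ltr_wpDl.
  have [r r0 rP] := C1_increment oU fC Ux e'0.
  near=> s.
  have s0 : s != 0 by near: s; exact: nbhs_dnbhs_neq.
  have hr : `|x (s *: 1 + t) - x t| < r.
    near: s; move/cvgrPdist_lt : cx => /(_ _ r0); apply: filterS => s.
    by rewrite distrC.
  have Db : `|D s| <= `|derive1 x t| + 1.
    rewrite -lerBlDl; apply: le_trans (ler_norm _) _.
    apply: le_trans (ler_dist_dist _ _) _.
    rewrite distrC; near: s; move/cvgrPdist_le : cD; exact.
  have := rP _ hr; rewrite subrK => le1.
  have -> : q s - \sum_i D s 0 i * partial i f (x t) =
      s^-1 * (f (x (s *: 1 + t)) - f (x t) -
        \sum_i (x (s *: 1 + t) - x t) 0 i * partial i f (x t)).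
    rewrite mulrBr mulr_sumr; congr (_ - _).
    by apply: eq_bigr => i _; rewrite /D mxE mulrA.
  rewrite normrM (le_trans (ler_wpM2l (normr_ge0 _) le1)) //.
  rewrite mulrCA -normrZ (le_trans (ler_wpM2l (ltW e'0) Db)) //.
  by rewrite /e' -mulrA mulVf ?mulr1 // gt_eqF // ltr_wpDl.
apply: DeriveDef; first by apply/cvg_ex; eexists; exact: H.
exact: cvg_lim.
Unshelve. all: by end_near. Qed.

(** Schwarz's argument: the mixed difference of [f] over the parallelogram with sides [a *: u],
    [a *: v] is, by two mean value theorems taken in either order, [a^2] times a mixed derivative at
    some point near [x]. Continuity of both mixed derivatives at [x] concludes. *)
Lemma derive_comm V (U : set V) (f : V -> R) x u v : open U ->
  class_C 2 U f -> U x -> 'D_u ('D_v f) x = 'D_v ('D_u f) x.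
Proof.
move=> oU fC Ux; apply/eqP; rewrite -subr_eq0 -normr_le0; apply/ler_addgt0Pl => e e0.
rewrite addr0.
have e20 : 0 < e / 2 by rewrite divr_gt0.
have cont a b := class_C_cont (class_C_derive b (class_C_derive a fC)) Ux.
have : \forall y \near x, [/\ U y, `|'D_u ('D_v f) x - 'D_u ('D_v f) y| <= e / 2 &
    `|'D_v ('D_u f) x - 'D_v ('D_u f) y| <= e / 2].
  have A1 := open_nbhs_nbhs (conj oU Ux).
  move/cvgrPdist_le : (cont v u) => /(_ _ e20) A2.
  move/cvgrPdist_le : (cont u v) => /(_ _ e20) A3.
  by apply: filterS (filterI A1 (filterI A2 A3)) => y [Uy [B2 B3]]; exact: And3 Uy B2 B3.
move=> /nbhs_normP[r /= r0 rU].
(* With this length the whole parallelogram lies in the ball of radius [r]; the [+ 1] covers the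
   case [u = v = 0]. *)
pose a := r / (`|u| + `|v| + 1).
have n0 : 0 < `|u| + `|v| + 1 by rewrite ltr_wpDl // addr_ge0.
have a0 : 0 < a by rewrite divr_gt0.
have rP (s s' : R) : `|s| <= `|a| -> `|s'| <= `|a| -> [/\ U (s *: u + (s' *: v + x)),
    `|'D_u ('D_v f) x - 'D_u ('D_v f) (s *: u + (s' *: v + x))| <= e / 2 &
    `|'D_v ('D_u f) x - 'D_v ('D_u f) (s *: u + (s' *: v + x))| <= e / 2].
  move=> sa s'a; apply: rU; rewrite /= addrA opprD addrCA subrr addr0 normrN.
  apply: le_lt_trans (ler_normD _ _) _; rewrite !normrZ.
  apply: (@le_lt_trans _ _ (a * (`|u| + `|v|))).
    by rewrite mulrDr lerD // ler_wpM2r // (le_trans sa _, le_trans s'a _) // ger0_norm // ltW.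
  by rewrite /a -mulrA gtr_pMr // mulrC ltr_pdivrMr // mul1r ltrDl.
have aa : `|0 : R| <= `|a| by rewrite normr0.
have fdir w (s s' : R) : `|s| <= `|a| -> `|s'| <= `|a| -> derivable f (s *: u + (s' *: v + x)) w.
  by move=> sa s'a; apply: class_C_derivable fC _; case: (rP _ _ sa s'a).
have fdir2 w w' (s s' : R) : `|s| <= `|a| -> `|s'| <= `|a| ->
    derivable ('D_w f) (s *: u + (s' *: v + x)) w'.
  move=> sa s'a; apply: class_C_derivable (class_C_derive w fC) _.
  by case: (rP _ _ sa s'a).
pose g1 (y : V) := f (a *: v + y) - f y.
pose g2 (y : V) := f (a *: u + y) - f y.
have shiftD (c : V) w y : derivable f (c + y) w ->
    is_derive y w (fun y => f (c + y)) ('D_w f (c + y)).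
  move=> fd.
  have [e1 d1] := @derive_affine R V V id (conj (fun _ _ _ => erefl) (fun _ => cvg_id)) _ f c y w.
  have -> : (fun y => f (c + y)) = (fun y => f (id y + c)) by apply/funext => z; rewrite addrC.
  rewrite addrC; apply: DeriveDef; last exact: e1.
  by apply: d1.2; rewrite addrC.
have D1 (s : R) : `|s| <= `|a| -> is_derive (s *: u + x) u g1
    ('D_u f (a *: v + (s *: u + x)) - 'D_u f (s *: u + x)).
  move=> sa; apply: is_deriveB.
    by apply: shiftD; rewrite addrCA; exact: fdir.
  apply/derivableP; have := fdir u s 0 sa aa.
  by rewrite scale0r add0r.
have D2 (s : R) : `|s| <= `|a| -> is_derive (s *: v + x) v g2
    ('D_v f (a *: u + (s *: v + x)) - 'D_v f (s *: v + x)).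
  move=> sa; apply: is_deriveB.
    by apply: shiftD; exact: fdir.
  apply/derivableP; have := fdir v 0 s aa sa.
  by rewrite scale0r add0r.
have [s sa E1] := @mean_value_dir V g1 x u a (fun s sa => let: DeriveDef d _ := D1 s sa in d).
have [s' s'a E2] := @mean_value_dir V g2 x v a (fun s sa => let: DeriveDef d _ := D2 s sa in d).
have [t ta F1] := @mean_value_dir V ('D_u f) (s *: u + x) v a
  (fun t ta => eq_ind _ (fun z => derivable ('D_u f) z v) (fdir2 u v s t sa ta) _ (addrCA _ _ _)).
have [t' t'a F2] := @mean_value_dir V ('D_v f) (s' *: v + x) u a
  (fun t ta => fdir2 v u t s' ta s'a).
move: E1 E2; case: (D1 s sa) => _ ->; case: (D2 s' s'a) => _ ->; rewrite F1 F2 => E1 E2.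
have E : 'D_v ('D_u f) (s *: u + (t *: v + x)) = 'D_u ('D_v f) (t' *: u + (s' *: v + x)).
  have a_neq0 : a != 0 by rewrite gt_eqF.
  apply: (mulfI a_neq0); apply: (mulfI a_neq0).
  have E0 (A B C D : R) : A - B - (C - D) = A - C - (B - D) by ring.
  rewrite (addrCA (s *: u) (t *: v) x).
  apply: etrans (esym E1) _; apply: etrans _ E2.
  rewrite /g1 /g2 E0.
  rewrite (addrCA (a *: v) (a *: u) x).
  reflexivity.
have [_ _ B1] := rP _ _ sa ta; have [_ B2 _] := rP _ _ t'a s'a.
rewrite -E in B2.
have E' (p q r' : R) : p - q = (p - r') - (q - r') by ring.
rewrite (E' _ _ ('D_v ('D_u f) (s *: u + (t *: v + x)))).
apply: le_trans (ler_normB _ _) _.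
rewrite [leRHS](splitr e); exact: lerD B2 B1.
Qed.
End MeanValue.

(** * Integrals depending on a parameter *)

Lemma is_derive_bigsum (R : realType) (V W : normedModType R) (I : Type) (r : seq I)
    (f : I -> V -> W) x v (df : I -> W) :
  (forall i, is_derive x v (f i) (df i)) ->
  is_derive x v (fun z => \sum_(i <- r) f i z) (\sum_(i <- r) df i).
Proof.
move=> fd; elim: r => [|i r IH].
  by rewrite big_nil; under eq_fun do rewrite big_nil; exact: is_derive_cst.
by rewrite big_cons; under eq_fun do rewrite big_cons; exact: is_deriveD.
Qed.

Lemma lcm_comp (R : realType) (V W X : normedModType R) (L1 : W -> X) (L2 : V -> W) :
  linear_continuous_map L1 -> linear_continuous_map L2 ->
  linear_continuous_map (fun x => L1 (L2 x)).
Proof.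
move=> H1 H2; split; first by move=> a x y; rewrite (lcmD H2) (lcmZ H2) (lcmD H1) (lcmZ H1).
by move=> x; apply: (continuous_comp (H2.2 x) (H1.2 (L2 x))).
Qed.

Lemma continuous_pairl (R : realType) (V W : normedModType R) (y : V) :
  continuous (fun q : W => (y, q)).
Proof. by move=> q; apply: cvg_pair; [exact: cvg_cst|exact: cvg_id]. Qed.

Lemma continuous_pairr (R : realType) (V W : normedModType R) (q : W) :
  continuous (fun y : V => (y, q)).
Proof. by move=> y; apply: cvg_pair; [exact: cvg_id|exact: cvg_cst]. Qed.

Section BorelIntegral.
Variables (R : realType) (F : normedModType R) (M : set F).
Variable mu : {measure set (borel F) -> \bar R}.
Hypothesis cM : compact M.
Hypothesis muM : (mu M < +oo)%E.

Lemma borel_open (O : set F) : open O -> measurable (O : set (borel F)).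
Proof. by move=> oO; exact: sub_sigma_algebra. Qed.

Lemma borel_compact : measurable (M : set (borel F)).
Proof.
rewrite -(setCK M); apply: measurableC; apply: borel_open.
by apply: closed_openC; apply: compact_closed cM; exact: norm_hausdorff.
Qed.

Definition cont_on (g : F -> R) := forall q, M q -> {for q, continuous g}.

(** The preimage of an open interval need not be open, but it is a neighbourhood of each of its
    points in [M], so it has the same trace on [M] as its interior. *)
Lemma cont_on_measurable (g : F -> R) : cont_on g ->
  measurable_fun (M : set (borel F)) (g : borel F -> R).
Proof.
move=> gc; apply: (measurability _ (measurable_realfun.RGenOpens.measurableE R)).
move=> _ [_ [a [b ->] <-]].
have -> : M `&` g @^-1` `]a, b[ = M `&` (g @^-1` `]a, b[)°.
  apply/seteqP; split=> q [Mq qg]; split=> //.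
    by apply: gc => //; apply: open_nbhs_nbhs; split=> //; exact: interval_open.
  exact: interior_subset.
by apply: measurableI; [exact: borel_compact|apply: borel_open; exact: open_interior].
Qed.

Lemma cont_on_within (g : F -> R) : cont_on g -> {within M, continuous g}.
Proof. by move=> gc; apply: continuous_in_subspaceT => q; rewrite inE; exact: gc. Qed.

Lemma cont_on_bounded (g : F -> R) : cont_on g ->
  exists2 C, 0 <= C & forall q, M q -> `|g q| <= C.
Proof.
move=> gc; have [M0|M0] := pselect (M !=set0); last first.
  by exists 0 => // q Mq; exfalso; apply: M0; exists q.
have nc : cont_on (fun q => `|g q|) by move=> q Mq; apply: cvg_norm; exact: gc.
have [c _ cP] := compact_EVT_max M0 cM (cont_on_within nc).
by exists `|g c| => // q Mq; apply: cP; rewrite inE.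
Qed.

Lemma cont_on_integrable (g : F -> R) : cont_on g ->
  mu.-integrable (M : set (borel F)) (EFin \o g).
Proof.
move=> gc; apply: measurable_bounded_integrable => //; first exact: borel_compact.
  exact: cont_on_measurable.
have [C C0 CP] := cont_on_bounded gc.
exists C; split; first exact: num_real.
by move=> x Cx; move=> q Mq /=; rewrite (le_trans (CP _ Mq)) // ltW.
Qed.

Definition Int (g : F -> R) : R := \int[mu]_(q in M) g q.

Lemma eq_Int g h : (forall q, M q -> g q = h q) -> Int g = Int h.
Proof. by move=> gh; apply: eq_Rintegral => q; rewrite inE; exact: gh. Qed.

Lemma cont_on_cst c : cont_on (fun=> c).
Proof. by move=> q _; exact: cvg_cst. Qed.

Lemma cont_onD g h : cont_on g -> cont_on h -> cont_on (fun q => g q + h q).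
Proof. by move=> gc hc q Mq; apply: cvgD; [exact: gc|exact: hc]. Qed.

Lemma cont_onM g h : cont_on g -> cont_on h -> cont_on (fun q => g q * h q).
Proof. by move=> gc hc q Mq; apply: cvgM; [exact: gc|exact: hc]. Qed.

Lemma cont_on_sum (I : Type) (r : seq I) (P : pred I) (g : I -> F -> R) :
  (forall i, P i -> cont_on (g i)) -> cont_on (fun q => \sum_(i <- r | P i) g i q).
Proof. by move=> gc q Mq; apply: cvg_sum => i Pi; exact: gc. Qed.

Lemma IntD g h : cont_on g -> cont_on h ->
  Int (fun q => g q + h q) = Int g + Int h.
Proof.
move=> gc hc; apply: (@RintegralD _ _ _ mu); [exact: borel_compact|exact: cont_on_integrable..].
Qed.

Lemma IntZ c g : cont_on g -> Int (fun q => c * g q) = c * Int g.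
Proof.
move=> gc; apply: (@RintegralZl _ _ _ mu); [exact: borel_compact|exact: cont_on_integrable].
Qed.

Lemma IntN g : cont_on g -> Int (fun q => - g q) = - Int g.
Proof. by move=> gc; rewrite -mulN1r -IntZ //; apply: eq_Int => q _; rewrite mulN1r. Qed.

Lemma Int_cst c : Int (fun=> c) = c * Int (fun=> 1).
Proof. by rewrite -IntZ; [apply: eq_Int => q _; rewrite mulr1|exact: cont_on_cst]. Qed.

Lemma Int0 : Int (fun=> 0) = 0.
Proof. by rewrite Int_cst mul0r. Qed.

Lemma Int_sum (I : Type) (r : seq I) (P : pred I) (g : I -> F -> R) :
  (forall i, P i -> cont_on (g i)) ->
  Int (fun q => \sum_(i <- r | P i) g i q) = \sum_(i <- r | P i) Int (g i).
Proof.
move=> gc; elim: r => [|i r IH].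
  by rewrite big_nil -[RHS]Int0; apply: eq_Int => q _; rewrite big_nil.
rewrite big_cons; case: (boolP (P i)) => Pi; last first.
  by rewrite -IH; apply: eq_Int => q _; rewrite big_cons (negbTE Pi).
rewrite -IH -IntD; [|exact: gc|exact: cont_on_sum].
by apply: eq_Int => q _; rewrite big_cons Pi.
Qed.

Section ParametricIntegral.
Variables (V : normedModType R) (Om : set (V * F)%type).
Hypothesis oOm : open Om.
Variable (x : V).
Hypothesis xM : forall q, M q -> Om (x, q).

(** The tube lemma for the compact slice over [x]. *)
Lemma near_param_domain : \forall y \near x, forall q, M q -> Om (y, q).
Proof.
have /compact_near_coveringP cc := cM.
apply: (cc V (nbhs x) (fun y q => Om (y, q))) => q Mq.
have : nbhs (x, q) Om by apply: open_nbhs_nbhs; split=> //; exact: xM.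
move=> [[A B] /= [xA qB] AB]; exists (B, A) => //= -[q' y] /= [Bq Ay].
exact: (AB (y, q')).
Qed.

(** If [C] bounds the function on the slice over [x], then [C + 1] bounds it on nearby slices, by
    the tube lemma again. This gives the constant that dominates the integrands below. *)
Lemma near_param_bounded (h : V * F -> R) :
  (forall q, M q -> {for (x, q), continuous h}) ->
  exists2 C, 0 <= C & \forall y \near x, forall q, M q -> `|h (y, q)| <= C.
Proof.
move=> hc.
have [|C C0 CP] := @cont_on_bounded (fun q => h (x, q)).
  move=> q Mq; apply: (@continuous_comp _ _ _ (fun q => (x, q)) h); last exact: hc.
  exact: continuous_pairl.
exists (C + 1); first by rewrite addr_ge0.
have /compact_near_coveringP cc := cM.
apply: (cc V (nbhs x) (fun y q => `|h (y, q)| <= C + 1)) => q Mq.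
have /cvgrPdist_le /(_ 1 ltr01) [[A B] /= [xA qB] AB] := hc q Mq.
exists (B, A) => //= -[q' y] /= [Bq Ay].
have /= := AB (y, q') (conj Ay Bq) => le1.
rewrite -(subrK (h (x, q)) (h (y, q'))) (le_trans (ler_normD _ _)) // addrC lerD ?CP //.
by rewrite distrC.
Qed.

(** Differentiation under the integral along the line [s |-> s *: v + x]; the dominating function is
    a constant, integrable because [mu M] is finite. *)
Lemma is_derive_Int (h : V * F -> R) v : class_C 1 Om h ->
  is_derive x v (fun y => Int (fun q => h (y, q))) (Int (fun q => 'D_(v, 0) h (x, q))).
Proof.
move=> hC.
have hcont y : (forall q, M q -> Om (y, q)) -> cont_on (fun q => h (y, q)).
  move=> yM q Mq; apply: (@continuous_comp _ _ _ (fun q => (y, q)) h).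
  exact: continuous_pairl.
  exact: class_C_cont hC (yM _ Mq).
have [|C C0 CP] := @near_param_bounded ('D_(v, 0) h).
  by move=> q Mq; exact: class_C_cont (class_C_derive (v, 0) hC) (xM Mq).
pose f (s : R) q := h (s *: v + x, q).
have nx : (fun s : R => s *: v + x) @ 0 --> x.
  rewrite -[X in _ --> X]add0r -(scale0r v); apply: cvgD; last exact: cvg_cst.
  exact: (lcm_scalel v).2.
have : \forall s \near (0 : R), (forall q, M q -> Om (s *: v + x, q)) /\
    (forall q, M q -> `|'D_(v, 0) h (s *: v + x, q)| <= C).
  exact: nx _ (filterI near_param_domain CP).
move=> /nbhs_ballP[e /= e0 eP].
have {}eP (s : R) : s \in `]-e, e[ -> (forall q, M q -> Om (s *: v + x, q)) /\
    forall q, M q -> `|'D_(v, 0) h (s *: v + x, q)| <= C.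
  rewrite in_itv /= => se; apply: (eP s).
  by rewrite /ball /= sub0r normrN ltr_norml.
have LL : linear_continuous_map (fun s : R => (s *: v, 0 : F)).
  exact: lcm_comp (@lcm_inl _ _ _) (lcm_scalel v).
have dq s q : s \in `]-e, e[ -> M q -> is_derive s 1 (f ^~ q) ('D_(v, 0) h (s *: v + x, q)).
  move=> se Mq; have [eq1 d1] := derive_affine LL h (x, q) s 1.
  rewrite scale1r /= in eq1 d1.
  have E (s' : R) : (s' *: v, 0) + (x, q) = (s' *: v + x, q) :> (V * F)%type.
    by apply: injective_projections => //=; rewrite add0r.
  rewrite (_ : (fun x0 : R => h ((x0 *: v, 0) + (x, q))) = f ^~ q) in eq1 d1; last first.
    by apply/funext => s'; rewrite E.
  rewrite E in eq1 d1.
  apply: DeriveDef; last exact: eq1.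
  apply: d1.2; exact: class_C_derivable hC ((eP s se).1 q Mq).
have I0 : `](-e), e[%classic (0 : R) by rewrite /= in_itv /= oppr_lt0 e0.
have int1 s : `](-e), e[%classic s -> mu.-integrable (M : set (borel F)) (EFin \o f s).
  by move=> se; apply: cont_on_integrable; apply: hcont; exact: (eP s se).1.
have der1 s (q : borel F) : `](-e), e[%classic s -> M q -> derivable (f ^~ q) s 1.
  by move=> se Mq; case: (dq s q se Mq).
have intC : mu.-integrable (M : set (borel F)) (EFin \o (fun=> C)).
  by apply: cont_on_integrable; exact: cont_on_cst.
have ub s (q : borel F) : `](-e), e[%classic s -> M q -> `|partial1of2 f s q| <= C.
  by move=> se Mq; rewrite partial1of2E; case: (dq s q se Mq) => _ ->; exact: (eP s se).2.
have D := @differentiation_under_integral R _ _ mu f M borel_compact 0 (-e) e I0 int1 der1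
  (fun=> C) (fun=> C0) intC ub.
have D' := @derivable_under_integral R _ _ mu f M borel_compact 0 (-e) e I0 int1 der1
  (fun=> C) (fun=> C0) intC ub.
have [eq1 d1] := derive_affine (lcm_scalel v) (fun y => Int (fun q => h (y, q))) x 0 1.
rewrite scale1r scale0r add0r in eq1 d1.
apply: DeriveDef; first exact: d1.1.
rewrite -eq1 -derive1E; apply: etrans D _.
apply: eq_Int => q Mq; rewrite partial1of2E.
by case: (dq 0 q I0 Mq) => _ ->; rewrite scale0r add0r.
Qed.
End ParametricIntegral.
End BorelIntegral.

Section SecondChain.
Variables (R : realType) (d : nat) (U : set 'rV[R]_d) (J : set R).
Hypotheses (oU : open U) (oJ : open J).

Lemma derive1n2_chain (f : 'rV[R]_d -> R) (x : R -> 'rV[R]_d) t :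
  class_C 2 U f -> class_C 2 J x -> (forall s, J s -> U (x s)) -> J t ->
  derive1n 2 (f \o x) t = \sum_i derive1n 2 x t 0 i * partial i f (x t) +
    \sum_i \sum_j derive1 x t 0 i * derive1 x t 0 j * partial j (partial i f) (x t).
Proof.
move=> fC xC JU Jt.
have xd s : J s -> derivable x s 1 by exact: class_C_derivable xC.
have E1 s : J s -> derive1 (f \o x) s = \sum_i derive1 x s 0 i * partial i f (x s).
  move=> Js; rewrite derive1E.
  by case: (is_derive_chain oU (class_C_pred fC) (JU _ Js) (xd _ Js)).
rewrite /derive1n /= derive1E.
have -> : 'D_1 (derive1 (f \o x)) t =
    'D_1 (fun s => \sum_i derive1 x s 0 i * partial i f (x s)) t.
  by apply: near_eq_derive; near=> s; apply: E1; near: s; exact: open_nbhs_nbhs.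
have dx : is_derive t 1 (derive1 x) (derive1 (derive1 x) t).
  rewrite [derive1 (derive1 x) t]derive1E; apply: derivableP.
  have E : 'D_1 x = derive1 x by apply/funext => s; rewrite derive1E.
  have H := class_C_derivable (v := (1 : R)) (class_C_derive (1 : R) xC) Jt.
  by rewrite E in H.
have dxi i : is_derive t 1 (fun s => derive1 x s 0 i) (derive1 (derive1 x) t 0 i).
  exact: (is_derive_lcm (lcm_coord R (0 : 'I_1) i) dx).
have df i : is_derive t 1 (partial i f \o x)
    (\sum_j (derive1 x t) 0 j * partial j (partial i f) (x t)).
  exact: is_derive_chain oU (class_C_derive _ fC) (JU _ Jt) (xd _ Jt).
have D i : is_derive t 1 (fun s => derive1 x s 0 i * partial i f (x s))
    (derive1 (derive1 x) t 0 i * partial i f (x t) +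
     derive1 x t 0 i * \sum_j (derive1 x t) 0 j * partial j (partial i f) (x t)).
  exact: (is_derive_bcm (bilinear_continuous_mulr R) (dxi i) (df i)).
have [_ De] := is_derive_sum D.
rewrite (_ : (fun s => \sum_i derive1 x s 0 i * partial i f (x s)) =
  \sum_i (fun s => derive1 x s 0 i * partial i f (x s))); last first.
  by apply/funext => s; rewrite fct_sumE.
rewrite De big_split /=; congr (_ + _); apply: eq_bigr => i _.
by rewrite mulr_sumr; apply: eq_bigr => j _; rewrite mulrA.
Unshelve. all: by end_near. Qed.
End SecondChain.

(** * The geodesic equation with its index lowered *)

Section LoweredChristoffel.
Variables (R : realType) (d : nat).

(** The Gram matrix cancels its inverse in the Christoffel symbols. Contraction with the symmetric
    product [v 0 i * v 0 j] merges the first two derivatives, which explains the asymmetric form of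
    the right-hand side. *)
Lemma christoffel_lower (Gm : 'rV[R]_d -> 'M[R]_d) (x a v : 'rV[R]_d) : Gm x \in unitmx ->
  let Gamma k i j := 2^-1 * \sum_l invmx (Gm x) k l *
    (partial i (fun y => Gm y j l) x + partial j (fun y => Gm y i l) x
     - partial l (fun y => Gm y i j) x) in
  (forall k, a 0 k + \sum_i \sum_j Gamma k i j * v 0 i * v 0 j = 0) <->
  (forall l, \sum_j Gm x l j * a 0 j + \sum_i \sum_j
    (partial i (fun y => Gm y j l) x - 2^-1 * partial l (fun y => Gm y i j) x)
      * v 0 i * v 0 j = 0).
Proof.
move=> Gu Gamma.
pose w : 'cV[R]_d := \col_l \sum_i \sum_j
    (partial i (fun y => Gm y j l) x - 2^-1 * partial l (fun y => Gm y i j) x)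
      * v 0 i * v 0 j.
have E k : \sum_i \sum_j Gamma k i j * v 0 i * v 0 j = (invmx (Gm x) *m w) k 0.
  rewrite mxE.
  pose T i j l := invmx (Gm x) k l * v 0 i * v 0 j.
  have -> : \sum_i \sum_j Gamma k i j * v 0 i * v 0 j =
    \sum_i \sum_j \sum_l (2^-1 * T i j l * partial i (fun y => Gm y j l) x) +
    (\sum_i \sum_j \sum_l (2^-1 * T i j l * partial j (fun y => Gm y i l) x) -
    \sum_i \sum_j \sum_l (2^-1 * T i j l * partial l (fun y => Gm y i j) x)).
    rewrite -sumrB -big_split; apply: eq_bigr => i _ /=.
    rewrite -sumrB -big_split; apply: eq_bigr => j _ /=.
    rewrite -sumrB -big_split /Gamma mulr_sumr !mulr_suml; apply: eq_bigr => l _ /=.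
    by rewrite /T; ring.
  (* Exchanging [i] and [j] turns the middle sum into the first one; the two halves add up to 1. *)
  rewrite [X in _ + (X - _)]exchange_big /= addrA -big_split /= -sumrB.
  under [RHS]eq_bigr do rewrite mxE mulr_sumr.
  rewrite [RHS]exchange_big; apply: eq_bigr => i _ /=.
  rewrite -big_split -sumrB /=.
  under [RHS]eq_bigr do rewrite mulr_sumr.
  rewrite [RHS]exchange_big; apply: eq_bigr => j _ /=.
  rewrite -big_split -sumrB /=.
  apply: eq_bigr => l _; rewrite /T.
  by field.
have -> : (forall k, a 0 k + \sum_i \sum_j Gamma k i j * v 0 i * v 0 j = 0) <->
    a^T + invmx (Gm x) *m w = 0.
  split=> [H|/colP H k]; first by apply/colP => k; have := H k; rewrite E !mxE.
  by have := H k; rewrite E !mxE.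
have -> : (forall l, \sum_j Gm x l j * a 0 j + \sum_i \sum_j
    (partial i (fun y => Gm y j l) x - 2^-1 * partial l (fun y => Gm y i j) x)
      * v 0 i * v 0 j = 0) <-> Gm x *m a^T + w = 0.
  split=> [H|/colP H l].
    apply/colP => l; rewrite !mxE; apply: etrans (H l); congr (_ + _).
    by apply: eq_bigr => j _; rewrite mxE.
  have := H l; rewrite !mxE; apply: etrans; congr (_ + _).
  by apply: eq_bigr => j _; rewrite mxE.
split=> H.
  by have := congr1 (mulmx (Gm x)) H; rewrite mulmxDr mulKVmx // mulmx0.
by have := congr1 (mulmx (invmx (Gm x))) H; rewrite mulmxDr mulKmx // mulmx0.
Qed.
End LoweredChristoffel.

Lemma sum_second_order (R : comNzRingType) (A : finType) (d : nat) (p : A -> R)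
    (g : A -> 'I_d -> R) (h : A -> 'I_d -> 'I_d -> R) (u w : 'I_d -> R) (e : A -> R) :
  (forall a, e a = \sum_i u i * g a i + \sum_i \sum_j w i * w j * h a j i) ->
  \sum_a p a * e a = \sum_i u i * (\sum_a p a * g a i) +
    \sum_i \sum_j w i * w j * (\sum_a p a * h a j i).
Proof.
move=> E; under eq_bigr do rewrite E mulrDr.
rewrite big_split /=; congr (_ + _).
  under eq_bigr do rewrite mulr_sumr.
  rewrite exchange_big /=; apply: eq_bigr => j _.
  by rewrite mulr_sumr; apply: eq_bigr => a _; rewrite mulrCA.
under eq_bigr do rewrite mulr_sumr.
rewrite exchange_big /=; apply: eq_bigr => i _.
under eq_bigr do rewrite mulr_sumr.
rewrite exchange_big /=; apply: eq_bigr => j _.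
by rewrite mulr_sumr; apply: eq_bigr => a _; rewrite mulrCA.
Qed.

(** * The Euler-Lagrange expression of a metric given by an integral *)

Section EulerLagrange.
Variables (R : realType) (F : normedModType R) (M : set F).
Variable mu : {measure set (borel F) -> \bar R}.
Hypothesis cM : compact M.
Hypothesis muM : (mu M < +oo)%E.
Variables (d : nat) (A : finType) (Om : set ('rV[R]_d * F)%type) (U : set 'rV[R]_d).
Hypotheses (oOm : open Om) (oU : open U).
Hypothesis UM : forall y q, U y -> M q -> Om (y, q).
Variable f : A -> 'rV[R]_d * F -> R.
Hypothesis fC : forall a, smooth_on Om (f a).

Local Notation D i g := ('D_(delta_mx 0 i, 0) g).
Local Notation Int := (Int M mu).

(** The metric pulled back from L^2(M) by [y |-> f (y, .)]; the index [a] runs over the coordinates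
    of the values. *)
Definition integral_gram (y : 'rV[R]_d) : 'M[R]_d :=
  \matrix_(i, j) Int (fun q => \sum_a D i (f a) (y, q) * D j (f a) (y, q)).

Lemma smooth_cont_on h y : class_C 0 Om h -> U y -> cont_on M (fun q => h (y, q)).
Proof.
move=> hC Uy q Mq; apply: (@continuous_comp _ _ _ (fun q => (y, q)) h).
  exact: continuous_pairl.
exact: class_C_cont hC (UM Uy Mq).
Qed.

(** The Christoffel symbol of the first kind of a metric pulled back from a flat space: a first
    derivative paired with a second one. *)
Let K y i j l := Int (fun q => \sum_a D i (f a) (y, q) * D j (D l (f a)) (y, q)).

Let fD a i k : class_C k Om (D i (f a)).
Proof. exact: class_C_derive (fC a k.+1). Qed.

Let fDD a i j k : class_C k Om (D i (D j (f a))).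
Proof. exact: class_C_derive (fD a j k.+1). Qed.

Let K_sym y i j l : U y -> K y i j l = K y i l j.
Proof.
move=> Uy; apply: eq_Int => q Mq; apply: eq_bigr => a _.
by rewrite (@derive_comm _ _ _ _ _ (delta_mx 0 j, 0) (delta_mx 0 l, 0) oOm (fC a 2) (UM Uy Mq)).
Qed.

Let fDDc y i j l a : U y ->
  cont_on M (fun q => D i (f a) (y, q) * D j (D l (f a)) (y, q)).
Proof.
move=> Uy; apply: (@smooth_cont_on (fun z => D i (f a) z * D j (D l (f a)) z)) => //.
by apply: class_CM.
Qed.

Let fDc y i j a : U y -> cont_on M (fun q => D i (f a) (y, q) * D j (f a) (y, q)).
Proof.
move=> Uy; apply: (@smooth_cont_on (fun z => D i (f a) z * D j (f a) z)) => //.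
by apply: class_CM.
Qed.

Lemma partial_integral_gram y i j l : U y ->
  partial l (fun y => integral_gram y i j) y = K y j l i + K y i l j.
Proof.
move=> Uy; rewrite /partial.
pose h z := \sum_a D i (f a) z * D j (f a) z.
have -> : (fun y => integral_gram y i j) = (fun y => Int (fun q => h (y, q))).
  by apply/funext => z; rewrite mxE.
have hC k : class_C k Om h by apply: class_C_sum => // a _; apply: class_CM.
have [_ ->] := is_derive_Int cM muM oOm (fun q Mq => UM Uy Mq) (delta_mx 0 l) (hC 1%N).
rewrite /K -IntD //; try by apply: cont_on_sum => a _; exact: fDDc.
apply: eq_Int => q Mq; rewrite -big_split /=.
have Dz a : is_derive (y, q) (delta_mx 0 l, 0) (fun z => D i (f a) z * D j (f a) z)
   (D l (D i (f a)) (y, q) * D j (f a) (y, q) + D i (f a) (y, q) * D l (D j (f a)) (y, q)).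
  apply: (is_derive_bcm (bilinear_continuous_mulr R)); apply: derivableP.
    exact: class_C_derivable (fD a i 1) (UM Uy Mq).
  exact: class_C_derivable (fD a j 1) (UM Uy Mq).
have dh : is_derive (y, q) (delta_mx 0 l, 0) h (\sum_a
   (D l (D i (f a)) (y, q) * D j (f a) (y, q) + D i (f a) (y, q) * D l (D j (f a)) (y, q))).
  exact: is_derive_bigsum.
by case: dh => _ ->; apply: eq_bigr => a _; rewrite mulrC.
Qed.

(** For a map into a flat space, here L^2(M), the lowered geodesic expression is the pairing of the
    acceleration of the image curve with the [l]-th tangent vector. *)
Lemma euler_lagrange (x : R -> 'rV[R]_d) (J : set R) t l :
  open J -> class_C 2 J x -> (forall s, J s -> U (x s)) -> J t ->
  \sum_j integral_gram (x t) l j * derive1n 2 x t 0 j + \sum_i \sum_j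
    (partial i (fun y => integral_gram y j l) (x t)
     - 2^-1 * partial l (fun y => integral_gram y i j) (x t))
      * derive1 x t 0 i * derive1 x t 0 j =
  Int (fun q => \sum_a D l (f a) (x t, q) * derive1n 2 (fun s => f a (x s, q)) t).
Proof.
move=> oJ xC JU Jt; have Ut := JU _ Jt.
have Uo q : open [set y | Om (y, q)].
  rewrite (_ : [set y | Om (y, q)] = (fun y => (y, q)) @^-1` Om) //.
  by apply: open_comp => // y _; exact: continuous_pairr.
have eqf (g : 'rV[R]_d * F -> R) q : (fun y => g ((y, 0) + (0, q))) = (fun y => g (y, q)).
  by apply/funext => y; congr g; apply: injective_projections; rewrite /= ?addr0 ?add0r.
have LL := @lcm_inl R 'rV[R]_d F.
have pf (g : 'rV[R]_d * F -> R) q i y : partial i (fun y => g (y, q)) y = D i g (y, q).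
  have [+ _] := derive_affine LL g (0, q) y (delta_mx 0 i).
  rewrite eqf /partial => ->; congr (D i g _).
  by apply: injective_projections; rewrite /= ?addr0 ?add0r.
have fqC a q k : class_C k [set y | Om (y, q)] (fun y => f a (y, q)).
  rewrite -eqf; apply: (class_C_affine LL _ (fC a k)) => y /=.
  by rewrite (_ : (y, 0) + (0, q) = (y, q)) //; apply: injective_projections; rewrite /= ?addr0 ?add0r.
(* The chain rule of order two, applied for each fixed [q], splits the acceleration into a Gram term
   and a term in [K]. *)
have -> : Int (fun q => \sum_a D l (f a) (x t, q) * derive1n 2 (fun s => f a (x s, q)) t) =
  \sum_j integral_gram (x t) l j * derive1n 2 x t 0 j +
  \sum_i \sum_j K (x t) l j i * derive1 x t 0 i * derive1 x t 0 j.
  have cG j : cont_on M (fun q => \sum_a D l (f a) (x t, q) * D j (f a) (x t, q)).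
    by apply: cont_on_sum => a _; exact: fDc.
  have cK i j : cont_on M (fun q => \sum_a D l (f a) (x t, q) * D j (D i (f a)) (x t, q)).
    by apply: cont_on_sum => a _; exact: fDDc.
  under [X in _ = X + _]eq_bigr do rewrite mxE mulrC -IntZ //.
  rewrite -Int_sum //; last by move=> j _; apply: cont_onM => //; exact: cont_on_cst.
  under [X in _ = _ + X]eq_bigr => i _.
    under eq_bigr => j _ do rewrite /K -mulrA mulrC -IntZ //.
    rewrite -Int_sum //; last by move=> j _; apply: cont_onM => //; exact: cont_on_cst.
    over.
  rewrite -Int_sum //; last first.
    by move=> i _; apply: cont_on_sum => j _; apply: cont_onM => //; exact: cont_on_cst.
  rewrite -IntD //; last 2 first.
  - by apply: cont_on_sum => j _; apply: cont_onM => //; exact: cont_on_cst.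
  - by apply: cont_on_sum => i _; apply: cont_on_sum => j _; apply: cont_onM => //; exact: cont_on_cst.
  apply: eq_Int => q Mq.
  have E a : derive1n 2 (fun s => f a (x s, q)) t =
     \sum_i derive1n 2 x t 0 i * D i (f a) (x t, q) +
     \sum_i \sum_j derive1 x t 0 i * derive1 x t 0 j * D j (D i (f a)) (x t, q).
    have E2 := @derive1n2_chain _ _ _ _ (Uo q) oJ _ _ t (fqC a q 2%N) xC
      (fun s Js => UM (JU _ Js) Mq) Jt.
    apply: etrans E2 _.
    apply: (f_equal2 +%R); apply: eq_bigr => i _; first by rewrite (pf (f a)).
    have pf2 : partial i (fun y => f a (y, q)) = (fun y => D i (f a) (y, q)).
      by apply/funext => y; rewrite (pf (f a)).
    by apply: eq_bigr => j _; rewrite pf2 (pf (D i (f a))).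
  exact: (@sum_second_order _ _ _ (fun a => D l (f a) (x t, q)) (fun a i => D i (f a) (x t, q))
    (fun a j i => D j (D i (f a)) (x t, q)) (fun i => derive1n 2 x t 0 i)
    (fun i => derive1 x t 0 i) _ E).
apply: (f_equal2 +%R) => //.
have -> : \sum_i \sum_j
    (partial i (fun y => integral_gram y j l) (x t)
     - 2^-1 * partial l (fun y => integral_gram y i j) (x t))
      * derive1 x t 0 i * derive1 x t 0 j =
  \sum_i \sum_j K (x t) l j i * derive1 x t 0 i * derive1 x t 0 j +
  (\sum_i \sum_j 2^-1 * K (x t) j l i * derive1 x t 0 i * derive1 x t 0 j -
   \sum_i \sum_j 2^-1 * K (x t) i l j * derive1 x t 0 i * derive1 x t 0 j).
  rewrite -sumrB -big_split; apply: eq_bigr => i _ /=.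
  rewrite -sumrB -big_split; apply: eq_bigr => j _ /=.
  rewrite !partial_integral_gram // (K_sym l j i Ut) (K_sym j l i Ut).
  have fe (a b c u v : R) : (a + b - 2^-1 * (b + c)) * u * v =
    a * u * v + (2^-1 * b * u * v - 2^-1 * c * u * v) by field.
  exact: fe.
(* The two remaining sums differ only by the names of [i] and [j], hence cancel. *)
rewrite [X in _ + (X - _)]exchange_big /=.
rewrite [X in _ + X](_ : _ = 0) ?addr0 //.
rewrite -sumrB big1 // => i _; rewrite -sumrB big1 // => j _.
by rewrite -!mulrA [derive1 x t 0 j * _]mulrC subrr.
Qed.
End EulerLagrange.

(** * Geodesics of a kinetic energy metric *)

Lemma near_openP (R : realType) (V : normedModType R) (U : set V) (y v : V) :
  open U -> U y -> exists2 e : R, 0 < e & forall s : R, s \in `]-e, e[ -> U (s *: v + y).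
Proof.
move=> oU Uy.
have nx : (fun s : R => s *: v + y) @ 0 --> y.
  rewrite -[X in _ --> X]add0r -(scale0r v); apply: cvgD; last exact: cvg_cst.
  exact: (lcm_scalel v).2.
have : \forall s \near (0 : R), U (s *: v + y) by exact: nx _ (open_nbhs_nbhs (conj oU Uy)).
move=> /nbhs_ballP[e /= e0 eP]; exists e => // s; rewrite in_itv /= => se.
by apply: (eP s); rewrite /ball /= sub0r normrN ltr_norml.
Qed.

Lemma derive1n2_eq (R : realType) (W : normedModType R) (J : set R) (f g : R -> W) t :
  open J -> J t -> (forall s, J s -> f s = g s) -> derive1n 2 f t = derive1n 2 g t.
Proof.
move=> oJ Jt fg; rewrite /derive1n /= !derive1E.
have E s : J s -> derive1 f s = derive1 g s.
  move=> Js; rewrite !derive1E; apply: near_eq_derive.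
  by apply: filterS (open_nbhs_nbhs (conj oJ Js)) => z; exact: fg.
apply: near_eq_derive; apply: filterS (open_nbhs_nbhs (conj oJ Jt)) => z; exact: E.
Qed.

Section DirectionalDerivative.
Variables (R : realType) (E : normedModType R) (B : Type) (kap : B -> E -> R).
Hypothesis kap_lcm : forall b, linear_continuous_map (kap b).
Hypothesis kap_inj : forall X, (forall b, kap b X = 0) -> X = 0.

(** Linearity of the derivative in its direction comes from the chain rule for real functions; in
    [E] it is tested on the separating functionals [kap b]. *)
Lemma derive_sum_partial d (U : set 'rV[R]_d) (psi : 'rV[R]_d -> E) y v : open U ->
  class_C 1 U psi -> U y -> 'D_v psi y = \sum_i v 0 i *: partial i psi y.
Proof.
move=> oU pC Uy; apply/subr0_eq; apply: kap_inj => b.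
have L := kap_lcm b.
rewrite (lcmB L) (lcm_sum L).
have kd w : 'D_w (kap b \o psi) y = kap b ('D_w psi y).
  by case: (is_derive_lcm L (derivableP (class_C_derivable (v := w) pC Uy))).
have kC : class_C 1 U (kap b \o psi) by exact: class_C_lcm.
have [eq1 d1] := derive_affine (lcm_scalel v) (kap b \o psi) y 0 1.
rewrite scale1r scale0r add0r in eq1 d1.
have LL := lcm_scalel v.
have xd : is_derive (0 : R) 1 (fun s : R => s *: v + y) v.
  have := @is_derive_lcm _ _ _ _ LL _ id (0 : R) 1 1 (is_derive_id _ _).
  rewrite scale1r => h; have := is_deriveD h (is_derive_cst y (0 : R) 1).
  by rewrite addr0.
have := is_derive_chain oU kC _ (@ex_derive _ _ _ _ _ _ _ xd).
rewrite scale0r add0r derive1E => /(_ Uy)[_].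
rewrite (@derive_val _ _ _ _ _ _ _ xd) => H.
rewrite -kd -eq1; apply/eqP; rewrite subr_eq0; apply/eqP; apply: etrans H _.
by apply: eq_bigr => i _; rewrite /partial kd (lcmZ L).
Qed.
End DirectionalDerivative.

Lemma Int_quadratic (R : realType) (F : normedModType R) (M : set F)
    (mu : {measure set (borel F) -> \bar R}) (d : nat) (A : finType)
    (v : 'I_d -> R) (p : 'I_d -> A -> F -> R) :
  compact M -> (mu M < +oo)%E -> (forall i a, cont_on M (p i a)) ->
  \sum_i \sum_j v i * v j * Int M mu (fun q => \sum_a p i a q * p j a q) =
  Int M mu (fun q => \sum_a (\sum_i v i * p i a q) ^+ 2).
Proof.
move=> cM muM pc.
have pc2 i j : cont_on M (fun q => \sum_a p i a q * p j a q).
  by apply: cont_on_sum => a _; exact: cont_onM.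
have pc3 i j : cont_on M (fun q => v i * v j * \sum_a p i a q * p j a q).
  by apply: cont_onM => //; exact: cont_on_cst.
under eq_bigr => i _.
  under eq_bigr => j _ do rewrite -IntZ //.
  rewrite -Int_sum //.
  over.
rewrite -Int_sum //; last by move=> i _; exact: cont_on_sum.
apply: eq_Int => q _.
under [RHS]eq_bigr do rewrite expr2 big_distrlr /=.
rewrite [RHS]exchange_big; apply: eq_bigr => i _ /=.
rewrite [RHS]exchange_big; apply: eq_bigr => j _ /=.
by rewrite mulr_sumr; apply: eq_bigr => a _; rewrite mulrACA.
Qed.

(** * From the kinetic energy metric to an integral condition *)

Section KineticGeodesic.
Variables (R : realType) (E F : normedModType R).
Variables (G : set E) (M : set F) (act : E -> F -> F) (ip : F -> F -> R).
Variable mu : {measure set (borel F) -> \bar R}.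
Variables (A : finType) (pr : A -> F -> R) (B : Type) (kap : B -> E -> R).
(** A closed formula for X~(q) that makes sense and is linear for every [X] in [E], whereas [tilde]
    is meaningful for tangent [X] only. *)
Variable vel : E -> E -> F -> F.
Hypothesis cM : compact M.
Hypothesis muM : (mu M < +oo)%E.
Hypothesis pr_lcm : forall a, linear_continuous_map (pr a).
Hypothesis ipE : forall x y, ip x y = \sum_a pr a x * pr a y.
Hypothesis kap_lcm : forall b, linear_continuous_map (kap b).
Hypothesis kap_inj : forall X, (forall b, kap b X = 0) -> X = 0.
Hypothesis velP : forall (c : R -> E) q, M q -> G (c 0) -> derivable c 0 1 ->
  is_derive (0 : R) 1 (fun t => act (c t) q) (vel (c 0) (derive1 c 0) q).
Hypothesis vel_lin : forall g q, linear (fun X => vel g X q).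
Hypothesis act_smooth : forall d (U : set 'rV[R]_d) (psi : 'rV[R]_d -> E), open U ->
  smooth_on U psi -> (forall y, U y -> G (psi y)) ->
  exists Om : set ('rV[R]_d * F)%type, [/\ open Om,
    forall y q, U y -> M q -> Om (y, q) &
    forall a, smooth_on Om (fun z => pr a (act (psi z.1) z.2))].

Local Notation kin := (kinetic G M act ip mu).
Local Notation Int := (Int M mu).

Definition tangent_at (g X : E) := curves_at G g X !=set0.

Lemma vel_sum g q d (v : 'I_d -> R) (X : 'I_d -> E) :
  vel g (\sum_i v i *: X i) q = \sum_i v i *: vel g (X i) q.
Proof.
have vl := vel_lin g q.
have v0 : vel g 0 q = 0.
  have := vl 1 0 0; rewrite !scale1r addr0 => /(congr1 (fun z => z - vel g 0 q)).
  by rewrite subrr addrK.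
have vD X' Y : vel g (X' + Y) q = vel g X' q + vel g Y q.
  by have := vl 1 X' Y; rewrite !scale1r.
have vZ s X' : vel g (s *: X') q = s *: vel g X' q.
  by have := vl s X' 0; rewrite v0 !addr0.
by rewrite (big_morph (fun X => vel g X q) vD v0); apply: eq_bigr => i _; rewrite vZ.
Qed.

(** Whichever curve [get] picks among those representing [X], [velP] computes the same derivative,
    so the choice disappears. *)
Lemma tilde_vel g X q : M q -> tangent_at g X -> tilde G act g X q = vel g X q.
Proof.
move=> Mq tX; rewrite /tilde; set c := get _.
have [e e0 [cC cG c0 cX]] : curves_at G g X c by exact: getPex.
have I0 : `]-e, e[%classic (0 : R) by rewrite /= in_itv /= oppr_lt0 e0.
have cd : derivable c 0 1 by apply: class_C_derivable (cC 1%N) I0.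
have Gc : G (c 0) by exact: cG.
by rewrite derive1E; case: (velP Mq Gc cd) => _ ->; rewrite c0 cX.
Qed.

Section Param.
Variables (S : set E) (d : nat) (U : set 'rV[R]_d) (psi : 'rV[R]_d -> E).
Hypothesis SG : S `<=` G.
Hypothesis psiP : local_param S U psi.

Lemma local_param_image y : U y -> S (psi y).
Proof.
case: psiP => oU _ _ _ H Uy; have [W _ WE] := H U oU (fun _ h => h).
have : (psi @` U) (psi y) by exists y.
by rewrite WE => -[].
Qed.

Let oU : open U. Proof. by case: psiP. Qed.
Let sU : smooth_on U psi. Proof. by case: psiP. Qed.

(** Straight lines of the chart, mapped by [psi], witness tangency. As [S] is any subset of [G],
    this serves charts of the subgroup and of the whole group alike. *)
Lemma param_curve y v : U y -> exists2 c : R -> E,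
    c = (fun s => psi (s *: v + y)) & [/\ curves_at G (psi y) ('D_v psi y) c,
     c 0 = psi y, derivable c 0 1 & derive1 c 0 = 'D_v psi y].
Proof.
move=> Uy; exists (fun s => psi (s *: v + y)) => //.
have [eq1 d1] := derive_affine (lcm_scalel v) psi y 0 1.
rewrite scale1r scale0r add0r in eq1 d1.
have c0 : psi (0 *: v + y) = psi y by rewrite scale0r add0r.
have dc : derivable (fun s : R => psi (s *: v + y)) 0 1.
  by apply: d1.2; exact: class_C_derivable (sU 1) Uy.
have D1 : derive1 (fun s : R => psi (s *: v + y)) 0 = 'D_v psi y by rewrite derive1E eq1.
split=> //.
have [e e0 eP] := near_openP v oU Uy.
exists e => //; split => //.
  move=> k; apply: (class_C_affine (lcm_scalel v) _ (sU k)) => s /= se.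
  exact: eP.
by move=> s se; apply: SG; apply: local_param_image; exact: eP.
Qed.

Lemma tangent_param y v : U y -> tangent_at (psi y) ('D_v psi y).
Proof. by move=> Uy; have [c _ [cc _ _ _]] := param_curve v Uy; exists c. Qed.

Lemma tilde_param y v q : U y -> M q ->
  tilde G act (psi y) ('D_v psi y) q = vel (psi y) ('D_v psi y) q.
Proof. by move=> Uy Mq; apply: tilde_vel => //; exact: tangent_param. Qed.

Let fa a (z : 'rV[R]_d * F) := pr a (act (psi z.1) z.2).

Lemma pr_vel_param a y v q : U y -> M q ->
  'D_(v, 0) (fa a) (y, q) = pr a (vel (psi y) ('D_v psi y) q).
Proof.
move=> Uy Mq.
have [c cE [_ c0 dc D1]] := param_curve v Uy.
have Gc : G (c 0) by rewrite c0; apply: SG; exact: local_param_image.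
have H := is_derive_lcm (pr_lcm a) (velP Mq Gc dc).
rewrite c0 D1 in H; case: H => _ <-.
have LL : linear_continuous_map (fun s : R => (s *: v, 0 : F)).
  exact: lcm_comp (@lcm_inl _ _ _) (lcm_scalel v).
have [eq1 _] := derive_affine LL (fa a) (y, q) 0 1.
have E0 (s' : R) : (s' *: v, 0) + (y, q) = (s' *: v + y, q) :> ('rV[R]_d * F)%type.
  by apply: injective_projections => //=; rewrite add0r.
rewrite scale1r E0 scale0r add0r in eq1.
have Ef : (fun s : R => fa a ((s *: v, 0) + (y, q))) = pr a \o (fun s => act (c s) q).
  by apply/funext => s; rewrite E0 /fa /= cE.
by rewrite -eq1 Ef.
Qed.

Lemma gram_kinetic y : U y -> gram kin psi y = integral_gram M mu fa y.
Proof.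
move=> Uy; apply/matrixP => i j; rewrite !mxE /kinetic.
apply: eq_Int => q Mq.
rewrite /partial !tilde_param // ipE.
by apply: eq_bigr => a _; rewrite !pr_vel_param.
Qed.

(** Positive definiteness of the kinetic metric at [g]. It is a pointwise condition because it will
    be verified along the subgroup. *)
Definition nondegenerate_at g := forall X, tangent_at g X ->
  Int (fun q => \sum_a pr a (vel g X q) ^+ 2) = 0 -> X = 0.

(** If [v] is in the kernel of the Gram matrix, then ['D_v psi y] has length 0, hence vanishes by
    nondegeneracy, and [v = 0] because [psi] is an immersion. *)
Lemma gram_kinetic_unit y : U y -> nondegenerate_at (psi y) -> gram kin psi y \in unitmx.
Proof.
move=> Uy nd; have [Om [oOm UM fC]] := act_smooth oU sU (fun y Uy => SG (local_param_image Uy)).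
rewrite -row_free_unit; apply/row_freeP.
have inj (v : 'rV[R]_d) : v *m gram kin psi y = 0 -> v = 0.
  move=> v0.
  have : 'D_v psi y = 0.
    apply: nd; first exact: tangent_param.
    have Q0 : (v *m gram kin psi y *m v^T) 0 0 = 0 by rewrite v0 mul0mx mxE.
    apply: etrans _ Q0.
    have fc i a : cont_on M (fun q => 'D_(delta_mx 0 i, 0) (fa a) (y, q)).
      apply: (@smooth_cont_on _ _ _ _ _ _ UM ('D_(delta_mx 0 i, 0) (fa a))) => //.
      exact: class_C_derive (fC a 1%N).
    have -> : (v *m gram kin psi y *m v^T) 0 0 = \sum_i \sum_j v 0 i * v 0 j * integral_gram M mu fa y i j.
      rewrite gram_kinetic // mxE exchange_big /=; apply: eq_bigr => j _.
      rewrite !mxE mulr_suml; apply: eq_bigr => i _.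
      by rewrite mulrAC.
    under [RHS]eq_bigr do under eq_bigr do rewrite mxE.
    rewrite Int_quadratic //; apply: eq_Int => q Mq; apply: eq_bigr => a _; congr (_ ^+ 2).
    rewrite (derive_sum_partial kap_lcm kap_inj v oU (sU 1) Uy).
    rewrite (vel_sum (psi y) q) (lcm_sum (pr_lcm a)).
    by apply: eq_bigr => i _; rewrite (lcmZ (pr_lcm a)) -pr_vel_param.
  by case: psiP => _ _ _ + _; apply.
apply/row_freeP; rewrite -kermx_eq0; apply/eqP/row_matrixP => i.
by rewrite row0; apply: inj; rewrite -row_mul mulmx_ker row0.
Qed.

(* The geodesic equation, with its index lowered by the Gram matrix, is the vanishing of this form. *)
Definition lagrange_form (c : R -> E) (t : R) (X : E) := Int (fun q =>
  \sum_a pr a (vel (c t) X q) * derive1n 2 (fun s => pr a (act (c s) q)) t).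

(** The form does not depend on [S]: passing from the subgroup to [G] only enlarges the space of
    tangent vectors on which it has to vanish. *)
Lemma geodesic_eqP (J : set R) (x : R -> 'rV[R]_d) (c : R -> E) t :
  open J -> smooth_on J x -> (forall s, J s -> U (x s) /\ c s = psi (x s)) -> J t ->
  nondegenerate_at (c t) ->
  (forall k, derive1n 2 x t 0 k + \sum_i \sum_j christoffel kin psi (x t) k i j
     * derive1 x t 0 i * derive1 x t 0 j = 0) <->
  (forall l, lagrange_form c t (partial l psi (x t)) = 0).
Proof.
move=> oJ sx Jx Jt nd.
have [Ut ct] := Jx t Jt; rewrite ct in nd.
have [Om [oOm UM fC]] := act_smooth oU sU (fun y Uy => SG (local_param_image Uy)).
have := christoffel_lower (derive1n 2 x t) (derive1 x t) (gram_kinetic_unit Ut nd).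
move=> /= H; apply: iff_trans H _.
have JU s : J s -> U (x s) by move=> /Jx[].
suff H l : \sum_j gram kin psi (x t) l j * derive1n 2 x t 0 j + \sum_i \sum_j
    (partial i (fun y => gram kin psi y j l) (x t)
     - 2^-1 * partial l (fun y => gram kin psi y i j) (x t))
      * derive1 x t 0 i * derive1 x t 0 j = lagrange_form c t (partial l psi (x t)).
  by split=> h l; [rewrite -H|rewrite H].
have pg l' i j : partial l' (fun y => gram kin psi y i j) (x t) =
    partial l' (fun y => integral_gram M mu fa y i j) (x t).
  apply: near_eq_derive; apply: filterS (open_nbhs_nbhs (conj oU Ut)) => y Uy.
  by rewrite gram_kinetic.
rewrite gram_kinetic //.
under [X in _ + X = _]eq_bigr do under eq_bigr do rewrite !pg.
apply: etrans (euler_lagrange cM muM oOm UM fC l oJ (sx 2) JU Jt) _.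
apply: eq_Int => q Mq; apply: eq_bigr => a _.
apply: (f_equal2 *%R); first by rewrite ct; exact: pr_vel_param.
by apply: (derive1n2_eq oJ Jt) => s Js; case: (Jx s Js) => _ ->.
Qed.
End Param.
End KineticGeodesic.

(** * The volume of a homogeneous submanifold *)

(** Read off from the definition of the integral as a supremum over simple functions; it serves to
    compare the volume density with constants. *)
Lemma ge0_integral_mono d (T : measurableType d) (R : realType)
    (mu : {measure set T -> \bar R}) (D : set T) (f g : T -> \bar R) :
  (forall x, D x -> 0 <= f x)%E -> (forall x, D x -> f x <= g x)%E ->
  (\int[mu]_(x in D) f x <= \int[mu]_(x in D) g x)%E.
Proof.
move=> f0 fg; have g0 x : D x -> (0 <= g x)%E by move=> Dx; rewrite (le_trans (f0 x Dx)) ?fg.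
rewrite !ge0_integralE //; apply: le_ereal_sup => _ [h hf <-]; exists h => // x.
apply: le_trans (hf x) _; rewrite !patchE; case: ifP => // /set_mem; exact: fg.
Qed.

Lemma eq_integral_in d (T : measurableType d) (R : realType)
    (mu : set T -> \bar R) (D : set T) (f g : T -> \bar R) :
  (forall x, D x -> f x = g x) -> (\int[mu]_(x in D) f x = \int[mu]_(x in D) g x)%E.
Proof.
move=> fg; rewrite /integral.
suff -> : f \_ D = g \_ D by [].
by apply/funext => x; rewrite !patchE; case: ifP => // /set_mem; exact: fg.
Qed.

(** The norm of row vectors is the sup norm, so balls are cubes, whose product measure is
    immediate. *)
Lemma vec3_box (R : realType) (r : R) :
  [set z : R * R * R | `|vec3 z| < r] = (`]-r, r[ `*` `]-r, r[) `*` `]-r, r[.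
Proof.
have c0 (z : R * R * R) : vec3 z 0 0 = z.1.1 by rewrite mxE.
have c1 (z : R * R * R) : vec3 z 0 1 = z.1.2 by rewrite mxE.
have c2 (z : R * R * R) : vec3 z 0 (lift 0 1) = z.2 by rewrite mxE.
apply/seteqP; split=> z /=.
  move=> zr.
  have := le_lt_trans (ler_mx_coord (vec3 z) 0 0) zr.
  have := le_lt_trans (ler_mx_coord (vec3 z) 0 1) zr.
  have := le_lt_trans (ler_mx_coord (vec3 z) 0 (lift 0 1)) zr.
  by rewrite c0 c1 c2 !in_itv /= !ltr_norml.
rewrite !in_itv /= => -[[h0 h1] h2].
have r0 : 0 < r by move: h0 => /andP[a b]; have := lt_trans a b; rewrite -subr_gt0 opprK -mulr2n pmulrn_lgt0.
rewrite [ltLHS]mx_normrE; apply/bigmax_ltP; split=> // -[i j] _ /=.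
rewrite ord1 ltr_norml; case: j => -[|[|[|//]]] jn; rewrite /vec3 mxE //=.
Qed.

Lemma lebesgue3_box (R : realType) (r : R) : 0 < r ->
  lebesgue3 [set z : R * R * R | `|vec3 z| < r] = ((r + r) ^+ 3)%:E.
Proof.
move=> r0; rewrite vec3_box /lebesgue3.
have mI : measurable (`]-r, r[ : set R) by exact: measurable_itv.
have E2 := product_measure1E lebesgue_measure lebesgue_measure mI mI.
have E3 := product_measure1E (lebesgue_measure \x lebesgue_measure)%E lebesgue_measure
  (measurableX mI mI) mI.
have E1 : lebesgue_measure (`]-r, r[ : set R) = (r + r)%:E.
  rewrite lebesgue_measure_itv /= lte_fin ifT; last by rewrite -subr_gt0 opprK addr_gt0.
  by rewrite -EFinB opprK.
apply: etrans E3 _; apply: etrans (f_equal2 *%E E2 erefl) _.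
apply: etrans (f_equal2 *%E (f_equal2 *%E E1 E1) E1) _.
by rewrite -!EFinM; congr (_%:E); ring.
Qed.

(* Defs integrates over [R * R * R] with the default measurable display of [R],
   which is not the display of [lebesgue_measure]; the measurable sets agree. *)
Lemma lebesgue3_0 (R : realType) : @lebesgue3 R set0 = 0%E.
Proof. exact: (@measure0 _ _ _ ((@lebesgue_measure R \x @lebesgue_measure R) \x @lebesgue_measure R)%E). Qed.

Lemma lebesgue3_ge0 (R : realType) (A : set (R * R * R)) : (0 <= @lebesgue3 R A)%E.
Proof. exact: (@measure_ge0 _ _ _ ((@lebesgue_measure R \x @lebesgue_measure R) \x @lebesgue_measure R)%E). Qed.

Lemma lebesgue3_sigma_additive (R : realType) : semi_sigma_additive (@lebesgue3 R).
Proof.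
exact: (@measure_semi_sigma_additive _ _ _
  ((@lebesgue_measure R \x @lebesgue_measure R) \x @lebesgue_measure R)%E).
Qed.

HB.instance Definition _ (R : realType) := isMeasure.Build _ (R * R * R)%type R (@lebesgue3 R)
  (@lebesgue3_0 R) (@lebesgue3_ge0 R) (@lebesgue3_sigma_additive R).

Definition rball (R : realType) (d : nat) (r : R) := [set y : 'rV[R]_d | `|y| < r].

Section Volume.
Variables (R : realType) (F : normedModType R) (M : set F) (ip : F -> F -> R).
Variable mu : {measure set (borel F) -> \bar R}.
Hypothesis volM : volume_measure M ip mu.
Hypothesis cM : compact M.

(** Linear isometries of the ambient space that preserve [M]. The inverse [T'] belongs to the data,
    so that the image of a Borel set by [T] is written as a preimage by [T']. *)
Definition isometry_of (T T' : F -> F) :=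
  [/\ linear_continuous_map T, linear_continuous_map T', cancel T T' /\ cancel T' T,
      forall x y, ip (T x) (T y) = ip x y & forall q, M q <-> M (T q)].

Lemma isometry_of_sym T T' : isometry_of T T' -> isometry_of T' T.
Proof.
case=> TL TL' [TK TK'] Tip TM; split=> // [x y|q].
  by rewrite -{2}(TK' x) -{2}(TK' y) Tip.
by rewrite -{1}(TK' q); apply: iff_sym; exact: TM.
Qed.

(** A linear [T] commutes with differentiation and preserves [ip], so the Gram matrix, hence the
    volume density, is unchanged. *)
Lemma local_param_isometry T T' d (U : set 'rV[R]_d) phi : isometry_of T T' ->
  local_param M U phi -> local_param M U (T \o phi) /\
  (forall y, U y -> gram (fun=> ip) (T \o phi) y = gram (fun=> ip) phi y).
Proof.
case=> TL TL' [TK TK'] Tip TM [oU sU inj imm im].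
have DT y v : U y -> 'D_v (T \o phi) y = T ('D_v phi y).
  by move=> Uy; case: (is_derive_lcm TL (derivableP (class_C_derivable (v := v) (sU 1%N) Uy))).
split.
  split=> //.
  - by move=> k; exact: class_C_lcm TL _ _ _ _ oU (sU k).
  - by move=> x y Ux Uy /= /(can_inj TK); exact: inj.
  - move=> y v Uy; rewrite DT // => H; apply: (imm _ _ Uy).
    by rewrite -[LHS]TK H (lcm0 TL').
  - move=> U' oU' UU; have [W oW WE] := im U' oU' UU.
    exists (T' @^-1` W); first by apply: open_comp => // y _; exact: TL'.2.
    apply/seteqP; split=> q.
      move=> [y Uy <-] /=; have : (phi @` U') (phi y) by exists y.
      by rewrite WE TK => -[Mq Wq]; split=> //; exact: (TM _).1.
    move=> [Mq /= Wq]; have : (M `&` W) (T' q) by split=> //; apply: (TM _).2; rewrite TK'.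
    by rewrite -WE => -[y Uy e]; exists y => //=; rewrite e TK'.
by move=> y Uy; apply/matrixP => i j; rewrite !mxE /partial !DT.
Qed.

Lemma borel_preimage T (B : set (borel F)) : continuous T ->
  measurable B -> measurable (T @^-1` B : set (borel F)).
Proof.
move=> cT mB.
have mT : measurable_fun [set: borel F] (T : borel F -> borel F).
  apply: (@measurability _ _ (borel F) (borel F) setT T (@open F)) => //.
  move=> _ [W oW <-]; rewrite setTI; apply: borel_open.
  by apply: open_comp.
by have := mT measurableT B mB; rewrite setTI.
Qed.

Lemma measurable_chart (U : set 'rV[R]_3) phi : local_param M U phi ->
  measurable (phi @` U : set (borel F)).
Proof.
case=> oU _ _ _ /(_ U oU (fun _ h => h)) [W oW ->].
by apply: measurableI; [exact: borel_compact|exact: borel_open].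
Qed.

(** The volumes of [B] in the chart [phi] and of its image in the chart [T \o phi] are one and the
    same integral over the parameters. *)
Lemma mu_isometry_chart T T' (U : set 'rV[R]_3) phi (B : set (borel F)) :
  isometry_of T T' -> local_param M U phi -> measurable B -> B `<=` phi @` U ->
  mu (T' @^-1` B) = mu B.
Proof.
move=> iT pU mB BU; have [pT gT] := local_param_isometry iT pU.
case: (iT) => TL TL' [TK TK'] Tip TM.
have mTB := borel_preimage TL'.2 mB.
have := volM.2 U phi pU B mB; rewrite setIidl // => ->.
have -> : T' @^-1` B = T' @^-1` B `&` (T \o phi) @` U.
  rewrite setIidl // => q /= /BU [y Uy e]; exists y => //=; by rewrite e TK'.
rewrite (volM.2 U _ pT _ mTB).
have -> : [set z | U (vec3 z) /\ (T' @^-1` B) ((T \o phi) (vec3 z))] =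
          [set z | U (vec3 z) /\ B (phi (vec3 z))].
  by apply/seteqP; split=> z /=; rewrite TK.
by apply: eq_integral_in => z [Uz _]; rewrite gT.
Qed.

Variables (Idx : finType) (crd : Idx -> F -> R).
Hypothesis crd_lcm : forall a, linear_continuous_map (crd a).
Hypothesis ipE : forall x y, ip x y = \sum_a crd a x * crd a y.
Variable (phi : 'rV[R]_3 -> F) (U0 : set 'rV[R]_3).
Hypothesis phiP : local_param M U0 phi.
Hypothesis U00 : U0 0.
Hypothesis gram0 : 0 < \det (gram (fun=> ip) phi 0).
Hypothesis transitive : forall p, M p -> exists T T', isometry_of T T' /\ T (phi 0) = p.

Let gram_cont : {for 0, continuous (fun y => \det (gram (fun=> ip) phi y))}.
Proof.
have [oU sU _ _ _] := phiP.
suff : class_C 0 U0 (fun y => \det (gram (fun=> ip) phi y)) by case=> /(_ 0 U00).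
apply: (class_C_det oU); apply: (class_C_mx oU) => i j.
have -> : (fun y => gram (fun=> ip) phi y i j) =
    (fun y => \sum_a crd a (partial i phi y) * crd a (partial j phi y)).
  by apply/funext => y; rewrite mxE ipE.
have dC i' : class_C 0 U0 (partial i' phi) by exact: class_C_derive (sU 1%N).
move: (dC i) (dC j); move: (partial i _) (partial j _) => f f' fC fC'.
apply: (class_C_sum _ oU) => a _.
have F1 := class_C_lcm (crd_lcm a) oU fC; have F2 := class_C_lcm (crd_lcm a) oU fC'.
by have := class_CM oU F1 F2.
Qed.

(** By continuity at 0 the Gram determinant stays between one half and three halves of its value
    there. *)
Lemma small_chart : exists2 r : R, 0 < r & exists2 e, 0 < e & exists K, forall y, `|y| < r ->
  U0 y /\ e <= \det (gram (fun=> ip) phi y) <= K.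
Proof.
case: (phiP) => oU _ _ _ _.
have D2 : 0 < \det (gram (fun=> ip) phi 0) / 2 by rewrite divr_gt0.
have /cvgrPdist_le /(_ _ D2) nD := gram_cont.
have : \forall y \near (0 : 'rV[R]_3), U0 y /\ `|\det (gram (fun=> ip) phi 0) -
    \det (gram (fun=> ip) phi y)| <= \det (gram (fun=> ip) phi 0) / 2.
  exact: filterI (open_nbhs_nbhs (conj oU U00)) nD.
move=> /nbhs_normP[r /= r0 rP].
move: D2 gram0 rP; set D := \det (gram (fun=> ip) phi 0) => D2 D0 rP.
exists r => //; exists (D / 2) => //; exists (D + D / 2) => y yr.
have [Uy] : U0 y /\ `|D - \det (gram (fun=> ip) phi y)| <= D / 2.
  by apply: rP; rewrite /= sub0r normrN.
by rewrite ler_norml => /andP[h1 h2]; split=> //; apply/andP; split; lra.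
Qed.

Lemma local_param_subset (S : set F) d (U U' : set 'rV[R]_d) psi : open U' -> U' `<=` U ->
  local_param S U psi -> local_param S U' psi.
Proof.
move=> oU' UU [oU sU inj imm im]; split=> //.
- by move=> k; exact: class_C_subset UU (sU k).
- by move=> x y; rewrite !inE => /UU Ux /UU Uy; apply: inj; rewrite inE.
- by move=> x v /UU; exact: imm.
- by move=> U'' oU'' UU''; apply: im => // x /UU'' /UU.
Qed.

Lemma open_norm_ball d r : open (@rball R d r).
Proof.
rewrite (_ : @rball R d r = Num.Def.normr @^-1` `]-oo, r[%classic); last first.
  by apply/seteqP; split=> y; rewrite /= in_itv.
by apply: open_comp => [y _|]; [exact: norm_continuous|exact: interval_open].
Qed.

Lemma chart_measure : exists2 r : R, 0 < r & local_param M (rball r) phi /\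
  (0 < mu (phi @` (rball r)) < +oo)%E.
Proof.
have [r r0 [e e0 [K KP]]] := small_chart.
have pr : local_param M (rball r) phi.
  by apply: local_param_subset phiP; [exact: open_norm_ball|move=> y /KP[]].
exists r => //; split=> //.
have := volM.2 _ phi pr setT measurableT; rewrite setTI => ->.
set D := [set z | _].
have DE : D = [set z | `|vec3 z| < r] by apply/seteqP; split=> z; rewrite /D //= => -[].
have mD : measurable (D : set (R * R * R)).
  by rewrite DE vec3_box; apply: measurableX; [apply: measurableX|]; exact: measurable_itv.
have cst c : (\int[@lebesgue3 R]_(z in D) (c%:E) = (c * (r + r) ^+ 3)%:E)%E.
  apply: etrans (integral_cst (@lebesgue3 R) mD c%:E) _; rewrite EFinM; congr (_ * _)%E.
  by have := lebesgue3_box r0; rewrite -DE.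
have DP z : D z -> e <= \det (gram (fun=> ip) phi (vec3 z)) <= K.
  by rewrite DE => /KP[].
apply/andP; split.
  apply: (@lt_le_trans _ _ (\int[@lebesgue3 R]_(z in D) ((Num.sqrt e)%:E))%E).
    by rewrite cst lte_fin mulr_gt0 ?sqrtr_gt0 // exprn_gt0 // addr_gt0.
  apply: (@ge0_integral_mono _ _ _ (@lebesgue3 R)) => z Dz; first by rewrite lee_fin sqrtr_ge0.
  by rewrite lee_fin ler_sqrt; have /andP[h1 h2] := DP z Dz; [exact: h1|exact: le_trans (ltW e0) h1].
apply: (@le_lt_trans _ _ (\int[@lebesgue3 R]_(z in D) ((Num.sqrt K)%:E))%E); last by rewrite cst ltry.
apply: (@ge0_integral_mono _ _ _ (@lebesgue3 R)) => z Dz; first by rewrite lee_fin sqrtr_ge0.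
rewrite lee_fin; have /andP[h1 h2] := DP z Dz.
by rewrite ler_sqrt // (le_trans _ h2) // (le_trans (ltW e0)).
Qed.

(** Transitivity carries the chart at [phi 0] to every point of [M], and compactness retains
    finitely many translates. *)
Lemma finite_chart_cover : exists (T T' : F -> F -> F) (B : set 'rV[R]_3) (s : seq F),
  [/\ local_param M B phi, (mu (phi @` B) < +oo)%E,
     forall p, p \in s -> isometry_of (T p) (T' p) &
     forall q, M q -> exists2 p, p \in s & ((T p \o phi) @` B) q].
Proof.
have [r r0 [pr /andP[_ fin]]] := chart_measure.
have [|TT TP] := @choice _ _ (fun p (t : ((F -> F) * (F -> F)) * set F) => M p ->
    [/\ isometry_of t.1.1 t.1.2, t.1.1 (phi 0) = p, open t.2 &
      (t.1.1 \o phi) @` (rball r) = M `&` t.2]).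
  move=> p.
  (* Outside [M] the chosen data are a mere default. *)
  have [Mp|nMp] := pselect (M p); last by exists ((id, id), set0).
  have [T [T' [iT Tp]]] := transitive Mp.
  have [[oU _ _ _ im] _] := local_param_isometry iT pr.
  have [W oW WE] := im _ oU (fun _ h => h).
  by exists ((T, T'), W).
have := cM; rewrite compact_cover => /(_ F M (fun p => (TT p).2)).
case=> [p /TP[]//|p Mp|D' D'M cov].
  exists p => //; have [_ Tp _ WE] := TP p Mp.
  suff : (((TT p).1.1 \o phi) @` (rball r)) p by rewrite WE => -[].
  by exists 0 => //; rewrite /rball /= normr0.
exists (fun p => (TT p).1.1), (fun p => (TT p).1.2), (rball r), (finmap.enum_fset D').
split=> // [p pD'|q Mq].
  have /TP[]// : M p.
  by have := D'M _ pD'; rewrite inE.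
have [p /= pD' Wq] := cov q Mq; exists p => //.
have Mp : M p by have := D'M _ pD'; rewrite inE.
have [_ _ _ WE] := TP p Mp.
suff : (((TT p).1.1 \o phi) @` rball r) q by [].
by rewrite WE.
Qed.

Lemma borel_fin_union (s : seq F) (C : F -> set F) :
  (forall p, p \in s -> measurable (C p : set (borel F)) /\ (mu (C p) < +oo)%E) ->
  exists2 D : set (borel F), measurable D /\ (mu D < +oo)%E &
    forall q p, p \in s -> C p q -> D q.
Proof.
elim: s => [|p s IH] H; first by exists set0; [split=> //; rewrite measure0 ltry|].
have [p' p's|D [mD fD] DP] := IH; first by apply: H; rewrite inE p's orbT.
have [mC fC] := H p (mem_head _ _).
exists (D `|` C p).
  split; first exact: measurableU.
  by apply: le_lt_trans (measureU2 _ mD mC) _; exact: lte_add_pinfty.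
move=> q p'; rewrite inE => /orP[/eqP -> ?|p's Cq]; [by right|left; exact: DP Cq].
Qed.

Lemma volume_finite : (mu M < +oo)%E.
Proof.
have [T [T' [B [s [pB fB iT cov]]]]] := finite_chart_cover.
have [p ps|D [mD fD] DP] := @borel_fin_union s (fun p => (T p \o phi) @` B).
  have [pTB _] := local_param_isometry (iT p ps) pB.
  split; first exact: measurable_chart.
  have mB := measurable_chart pB.
  rewrite (_ : (T p \o phi) @` B = T' p @^-1` (phi @` B)).
    by rewrite (mu_isometry_chart (iT p ps) pB mB).
  case: (iT p ps) => _ _ [TK TK'] _ _; apply/seteqP; split=> q.
    by move=> [y By <-] /=; exists y => //=; rewrite TK.
  by move=> [y By e]; exists y => //=; rewrite e TK'.
apply: le_lt_trans fD; apply: le_measure; rewrite ?inE //; first exact: borel_compact.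
by move=> q Mq; have [p ps Tq] := cov q Mq; exact: DP ps Tq.
Qed.

Lemma volume_gt0 : (0 < mu M)%E.
Proof.
have [r r0 [pr /andP[pos _]]] := chart_measure.
apply: lt_le_trans pos _; apply: le_measure; rewrite ?inE; [exact: measurable_chart|exact: borel_compact|].
by case: (pr) => oU _ _ _ /(_ _ oU (fun _ h => h)) [W _ ->] q [].
Qed.

Lemma Int1_gt0 : 0 < Int M mu (fun=> 1).
Proof.
rewrite /Int Rintegral_cst; last exact: borel_compact.
by rewrite mul1r fine_gt0 // volume_gt0 volume_finite.
Qed.

(** Inside one chart this is [mu_isometry_chart]. A Borel subset of [M] is cut along the finite
    cover, one chart at a time, by induction on the list of centres. Outside [M] both sets are null,
    because [T] preserves [M]. *)
Lemma volume_invariant T T' (B : set (borel F)) : isometry_of T T' -> measurable B ->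
  mu (T' @^-1` B) = mu B.
Proof.
move=> iT mB.
have [S [S' [C [s [pC _ iS cov]]]]] := finite_chart_cover.
have mM := borel_compact cM.
case: (iT) => TL TL' [TK TK'] Tip TM.
have T'c : continuous T' := TL'.2.
have onM A : measurable (A : set (borel F)) -> A `<=` M -> mu (T' @^-1` A) = mu A.
  move=> mA AM.
  have : forall q, A q -> exists2 p, p \in s & ((S p \o phi) @` C) q.
    by move=> q /AM; exact: cov.
  elim: s iS A {cov AM} mA => [|p s IH] iS A mA cov.
    rewrite (_ : A = set0) ?preimage_set0 //.
    by apply/seteqP; split=> q // /cov[].
  have [pp _] := local_param_isometry (iS p (mem_head _ _)) pC.
  have mp := measurable_chart pp.
  have mA1 := measurableI _ _ mA mp; have mA2 := measurableD mA mp.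
  have e1 := measureDI mu (borel_preimage T'c mA) (borel_preimage T'c mp).
  apply: etrans e1 _; rewrite (measureDI mu mA mp); apply: (f_equal2 adde).
    apply: (IH _ _ mA2) => [p' p's|q [Aq nq]]; first by apply: iS; rewrite inE p's orbT.
    by have [p'] := cov q Aq; rewrite inE => /orP[/eqP -> //|p's h]; exists p'.
  apply: (mu_isometry_chart iT pp mA1).
  by move=> q [].
have null A : measurable (A : set (borel F)) -> A `<=` ~` M -> mu A = 0%E.
  move=> mA AM; apply: (subset_measure0 mA _ AM volM.1).
  exact: measurableC.
rewrite (measureDI mu mB mM) (measureDI mu (borel_preimage T'c mB) mM).
have mTB := borel_preimage T'c mB.
apply: (f_equal2 adde).
  apply: etrans (null _ _ _) (esym (null _ _ _)); try by move=> q [].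
    exact: measurableD.
  exact: measurableD.
apply: etrans _ (onM (B `&` M) (measurableI _ _ mB mM) (fun q h => h.2)).
congr (mu _); apply/seteqP; split=> q [h1 h2]; split=> //=.
  by apply: (TM _).2; rewrite TK'.
by rewrite -(TK' q); apply: (TM _).1.
Qed.

(** The change of variables is applied to [g + C], nonnegative on the compact [M] for a bound [C] of
    [g]; the constant is then removed by linearity. *)
Lemma Int_isometry T T' g : isometry_of T T' -> cont_on M g ->
  Int M mu (fun q => g (T q)) = Int M mu g.
Proof.
move=> iT gc; case: (iT) => TL TL' [TK TK'] Tip TM.
have mM := borel_compact cM.
have muf := volume_finite.
have [C C0 CP] := cont_on_bounded cM gc.
have gTc : cont_on M (fun q => g (T q)).
  move=> q Mq; apply: (@continuous_comp _ _ _ T g); first exact: TL.2.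
  by apply: gc; apply: (TM _).1.
have key : Int M mu (fun q => g (T q) + C) = Int M mu (fun q => g q + C).
  have mf : measurable_fun (M : set (borel F)) (EFin \o (fun q : borel F => g q + C)).
    by apply/measurable_EFinP; apply: (cont_on_measurable cM); apply: cont_onD => //; exact: cont_on_cst.
  have mT : measurable_fun [set: borel F] (T : borel F -> borel F).
    by move=> _ B mB; rewrite setTI; exact: borel_preimage TL.2 mB.
  have f0 : {in M, forall y, (0 <= (g y + C)%:E)%E}.
    move=> y /set_mem My; rewrite lee_fin -lerBlDr sub0r lerNl.
    by apply: le_trans (CP y My); rewrite -normrN ler_norm.
  have := ge0_integral_pushforward mT mu mM mf f0.
  have -> : T @^-1` M = M by apply/seteqP; split=> q; [exact: (TM q).2|exact: (TM q).1].
  rewrite /Int /Rintegral => <-; congr fine.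
  apply: eq_measure_integral => B mB _.
  exact: volume_invariant (isometry_of_sym iT) mB.
move: key; rewrite !(IntD cM muf) //; try exact: cont_on_cst.
by move/addIr.
Qed.

(* The charts [T \o phi] cover the compact [M] and have the same Gram matrices as [phi]. *)
Lemma homogeneous_volume : [/\ (mu M < +oo)%E, 0 < Int M mu (fun=> 1) &
  forall T T' g, isometry_of T T' -> cont_on M g -> Int M mu (fun q => g (T q)) = Int M mu g].
Proof.
by split; [exact: volume_finite|exact: Int1_gt0|move=> T T' g; exact: Int_isometry].
Qed.
End Volume.

(** * Cayley charts *)

Lemma lcm_mx (R : realType) (W : normedModType R) m n (L : 'M[R]_(m, n) -> W) :
  linear L -> linear_continuous_map L.
Proof.
move=> Ll; split=> // A.
have E B : L B = \sum_i \sum_j B i j *: L (delta_mx i j).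
  rewrite {1}(mx_sum_coord B) (big_morph L (linD Ll) (lin0 Ll)); apply: eq_bigr => i _.
  by rewrite (big_morph L (linD Ll) (lin0 Ll)); apply: eq_bigr => j _; rewrite (linZ Ll).
rewrite /continuous_at E; rewrite (_ : L @ A = (fun B => \sum_i \sum_j B i j *: L (delta_mx i j)) @ A); last first.
  by congr (_ @ A); apply/funext.
apply: cvg_sum => i _; apply: cvg_sum => j _.
apply: (lcm_cvg (bcm_lcmr (bilinear_continuous_scaler _) _)).
exact: coord_continuous.
Qed.

Lemma class_C_id (R : realType) (V : normedModType R) k (U : set V) : class_C k U id.
Proof. by apply: class_C_lin; split=> // x; exact: cvg_id. Qed.

Lemma open_unitmx (R : realType) n : open [set A : 'M[R]_n | A \in unitmx].
Proof.
rewrite (_ : [set A : 'M[R]_n | A \in unitmx] = (fun P => \det P) @^-1` [set x : R | x != 0]).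
  apply: open_comp; last exact: open_neq.
  move=> y _; have : class_C 0 setT (fun P : 'M[R]_n => \det P).
    by apply: class_C_det openT (class_C_id _ _).
  by case=> /(_ y I).
by apply/seteqP; split=> y /=; rewrite unitmxE unitfE.
Qed.

Section Cayley.
Variables (R : realType) (n : nat).
Implicit Types X N : 'M[R]_n.

(** A rational substitute for the exponential: it sends the solutions of X^T J + J X = 0 into the
    group P^T J P = J, and its inverse [inv_cayley] is rational too. *)
Definition cayley X : 'M[R]_n := invmx (1%:M - X) *m (1%:M + X).
Definition inv_cayley N : 'M[R]_n := (N - 1%:M) *m invmx (N + 1%:M).

Let comm_1BX X : (1%:M - X) *m (1%:M + X) = (1%:M + X) *m (1%:M - X).
Proof.
rewrite !(mulmxDr, mulmxBr, mulmxDl, mulmxBl, mulNmx, mulmxN) !mulmx1 !mul1mx.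
by move: (X *m X) (1%:M : 'M[R]_n) => a b; apply/matrixP => i j; rewrite !mxE; ring.
Qed.

Let add2 (A X : 'M[R]_n) : A + X + (A - X) = 2 *: A.
Proof. by apply/matrixP => i j; rewrite !mxE; ring. Qed.

Let sub2 (A X : 'M[R]_n) : A + X - (A - X) = 2 *: X.
Proof. by apply/matrixP => i j; rewrite !mxE; ring. Qed.

Let unit2 X : X \in unitmx -> 2 *: X \in unitmx.
Proof. by move=> u; rewrite unitmxZ // unitfE pnatr_eq0. Qed.

Lemma cayleyE X : 1%:M - X \in unitmx -> cayley X = (1%:M + X) *m invmx (1%:M - X).
Proof.
move=> u; apply: (can_inj (mulKmx u)); rewrite mulKVmx // mulmxA comm_1BX.
by rewrite -mulmxA mulmxV // mulmx1.
Qed.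

Lemma cayley0 : cayley 0 = 1%:M.
Proof. by rewrite /cayley subr0 addr0 invmx1 mulmx1. Qed.

Lemma cayleyD1 X : 1%:M - X \in unitmx -> cayley X + 1%:M = 2 *: invmx (1%:M - X).
Proof.
move=> u; apply: (can_inj (mulKmx u)).
by rewrite mulmxDr mulKVmx // mulmx1 -scalemxAr mulmxV // add2.
Qed.

Lemma cayleyB1 X : 1%:M - X \in unitmx -> cayley X - 1%:M = 2 *: (invmx (1%:M - X) *m X).
Proof.
move=> u; apply: (can_inj (mulKmx u)).
by rewrite mulmxBr mulKVmx // mulmx1 -scalemxAr mulKVmx // sub2.
Qed.

Lemma cayleyD1_unit X : 1%:M - X \in unitmx -> cayley X + 1%:M \in unitmx.
Proof. by move=> u; rewrite cayleyD1 // unit2 // unitmx_inv. Qed.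

Lemma cayleyK X : 1%:M - X \in unitmx -> inv_cayley (cayley X) = X.
Proof.
move=> u; rewrite /inv_cayley cayleyD1 // cayleyB1 // invmxZ ?unit2 ?unitmx_inv //.
rewrite invmxK -scalemxAl -scalemxAr scalerA mulfV ?pnatr_eq0 // scale1r.
have c : X *m (1%:M - X) = (1%:M - X) *m X by rewrite mulmxBr mulmxBl mulmx1 mul1mx.
by rewrite -mulmxA c mulKmx.
Qed.

Lemma inv_cayley_unit N : N + 1%:M \in unitmx -> 1%:M - inv_cayley N \in unitmx /\
  1%:M - inv_cayley N = 2 *: invmx (N + 1%:M).
Proof.
move=> u; suff E : 1%:M - inv_cayley N = 2 *: invmx (N + 1%:M).
  by rewrite E unit2 // unitmx_inv.
apply: (can_inj (mulmxK u)).
rewrite mulmxBl mul1mx /inv_cayley mulmxKV // -scalemxAl mulVmx //.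
Qed.

Lemma inv_cayleyK N : N + 1%:M \in unitmx -> cayley (inv_cayley N) = N.
Proof.
move=> u; have [u' E] := inv_cayley_unit u.
rewrite cayleyE // E invmxZ ?unit2 ?unitmx_inv // invmxK -scalemxAr.
rewrite mulmxDl mul1mx /inv_cayley mulmxKV // add2.
by rewrite scalerA mulVf ?pnatr_eq0 // scale1r.
Qed.

(** From X^T J = - J X follow (1 - X)^T J = J (1 + X) and (1 + X)^T J = J (1 - X), and the factors
    cancel in pairs. *)
Lemma cayley_form (J : 'M[R]_n) X : 1%:M - X \in unitmx ->
  X^T *m J + J *m X = 0 -> (cayley X)^T *m J *m cayley X = J.
Proof.
move=> u XJ; have XJ' : X^T *m J = - (J *m X) by apply/eqP; rewrite -addr_eq0 XJ.
have AJ : (1%:M - X)^T *m J = J *m (1%:M + X).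
  by rewrite linearB /= trmx1 mulmxBl mul1mx XJ' opprK mulmxDr mulmx1.
have BJ : (1%:M + X)^T *m J = J *m (1%:M - X).
  by rewrite linearD /= trmx1 mulmxDl mul1mx XJ' mulmxBr mulmx1.
have uT : (1%:M - X)^T \in unitmx by rewrite unitmx_tr.
rewrite {2}cayleyE // /cayley trmx_mul trmx_inv -!mulmxA (mulmxA J) -AJ.
by rewrite -(mulmxA _ J) mulKmx // mulmxA BJ -mulmxA mulmxV // mulmx1.
Qed.

(** Multiplication by (N + 1)^T on the left and N + 1 on the right clears the inverses; what remains
    is 2 (N^T J N - J) = 0. *)
Lemma inv_cayley_form (J : 'M[R]_n) N : N + 1%:M \in unitmx -> N^T *m J *m N = J ->
  (inv_cayley N)^T *m J + J *m inv_cayley N = 0.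
Proof.
move=> u NJ.
have uT : (N + 1%:M)^T \in unitmx by rewrite unitmx_tr.
apply: (can_inj (mulKmx uT)); apply: (can_inj (mulmxK u)).
rewrite mulmx0 mul0mx [X in X *m _ = _]mulmxDr [LHS]mulmxDl.
have e : inv_cayley N *m (N + 1%:M) = N - 1%:M by rewrite /inv_cayley mulmxKV.
rewrite (mulmxA _ (inv_cayley N)^T J) -trmx_mul.
rewrite e.
rewrite -(mulmxA _ (J *m _)) -(mulmxA J).
rewrite e.
rewrite !mulmxA !linearB !linearD /= trmx1.
rewrite !(mulmxDl, mulmxBl, mulmxDr, mulmxBr, mulNmx) !mulmx1 !mul1mx NJ.
by move: (N^T *m J) (J *m N) => a b; apply/matrixP => i j; rewrite !mxE; ring.
Qed.
End Cayley.

Lemma block_diag_unit (R : comUnitRingType) m n (X : 'M[R]_m) (Y : 'M[R]_n) :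
  (block_mx X 0 0 Y \in unitmx) = (X \in unitmx) && (Y \in unitmx).
Proof. by rewrite !unitmxE det_ublock unitrM. Qed.

Lemma cayley_block_diag (R : realType) m n (X : 'M[R]_m) (Y : 'M[R]_n) :
  1%:M - X \in unitmx -> 1%:M - Y \in unitmx ->
  cayley (block_mx X 0 0 Y) = block_mx (cayley X) 0 0 (cayley Y).
Proof.
move=> uX uY.
have E : 1%:M - block_mx X 0 0 Y = block_mx (1%:M - X) 0 0 (1%:M - Y).
  by rewrite (scalar_mx_block m n 1) opp_block_mx add_block_mx !oppr0 !addr0.
have u : 1%:M - block_mx X 0 0 Y \in unitmx by rewrite E block_diag_unit uX uY.
apply: (can_inj (mulKmx u)); rewrite /cayley mulKVmx // E mulmx_block.
rewrite !mulmxA !mulmx0 !mul0mx !mulmxV // !mul1mx !addr0 !add0r.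
by rewrite (scalar_mx_block m n 1) add_block_mx !addr0.
Qed.

Lemma inv_cayley_block_diag (R : realType) m n (X : 'M[R]_m) (Y : 'M[R]_n) :
  X + 1%:M \in unitmx -> Y + 1%:M \in unitmx ->
  inv_cayley (block_mx X 0 0 Y) = block_mx (inv_cayley X) 0 0 (inv_cayley Y).
Proof.
move=> uX uY.
have E : block_mx X 0 0 Y + 1%:M = block_mx (X + 1%:M) 0 0 (Y + 1%:M).
  by rewrite (scalar_mx_block m n 1) add_block_mx !addr0.
have u : block_mx X 0 0 Y + 1%:M \in unitmx by rewrite E block_diag_unit uX uY.
apply: (can_inj (mulmxK u)); rewrite /inv_cayley mulmxKV // E mulmx_block.
rewrite !mulmx0 !mul0mx !mulmxKV // !addr0 !add0r.
by rewrite (scalar_mx_block m n 1) opp_block_mx add_block_mx !oppr0 !addr0.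
Qed.

(** When the inverse of [psi] extends to a continuous [rho] on an ambient open set [W0], the image
    of [U'] is the trace on [S] of the open set of points of [W0] that [rho] sends into [U']. *)
Lemma local_param_intro (R : realType) (E : normedModType R) (S : set E) d
    (U : set 'rV[R]_d) (psi : 'rV[R]_d -> E) (rho : E -> 'rV[R]_d) (W0 : set E) :
  open U -> smooth_on U psi -> open W0 ->
  (forall P, W0 P -> {for P, continuous rho}) ->
  (forall y, U y -> [/\ S (psi y), W0 (psi y) & rho (psi y) = y]) ->
  (forall P, S P -> W0 P -> U (rho P) /\ psi (rho P) = P) ->
  (forall y v, U y -> 'D_v psi y = 0 -> v = 0) -> local_param S U psi.
Proof.
move=> oU sU oW cr psiP rhoP imm; split=> //.
  move=> x y; rewrite !inE => /psiP[_ _ {2}<-] /psiP[_ _ {2}<-] ->.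
  by [].
move=> U' oU' UU; exists (W0 `&` rho @^-1` U').
  rewrite openE => P [WP UP]; have : nbhs P (rho @^-1` U').
    by apply: (cr P WP); exact: open_nbhs_nbhs.
  by move=> nP; rewrite /interior; apply: filterI => //; exact: open_nbhs_nbhs.
apply/seteqP; split=> P.
  by move=> [y Uy <-]; have [Sy Wy ry] := psiP y (UU y Uy); split=> //; split=> //=; rewrite ry.
by move=> [SP [WP UP]]; exists (rho P) => //; case: (rhoP P SP WP).
Qed.

Section CayleyChart.
Variables (R : realType) (n d : nat) (io : 'rV[R]_d -> 'M[R]_n) (ka : 'M[R]_n -> 'rV[R]_d).
Variables (S : set 'M[R]_n) (g0 : 'M[R]_n).
Hypotheses (iol : linear io) (kal : linear ka) (ioK : cancel io ka) (ug0 : g0 \in unitmx).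
(** Invertibility is supplied on the whole segment from 0 to [io y]: membership in a connected
    component is proved along the path [s |-> cayley (s *: io y) *m g0]. *)
Hypothesis cayS : exists2 r0 : R, 0 < r0 & forall y, `|y| < r0 ->
  (forall s : R, 0 <= s <= 1 -> 1%:M - s *: io y \in unitmx) -> S (cayley (io y) *m g0).
Hypothesis Scay : forall P, S P -> P *m invmx g0 + 1%:M \in unitmx ->
  io (ka (inv_cayley (P *m invmx g0))) = inv_cayley (P *m invmx g0).

Let iol' := lcm_mx iol.
Let kal' := lcm_mx kal.

Definition cayley_param y := cayley (io y) *m g0.
Definition cayley_coord P := ka (inv_cayley (P *m invmx g0)).

Lemma cayley_param0 : cayley_param 0 = g0.
Proof. by rewrite /cayley_param (lcm0 iol') cayley0 mul1mx. Qed.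

Let V0 := [set y | 1%:M - io y \in unitmx].

Let oV0 : open V0.
Proof.
rewrite (_ : V0 = (fun y => 1%:M - io y) @^-1` [set A : 'M[R]_n | A \in unitmx]) //.
apply: open_comp; last exact: open_unitmx.
move=> y _; have : class_C 0 setT (fun y => 1%:M - io y).
  by apply: class_CB openT _ _; [exact: class_C_cst|exact: class_C_lin].
by case=> /(_ y I).
Qed.

Let sV0 : smooth_on V0 cayley_param.
Proof.
move=> k; apply: class_C_mulmx => //; last exact: class_C_cst.
have c1 : class_C k V0 (fun y => 1%:M - io y).
  by apply: class_CB => //; [exact: class_C_cst|exact: class_C_lin].
apply: class_C_mulmx => //; first exact: class_C_invmx.
by apply: class_CD => //; [exact: class_C_cst|exact: class_C_lin].
Qed.

Definition cayley_domain : set 'M[R]_n := [set P | P *m invmx g0 + 1%:M \in unitmx].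

Lemma open_cayley_domain : open cayley_domain.
Proof.
rewrite (_ : cayley_domain = (fun P => P *m invmx g0 + 1%:M) @^-1` [set A : 'M[R]_n | A \in unitmx]) //.
apply: open_comp; last exact: open_unitmx.
move=> y _; have : class_C 0 setT (fun P => P *m invmx g0 + 1%:M).
  apply: class_CD openT _ _; last exact: class_C_cst.
  by apply: class_C_mulmx openT (class_C_id _ _) _; exact: class_C_cst.
by case=> /(_ y I).
Qed.

Lemma smooth_cayley_coord (V : normedModType R) k (U : set V) (c : V -> 'M[R]_n) : open U ->
  class_C k U c -> (forall x, U x -> cayley_domain (c x)) ->
  class_C k U (fun x => cayley_coord (c x)).
Proof.
move=> oU cC cD; apply: (class_C_lcm kal' oU).
have c1 : class_C k U (fun x => c x *m invmx g0).
  by apply: class_C_mulmx => //; exact: class_C_cst.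
apply: class_C_mulmx => //; first by apply: class_CB => //; exact: class_C_cst.
by apply: class_C_invmx => //; apply: class_CD => //; exact: class_C_cst.
Qed.

(** Obtained by differentiating (1 - X) psi = (1 + X) g0, where no inverse occurs. Since psi + g0 =
    (cayley X + 1) g0 is invertible, it also yields that the parametrization is an immersion. *)
Lemma derive_cayley_param y v : V0 y ->
  io v *m (cayley_param y + g0) = (1%:M - io y) *m 'D_v cayley_param y.
Proof.
move=> Vy.
have dp := derivableP (class_C_derivable (v := v) (sV0 1%N) Vy).
have di : is_derive y v (fun y => 1%:M - io y) (- io v).
  have := @is_derive_lcm _ _ _ _ iol' _ id y v v (is_derive_id _ _) => h.
  by have := is_deriveB (is_derive_cst (1%:M : 'M[R]_n) y v) h; rewrite sub0r.
have di2 : is_derive y v (fun y => 1%:M + io y) (io v).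
  have := @is_derive_lcm _ _ _ _ iol' _ id y v v (is_derive_id _ _) => h.
  by have := is_deriveD (is_derive_cst (1%:M : 'M[R]_n) y v) h; rewrite add0r.
have [_ e1] := is_derive_bcm (bilinear_continuous_mulmx R n n n) di dp.
have [_ e2] := is_derive_bcm (bilinear_continuous_mulmx R n n n) di2 (is_derive_cst g0 y v).
have E : 'D_v (fun y => (1%:M - io y) *m cayley_param y) y = 'D_v (fun y => (1%:M + io y) *m g0) y.
  apply: near_eq_derive; apply: filterS (open_nbhs_nbhs (conj oV0 Vy)) => z Vz.
  by rewrite /cayley_param /cayley !mulmxA mulmxV // mul1mx.
move: E; rewrite e1 e2 mulmx0 addr0 mulNmx => E.
by rewrite mulmxDr -E addrA subrr add0r.
Qed.

(** The rational map [cayley_coord] is defined on an ambient open set; composing with it gives both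
    the open-map property of the chart and smooth lifts of the curves of [S] through [g0]. *)
Lemma cayley_chart : exists2 r : R, 0 < r & [/\ local_param S (rball r) cayley_param,
  forall v, 'D_v cayley_param 0 = 2 *: (io v *m g0) &
  forall (I : set R) (c : R -> 'M[R]_n), open I -> smooth_on I c -> (forall s, I s -> S (c s)) ->
    forall t, I t -> c t = g0 -> exists J (x : R -> 'rV[R]_d),
      [/\ open J, J t, J `<=` I, smooth_on J x /\ x t = 0 &
          forall s, J s -> rball r (x s) /\ c s = cayley_param (x s)]].
Proof.
have [r0 r00 SP] := cayS.
have V00 : V0 0 by rewrite /V0 /= (lcm0 iol') subr0 unitmx1.
have /nbhs_normP[r1 /= r10 rP] := open_nbhs_nbhs (conj oV0 V00).
(* Balls are star-shaped about 0, so invertibility on the ball of radius [r1] covers the segments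
   required by [cayS]. *)
pose r := Num.min r0 r1.
have rV y : `|y| < r -> `|y| < r0 /\ forall s : R, 0 <= s <= 1 -> 1%:M - s *: io y \in unitmx.
  rewrite lt_min => /andP[h0 h1]; split=> // s /andP[s0 s1].
  rewrite -(lcmZ iol'); apply: (rP (s *: y)); rewrite /= sub0r normrN normrZ ger0_norm //.
  by apply: le_lt_trans h1; rewrite ler_piMl.
have rV0 y : `|y| < r -> V0 y.
  by move=> /rV[_ /(_ 1)]; rewrite scale1r; apply; rewrite ler01 lexx.
have d0 v : 'D_v cayley_param 0 = 2 *: (io v *m g0).
  have := derive_cayley_param v V00; rewrite cayley_param0 (lcm0 iol') subr0 mul1mx => <-.
  by rewrite mulmxDr scaler_nat mulr2n.
have coordK y : V0 y -> cayley_domain (cayley_param y) /\ cayley_coord (cayley_param y) = y.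
  move=> Vy; rewrite /cayley_domain /cayley_coord /cayley_param /= mulmxK //.
  by split; [exact: cayleyD1_unit|rewrite cayleyK].
have paramK P : S P -> cayley_domain P -> cayley_param (cayley_coord P) = P.
  move=> SPP DP; rewrite /cayley_param /cayley_coord Scay // inv_cayleyK //.
  by rewrite mulmxKV.
have coordC P : cayley_domain P -> {for P, continuous cayley_coord}.
  move=> DP; have := @smooth_cayley_coord _ 0 cayley_domain id open_cayley_domain.
  by case=> [||/(_ P DP)] //; exact: class_C_id.
have oW0 : open (cayley_domain `&` cayley_coord @^-1` rball r).
  rewrite openE => P [WP UP]; have : nbhs P (cayley_coord @^-1` rball r).
    by apply: (coordC P WP); apply: open_nbhs_nbhs; split=> //; exact: open_norm_ball.
  move=> nP; rewrite /interior; apply: filterI => //; apply: open_nbhs_nbhs.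
  by split=> //; exact: open_cayley_domain.
exists r; first by rewrite lt_min r00.
split=> //.
- apply: (@local_param_intro _ _ _ _ _ _ cayley_coord (cayley_domain `&` cayley_coord @^-1` rball r)) => //.
  + exact: open_norm_ball.
  + by move=> k; apply: class_C_subset (sV0 k) => y; exact: rV0.
  + by move=> P [DP _]; exact: (coordC P DP).
  + move=> y yr; have [D1 D2] := coordK y (rV0 y yr); have [h1 h2] := rV y yr.
    by split=> //; [exact: SP|split=> //=; rewrite D2].
  + by move=> P SPP [D1 D2]; split=> //; exact: paramK.
  + move=> y v yr Dv; have Vy := rV0 y yr.
    have := derive_cayley_param v Vy; rewrite Dv mulmx0 => H.
    have u1 := cayleyD1_unit Vy.
    have : io v = 0.
      apply: (can_inj (mulmxK u1)); rewrite mul0mx; apply: (can_inj (mulmxK ug0)).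
      by rewrite mul0mx -mulmxA mulmxDl mul1mx.
    by move=> /(congr1 ka); rewrite ioK (lcm0 kal').
- move=> I c oI cC cS t It ct.
  have cc s : I s -> {for s, continuous c} by exact: class_C_cont (cC 0%N).
  exists (I `&` c @^-1` (cayley_domain `&` cayley_coord @^-1` rball r)), (fun s => cayley_coord (c s)).
  have oJ : open (I `&` c @^-1` (cayley_domain `&` cayley_coord @^-1` rball r)).
    rewrite openE => s [Is Ws]; rewrite /interior; apply: filterI; first exact: open_nbhs_nbhs.
    by apply: (cc s Is); exact: open_nbhs_nbhs.
  have [D1 D2] := coordK 0 V00; rewrite cayley_param0 in D1 D2.
  split=> //.
  + split=> //=; rewrite ct; split=> //=; rewrite D2 /rball /= normr0 lt_min r00.
    exact: r10.
  + split; last by rewrite ct.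
    move=> k; apply: smooth_cayley_coord => //; last by move=> s [_ []].
    by apply: class_C_subset (cC k) => s [].
  + move=> s [Is [Ds rs]]; split=> //; apply/esym; apply: paramK => //; exact: cS.
Qed.
End CayleyChart.

(** * The rotation group *)

Section MatrixSmooth.
Variables (R : realType) (V : normedModType R).

Lemma class_C_trmx k (U : set V) m n (f : V -> 'M[R]_(m, n)) : open U ->
  class_C k U f -> class_C k U (fun x => (f x)^T).
Proof.
by move=> oU; apply: class_C_lcm => //; apply: lcm_mx => a A B; rewrite linearP.
Qed.

Lemma class_C_mxtrace k (U : set V) n (f : V -> 'M[R]_n) : open U ->
  class_C k U f -> class_C k U (fun x => \tr (f x)).
Proof.
by move=> oU; apply: class_C_lcm => //; apply: lcm_mx => a A B; rewrite linearP.
Qed.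

Lemma class_C_cont_on (M : set V) (f : V -> R) : class_C 0 setT f -> cont_on M f.
Proof. by case=> fc _ q _; exact: fc. Qed.
End MatrixSmooth.

Ltac class_C_poly := repeat first
  [ exact: class_C_cst | exact: class_C_id | exact: openT
  | apply: class_CB | apply: class_CD | apply: class_CN | apply: class_CM
  | apply: class_C_mulmx | apply: class_C_trmx | apply: class_C_mxtrace | apply: class_C_coord].

Section Matrix3.
Variable R : realType.
Implicit Types (u w : 'cV[R]_3) (A B X q : 'M[R]_3) (y : 'rV[R]_3).

Definition e0 : 'I_3 := ord0.
Definition e1 : 'I_3 := lift ord0 ord0.
Definition e2 : 'I_3 := lift ord0 (lift ord0 ord0).

Lemma ord3P (P : 'I_3 -> Prop) : P e0 -> P e1 -> P e2 -> forall i, P i.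
Proof.
move=> P0 P1 P2 [[|[|[|//]]] h].
- by rewrite (_ : Ordinal h = e0) //; exact: val_inj.
- by rewrite (_ : Ordinal h = e1) //; exact: val_inj.
- by rewrite (_ : Ordinal h = e2) //; exact: val_inj.
Qed.

Lemma sum3 (V : nmodType) (F : 'I_3 -> V) : \sum_i F i = F e0 + F e1 + F e2.
Proof. by rewrite !big_ord_recl big_ord0 addr0 addrA. Qed.

(** The matrix of the cross product with [y], which identifies vectors with skew matrices. *)
Definition hat y : 'M[R]_3 := \matrix_(i, j) nth 0 (nth [::]
  [:: [:: 0; - y 0 e2; y 0 e1]; [:: y 0 e2; 0; - y 0 e0]; [:: - y 0 e1; y 0 e0; 0]] i) j.

Definition vee X : 'rV[R]_3 := \row_i nth 0 [:: X e2 e1; X e0 e2; X e1 e0] i.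

Lemma hat_linear : linear hat.
Proof.
move=> a x y; apply/matrixP; apply: ord3P; apply: ord3P; rewrite !mxE /= ?mxE /=; ring.
Qed.

Lemma vee_linear : linear vee.
Proof. move=> a x y; apply/rowP; apply: ord3P; rewrite !mxE /= ?mxE /=; ring. Qed.

Lemma hatK : cancel hat vee.
Proof. by move=> y; apply/rowP; apply: ord3P; rewrite !mxE /= ?mxE. Qed.

Lemma hat_skew y : (hat y)^T = - hat y.
Proof. by apply/matrixP; apply: ord3P; apply: ord3P; rewrite !mxE /= ?oppr0 ?opprK. Qed.

Lemma veeK X : X^T = - X -> hat (vee X) = X.
Proof.
move=> Xs; have Xij i j : X i j = - X j i by have /matrixP/(_ j i) := Xs; rewrite !mxE => ->.
have X0 i : X i i = 0.
  have := Xij i i => /eqP; rewrite -addr_eq0 -mulr2n -mulr_natr mulf_eq0 pnatr_eq0 orbF.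
  by move/eqP.
apply/matrixP; apply: ord3P; apply: ord3P; rewrite !mxE /= ?mxE /= ?X0 //; by rewrite -Xij.
Qed.

Lemma skew_tr X : X^T = - X -> \tr X = 0.
Proof.
move=> Xs; have : \tr X = - \tr X by rewrite -{1}mxtrace_tr Xs linearN.
move/eqP; rewrite -addr_eq0 -mulr2n -mulr_natr mulf_eq0 pnatr_eq0 orbF.
by move/eqP.
Qed.

Lemma hat_mul y z : hat y *m hat z = z^T *m y - (y *m z^T) 0 0 *: 1%:M.
Proof.
apply/matrixP; apply: ord3P; apply: ord3P;
  rewrite !mxE !sum3 !mxE /= ?big_ord_recl ?big_ord0 /= ?mxE /=; ring.
Qed.

Lemma det2 (A : 'M[R]_2) :
  \det A = A ord0 ord0 * A (lift ord0 ord0) (lift ord0 ord0) -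
           A ord0 (lift ord0 ord0) * A (lift ord0 ord0) ord0.
Proof.
rewrite (expand_det_row _ ord0) !big_ord_recl big_ord0 addr0 /cofactor !det_mx11 !mxE /=.
rewrite (_ : lift (lift ord0 ord0) 0 = ord0 :> 'I_2); last exact: val_inj.
rewrite (_ : lift ord0 0 = lift ord0 ord0 :> 'I_2); last exact: val_inj.
by rewrite /bump /=; ring.
Qed.

Lemma det3 A : \det A =
  A e0 e0 * (A e1 e1 * A e2 e2 - A e1 e2 * A e2 e1)
  - A e0 e1 * (A e1 e0 * A e2 e2 - A e1 e2 * A e2 e0)
  + A e0 e2 * (A e1 e0 * A e2 e1 - A e1 e1 * A e2 e0).
Proof.
rewrite (expand_det_row _ e0) sum3 /cofactor !det2 !mxE.
rewrite (_ : lift e1 ord0 = e0); last exact: val_inj.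
rewrite (_ : lift e1 (lift ord0 ord0) = e2); last exact: val_inj.
rewrite (_ : lift e2 ord0 = e0); last exact: val_inj.
rewrite (_ : lift e2 (lift ord0 ord0) = e1); last exact: val_inj.
rewrite (_ : lift e0 ord0 = e1); last exact: val_inj.
rewrite (_ : lift e0 (lift ord0 ord0) = e2); last exact: val_inj.
by rewrite /= /bump /=; ring.
Qed.

(** The cofactor matrix written out, so that its product with [A^T] is a polynomial identity. A
    rotation is equal to its cofactor matrix. *)
Definition cof3 A : 'M[R]_3 := \matrix_(i, j) nth 0 (nth [::]
  [:: [:: A e1 e1 * A e2 e2 - A e1 e2 * A e2 e1; A e1 e2 * A e2 e0 - A e1 e0 * A e2 e2;
          A e1 e0 * A e2 e1 - A e1 e1 * A e2 e0];
      [:: A e0 e2 * A e2 e1 - A e0 e1 * A e2 e2; A e0 e0 * A e2 e2 - A e0 e2 * A e2 e0;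
          A e0 e1 * A e2 e0 - A e0 e0 * A e2 e1];
      [:: A e0 e1 * A e1 e2 - A e0 e2 * A e1 e1; A e0 e2 * A e1 e0 - A e0 e0 * A e1 e2;
          A e0 e0 * A e1 e1 - A e0 e1 * A e1 e0]] i) j.

Lemma mul_cof3 A : A^T *m cof3 A = (\det A)%:M.
Proof.
rewrite det3; apply/matrixP; apply: ord3P; apply: ord3P; rewrite !mxE !sum3 !mxE /=; ring.
Qed.

Lemma SO3_cof q : SO3 q -> cof3 q = q.
Proof.
case=> qq dq; have [u _] := mulmx1_unit qq.
by apply: (can_inj (mulKmx u)); rewrite mul_cof3 dq qq.
Qed.

(* The cofactor identity [q^T (u x v) = (q^T u) x (q^T v)] for rotations. *)
Lemma hat_conj q y : SO3 q -> q^T *m hat y *m q = hat (y *m q).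
Proof.
move=> Sq; rewrite -{3}(SO3_cof Sq).
apply/matrixP; apply: ord3P; apply: ord3P;
  rewrite !mxE !sum3 !mxE !sum3 !mxE /= ?sum3 ?mxE /=; ring.
Qed.

Lemma SO3_mul g h : SO3 g -> SO3 h -> SO3 (g *m h : 'M[R]_3).
Proof.
move=> [gg dg] [hh dh]; split; last by rewrite det_mulmx dg dh mulr1.
by rewrite trmx_mul mulmxA -(mulmxA h^T) gg mulmx1 hh.
Qed.

Lemma SO3_tr (g : 'M[R]_3) : SO3 g -> SO3 g^T /\ g *m g^T = 1%:M.
Proof.
move=> [gg dg]; have gg' : g *m g^T = 1%:M by apply: mulmx1C.
by split=> //; split; [rewrite trmxK|rewrite det_tr].
Qed.

Lemma SO3_1 : SO3 (1%:M : 'M[R]_3).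
Proof. by split; [rewrite trmx1 mulmx1|rewrite det1]. Qed.

Lemma SO3_unit (g : 'M[R]_3) : SO3 g -> g \in unitmx.
Proof. by move=> [_ dg]; rewrite unitmxE dg unitr1. Qed.

Lemma SO3_inv (g : 'M[R]_3) : SO3 g -> invmx g = g^T.
Proof.
move=> Sg; have [_ gg] := SO3_tr Sg; have u := SO3_unit Sg.
by apply: (can_inj (mulKmx u)); rewrite mulmxV.
Qed.

(** The determinant is 1 because [1 + X] is the transpose of [1 - X]. *)
Lemma cayley_SO3 X : X^T = - X -> 1%:M - X \in unitmx -> SO3 (cayley X).
Proof.
move=> Xs u; split.
  have := @cayley_form R 3 1%:M X u; rewrite !mulmx1 !mul1mx => -> //.
  by rewrite Xs addNr.
rewrite /cayley det_mulmx det_inv.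
have -> : 1%:M + X = (1%:M - X)^T by rewrite linearB /= trmx1 Xs opprK.
by rewrite det_tr mulVr // -unitmxE.
Qed.

Lemma SO3_inv_cayley (N : 'M[R]_3) : SO3 N -> N + 1%:M \in unitmx ->
  hat (vee (inv_cayley N)) = inv_cayley N.
Proof.
move=> [NN _] u; apply: veeK; apply/eqP; rewrite -addr_eq0; apply/eqP.
have := @inv_cayley_form R 3 1%:M N u; rewrite !mulmx1 mul1mx => -> //.
Qed.

(** Closed as the solution set of polynomial equations, bounded because the columns are unit
    vectors; compactness is transported from row vectors of length 9 by [vec_mx]. *)
Lemma SO3_compact : compact (@SO3 R).
Proof.
have closedS : closed (@SO3 R).
  rewrite (_ : @SO3 R = (fun g => g^T *m g) @^-1` [set 1%:M] `&` (fun g => \det g) @^-1` [set 1]) //.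
  have c0 : class_C 0 setT (fun g : 'M[R]_3 => g^T *m g) by class_C_poly.
  have c1 : class_C 0 setT (fun g : 'M[R]_3 => \det g) by apply: class_C_det openT (class_C_id _ _).
  apply: closedI; apply: preimage_closed.
  - by move=> g _; case: c0 => /(_ g I).
  - exact: accessible_closed_set1 (hausdorff_accessible (@norm_hausdorff _ _)) _.
  - by move=> g _; case: c1 => /(_ g I).
  - exact: accessible_closed_set1 (hausdorff_accessible (@norm_hausdorff _ _)) _.
pose A : set 'rV[R]_(3 * 3) := vec_mx @^-1` (@SO3 R).
have vc : continuous (vec_mx : 'rV[R]_(3 * 3) -> 'M[R]_3).
  by apply: (lcm_mx _).2 => a x y; rewrite linearP.
have -> : @SO3 R = vec_mx @` A.
  apply/seteqP; split=> g; last by move=> [v Av <-].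
  by move=> Sg; exists (mxvec g); rewrite /A /= mxvecK.
apply: continuous_compact; first exact: continuous_subspaceT.
apply: bounded_closed_compact; last by apply: preimage_closed => // v _; exact: vc.
exists 1; split; first exact: num_real.
move=> x x1 v [gg _] /=; apply: le_trans (ltW x1).
apply: ler_mx_norm => // i j; rewrite ord1 {i}.
case: (mxvec_indexP j) => i k; rewrite -[v]vec_mxK mxvecE.
move: (vec_mx v) gg => {A vc closedS j}g gg.
have : \sum_l g l k ^+ 2 = 1.
  have /matrixP/(_ k k) := gg; rewrite !mxE eqxx; apply: etrans.
  by apply: eq_bigr => l _; rewrite mxE expr2.
rewrite (bigD1 i) //= => h.
have h2 : g i k ^+ 2 <= 1 by rewrite -h lerDl sumr_ge0 // => l _; rewrite sqr_ge0.
by rewrite -[leLHS]ger0_norm // -sqrtr_sqr -[leRHS]sqrtr1 ler_sqrt // real_normK ?num_real.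
Qed.
End Matrix3.

Lemma rip_sum (R : realType) (x y : 'M[R]_3) :
  rip x y = \sum_(a : 'I_3 * 'I_3) x a.1 a.2 * y a.1 a.2.
Proof.
rewrite -(pair_bigA _ (fun i j => x i j * y i j)) exchange_big /=.
by apply: eq_bigr => j _; rewrite mxE; apply: eq_bigr => i _; rewrite mxE.
Qed.

(** * Invariant integration on SO_3 and moments of the matrix entries *)

Section SO3Moments.
Variables (R : realType) (mu : {measure set (borel 'M[R]_3) -> \bar R}).
Hypothesis vol : volume_measure (@SO3 R) (@rip R) mu.
Local Notation M := (@SO3 R).
Local Notation Int := (Int M mu).

Lemma rip_isometry g : SO3 g -> isometry_of M (@rip R) (mulmx g) (mulmx g^T).
Proof.
move=> Sg; have [Sgt gg'] := SO3_tr Sg; have [gg _] := Sg; split.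
- by apply: lcm_mx => a x y; rewrite linearP.
- by apply: lcm_mx => a x y; rewrite linearP.
- by split=> q; rewrite mulmxA ?gg ?gg' mul1mx.
- by move=> x y; rewrite /rip trmx_mul mulmxA -(mulmxA x^T) gg mulmx1.
- move=> q; split=> [|Sgq]; first exact: SO3_mul.
  by rewrite -[q]mul1mx -gg -mulmxA; exact: SO3_mul.
Qed.

Lemma SO3_chart (g0 : 'M[R]_3) : SO3 g0 -> exists2 r : R, 0 < r & [/\
  local_param M (rball r) (cayley_param (@hat R) g0),
  forall v, 'D_v (cayley_param (@hat R) g0) 0 = 2 *: (hat v *m g0) &
  forall (I : set R) (c : R -> 'M[R]_3), open I -> smooth_on I c -> (forall s, I s -> M (c s)) ->
    forall t, I t -> c t = g0 -> exists J (x : R -> 'rV[R]_3),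
      [/\ open J, J t, J `<=` I, smooth_on J x /\ x t = 0 &
          forall s, J s -> rball r (x s) /\ c s = cayley_param (@hat R) g0 (x s)]].
Proof.
move=> Sg; apply: (@cayley_chart _ _ _ (@hat R) (@vee R)).
- exact: hat_linear.
- exact: vee_linear.
- exact: hatK.
- exact: SO3_unit.
- exists 1 => // y _ /(_ 1); rewrite scale1r ler01 lexx => /(_ isT) u.
  by apply: SO3_mul => //; apply: cayley_SO3 => //; exact: hat_skew.
- move=> P SP u; apply: SO3_inv_cayley => //; apply: SO3_mul => //.
  by rewrite SO3_inv //; case: (SO3_tr Sg).
Qed.

(** The differential at the identity is [v |-> 2 hat v], and the matrices [hat] of the basis are
    orthogonal of squared norm 2, whence 8 = 4 x 2. *)
Lemma rip_gram0 : gram (fun=> @rip R) (cayley_param (@hat R) 1%:M) 0 = 8%:M.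
Proof.
have [r r0 [_ D _]] := SO3_chart (SO3_1 R).
apply/matrixP => i j; rewrite !mxE /partial !D !mulmx1 /rip.
rewrite (_ : (2 *: _)^T = 2 *: (hat (delta_mx 0 i))^T); last by rewrite linearZ.
rewrite -(scalemxAl 2) -(scalemxAr 2) !mxtraceZ.
move: i j; apply: ord3P; apply: ord3P;
  rewrite /mxtrace sum3 !mxE !sum3 !mxE /=; ring.
Qed.

Lemma SO3_volume_facts : [/\ (mu M < +oo)%E, 0 < Int (fun=> 1) &
  forall g f, SO3 g -> cont_on M f -> Int (fun q => f (g *m q)) = Int f].
Proof.
have [r r0 [lp D _]] := SO3_chart (SO3_1 R).
have U00 : rball r (0 : 'rV[R]_3) by rewrite /rball /= normr0.
have g0 : 0 < \det (gram (fun=> @rip R) (cayley_param (@hat R) 1%:M) 0).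
  by rewrite rip_gram0 det_scalar exprn_gt0.
have tr p : M p -> exists T T', isometry_of M (@rip R) T T' /\ T (cayley_param (@hat R) 1%:M 0) = p.
  move=> Mp; exists (mulmx p), (mulmx p^T); split; first exact: rip_isometry.
  by rewrite cayley_param0 ?mulmx1 //; exact: hat_linear.
have [fin pos inv] := homogeneous_volume vol (@SO3_compact R)
  (fun a : 'I_3 * 'I_3 => lcm_coord R a.1 a.2) (@rip_sum R) lp U00 g0 tr.
by split=> // g f /rip_isometry iT; exact: inv iT.
Qed.

Definition halfturn (i : 'I_3) : 'M[R]_3 := diag_mx (\row_j if j == i then 1 else -1).

Lemma SO3_halfturn i : SO3 (halfturn i).
Proof.
split.
  rewrite /halfturn tr_diag_mx mulmx_diag; apply/matrixP => k l; rewrite !mxE.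
  by case: ifP => _; rewrite ?mulr1 ?mulrNN ?mulr1.
by rewrite det_diag; move: i; apply: ord3P; rewrite !big_ord_recl big_ord0 !mxE /=; ring.
Qed.

(** The rotation that permutes the three axes cyclically. *)
Definition cyc3 : 'M[R]_3 := \matrix_(i, j) nth 0 (nth [::]
  [:: [:: 0; 1; 0]; [:: 0; 0; 1]; [:: 1; 0; 0]] i) j.

Lemma SO3_cyc3 : SO3 cyc3.
Proof.
split; last by rewrite det3 !mxE /=; ring.
by apply/matrixP; apply: ord3P; apply: ord3P; rewrite !mxE !sum3 !mxE /=; ring.
Qed.

Lemma cont_entry i j : cont_on M (fun q : 'M[R]_3 => q i j).
Proof. by apply: class_C_cont_on; class_C_poly. Qed.

Let cM := @SO3_compact R.
Let muM := let: And3 a _ _ := SO3_volume_facts in a.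
Let Int_mul := let: And3 _ _ a := SO3_volume_facts in a.

Lemma halfturnE i (q : 'M[R]_3) k j :
  (halfturn i *m q) k j = (if k == i then 1 else -1) * q k j.
Proof. by rewrite /halfturn mul_diag_mx !mxE. Qed.

(** The half turn about an axis other than [i] changes the sign of row [i]. *)
Lemma Int_entry i j : Int (fun q => q i j) = 0.
Proof.
pose k := lift i ord0 : 'I_3.
have ik : (i == k) = false by apply/negbTE; exact: neq_lift.
have := Int_mul (SO3_halfturn k) (@cont_entry i j).
under [in LHS]eq_fun do rewrite halfturnE ik.
rewrite (IntZ cM muM); last exact: cont_entry.
move: (Int _) => z; lra.
Qed.

(** For different rows, the half turn about axis [i] changes the sign of the product. For equal
    rows, cyclic permutations make the integral independent of the row, and the three rows add up to
    the entry (j, l) of q^T q = 1; hence the factor 1/3. *)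
Lemma Int_entry2 i j k l :
  Int (fun q => q i j * q k l) = (i == k)%:R * (j == l)%:R * (Int (fun=> 1) / 3).
Proof.
have c2 i' j' k' l' : cont_on M (fun q : 'M[R]_3 => q i' j' * q k' l').
  by apply: cont_onM; exact: cont_entry.
have [->{i}|ik] := eqVneq i k; last first.
  rewrite !mul0r; have := Int_mul (SO3_halfturn i) (c2 i j k l).
  under [in LHS]eq_fun do rewrite !halfturnE eqxx eq_sym (negbTE ik).
  have -> : (fun q : 'M[R]_3 => 1 * q i j * (-1 * q k l)) = (fun q => -1 * (q i j * q k l)).
    by apply/funext => q; ring.
  rewrite (IntZ cM muM); last exact: c2.
  move: (Int _) => z; lra.
rewrite mul1r; pose m i' := Int (fun q => q i' j * q i' l).
have mC i' : m i' = Int (fun q => (cyc3 *m q) i' j * (cyc3 *m q) i' l).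
  by rewrite /m -(Int_mul SO3_cyc3 (c2 i' j i' l)).
have s : \sum_i' m i' = (j == l)%:R * Int (fun=> 1).
  rewrite /m -(Int_sum cM muM) //.
  rewrite -(Int_cst cM muM); apply: eq_Int => q [qq _].
  have /matrixP/(_ j l) := qq; rewrite !mxE => <-.
  by apply: eq_bigr => i' _; rewrite mxE.
have m01 : m e0 = m e1.
  rewrite mC; apply: eq_Int => q _; rewrite !mxE !sum3 !mxE /=; ring.
have m12 : m e1 = m e2.
  rewrite mC; apply: eq_Int => q _; rewrite !mxE !sum3 !mxE /=; ring.
move: s; rewrite sum3 m01 m12 => s.
have mk : m k = m e2 by move: k; apply: ord3P; rewrite ?m01 ?m12.
rewrite -/(m k) mk; move: s; move: (m e2) (Int _) => x y.
by move: (_%:R) => z s; lra.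
Qed.

(** First moments vanish and second moments are 1/3 of the identity, so a quadratic polynomial
    integrates to its constant term plus one third of the trace of its quadratic part over the
    matrix units. *)
Lemma Int_poly2 k (L : 'M[R]_3 -> R) (Q : 'M[R]_3 -> 'M[R]_3 -> R) :
  (forall a x y, L (a *: x + y) = a * L x + L y) ->
  (forall z a x y, Q (a *: x + y) z = a * Q x z + Q y z) ->
  (forall z a x y, Q z (a *: x + y) = a * Q z x + Q z y) ->
  Int (fun q => k + L q + Q q q) =
  Int (fun=> 1) * (k + 3^-1 * \sum_i \sum_j Q (delta_mx i j) (delta_mx i j)).
Proof.
move=> lL lQ1 lQ2.
have expand (f : 'M[R]_3 -> R) : (forall a x y, f (a *: x + y) = a * f x + f y) ->
    forall q, f q = \sum_i \sum_j q i j * f (delta_mx i j).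
  move=> lf q; have lf' : linear (f : 'M[R]_3 -> R^o) by [].
  rewrite {1}[q]matrix_sum_delta (big_morph f (linD lf') (lin0 lf')); apply: eq_bigr => i _.
  by rewrite (big_morph f (linD lf') (lin0 lf')); apply: eq_bigr => j _; rewrite (linZ lf').
pose l i j := L (delta_mx i j); pose c i j k l := Q (delta_mx i j) (delta_mx k l).
have Eq q : k + L q + Q q q = k + \sum_i \sum_j l i j * q i j +
    \sum_i \sum_j \sum_i' \sum_j' c i j i' j' * (q i j * q i' j').
  rewrite (expand _ lL) (expand _ (lQ1 q)); congr (_ + _ + _).
    by apply: eq_bigr => i _; apply: eq_bigr => j _; rewrite mulrC.
  apply: eq_bigr => i _; apply: eq_bigr => j _; rewrite (expand _ (lQ2 (delta_mx i j))).
  rewrite mulr_sumr; apply: eq_bigr => i' _; rewrite mulr_sumr; apply: eq_bigr => j' _.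
  by rewrite /c; ring.
under eq_Int do rewrite Eq.
have c1 i j : cont_on M (fun q : 'M[R]_3 => l i j * q i j).
  by apply: cont_onM; [exact: cont_on_cst|exact: cont_entry].
have c2 i j i' j' : cont_on M (fun q : 'M[R]_3 => c i j i' j' * (q i j * q i' j')).
  by apply: cont_onM; [exact: cont_on_cst|apply: cont_onM; exact: cont_entry].
rewrite (IntD cM muM); last first.
- by do 4! (apply: cont_on_sum => ? _); exact: c2.
- apply: cont_onD; first exact: cont_on_cst.
  by do 2! (apply: cont_on_sum => ? _); exact: c1.
rewrite (IntD cM muM); last first.
- by do 2! (apply: cont_on_sum => ? _); exact: c1.
- exact: cont_on_cst.
rewrite (Int_cst cM muM k) (Int_sum cM muM); last first.
  by move=> i _; apply: cont_on_sum => ? _; exact: c1.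
rewrite big1 => [|i _]; last first.
  rewrite (Int_sum cM muM) => [|j _]; last exact: c1.
  by rewrite big1 // => j _; rewrite (IntZ cM muM) ?Int_entry ?mulr0 //; exact: cont_entry.
rewrite (Int_sum cM muM); last by move=> i _; do 3! (apply: cont_on_sum => ? _); exact: c2.
rewrite addr0 [RHS]mulrDr [k * _]mulrC; congr (_ + _); rewrite mulrA mulr_sumr.
apply: eq_bigr => i _; rewrite (Int_sum cM muM); last first.
  by move=> j _; do 2! (apply: cont_on_sum => ? _); exact: c2.
rewrite mulr_sumr; apply: eq_bigr => j _; rewrite (Int_sum cM muM); last first.
  by move=> j' _; (apply: cont_on_sum => ? _); exact: c2.
have I4 i' j' : Int (fun q => c i j i' j' * (q i j * q i' j')) =
    (i == i')%:R * ((j == j')%:R * (c i j i' j' * (Int (fun=> 1) / 3))).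
  rewrite (IntZ cM muM) ?Int_entry2; last by apply: cont_onM; exact: cont_entry.
  by move: (Int _) (_%:R) (_%:R) (c _ _ _ _) => *; ring.
rewrite (bigD1 i) //= big1 ?addr0 => [|i' i'i]; last first.
  rewrite (Int_sum cM muM) => [|j' _]; last exact: c2.
  by rewrite big1 // => j' _; rewrite I4 eq_sym (negbTE i'i) mul0r.
rewrite (Int_sum cM muM) => [|j' _]; last exact: c2.
rewrite (bigD1 j) //= big1 ?addr0 => [|j' j'j]; last first.
  by rewrite I4 [j == _]eq_sym (negbTE j'j) mul0r mulr0.
by rewrite I4 !eqxx !mul1r /c mulrC.
Qed.
End SO3Moments.

(** * The group O_o(3,3) *)

Section Invmx.
Variable R : realType.

Lemma unitmx_ker n (A : 'M[R]_n) : (forall x : 'cV[R]_n, A *m x = 0 -> x = 0) -> A \in unitmx.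
Proof.
move=> A0; rewrite -unitmx_tr -row_free_unit -kermx_eq0; apply/eqP/row_matrixP => i.
rewrite row0 -[LHS]trmxK (A0 (row i (kermx A^T))^T) ?trmx0 //.
by apply: trmx_inj; rewrite trmx_mul trmxK trmx0 -row_mul mulmx_ker row0.
Qed.

Lemma trmx_mul_eq0 m n (A : 'M[R]_(m, n)) : \tr (A^T *m A) = 0 -> A = 0.
Proof.
have E : \tr (A^T *m A) = \sum_j \sum_i A i j ^+ 2.
  by apply: eq_bigr => j _; rewrite mxE; apply: eq_bigr => i _; rewrite mxE expr2.
have p j : 0 <= \sum_i A i j ^+ 2 by apply: sumr_ge0 => i _; exact: sqr_ge0.
rewrite E => /eqP; rewrite psumr_eq0 => [/allP h|//].
apply/matrixP => i j; rewrite mxE; apply/eqP; rewrite -sqrf_eq0.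
have := h j; rewrite mem_index_enum => /(_ isT) /=.
by rewrite psumr_eq0 => [/allP/(_ i)|k _]; rewrite ?mem_index_enum ?sqr_ge0 //; apply.
Qed.

Lemma class_C_block_mx (V : normedModType R) k (U : set V) m1 m2 n1 n2
    (a : V -> 'M[R]_(m1, n1)) (b : V -> 'M[R]_(m1, n2))
    (c : V -> 'M[R]_(m2, n1)) (d : V -> 'M[R]_(m2, n2)) : open U ->
  class_C k U a -> class_C k U b -> class_C k U c -> class_C k U d ->
  class_C k U (fun x => block_mx (a x) (b x) (c x) (d x)).
Proof.
move=> oU aC bC cC dC; apply: (class_C_mx oU) => i j; rewrite -[i]splitK -[j]splitK.
case: (fintype.split i) => i'; case: (fintype.split j) => j' /=.
- rewrite [X in class_C _ _ X](_ : _ = fun x => a x i' j'); first exact: class_C_coord.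
  by apply/funext => x; rewrite block_mxEul.
- rewrite [X in class_C _ _ X](_ : _ = fun x => b x i' j'); first exact: class_C_coord.
  by apply/funext => x; rewrite block_mxEur.
- rewrite [X in class_C _ _ X](_ : _ = fun x => c x i' j'); first exact: class_C_coord.
  by apply/funext => x; rewrite block_mxEdl.
- rewrite [X in class_C _ _ X](_ : _ = fun x => d x i' j'); first exact: class_C_coord.
  by apply/funext => x; rewrite block_mxEdr.
Qed.

(** For s near t, P(s)^-1 - P(t)^-1 = - P(s)^-1 (P(s) - P(t)) P(t)^-1; divide and use the continuity
    of inversion. *)
Lemma is_derive_invmx n (P : R -> 'M[R]_n) (t : R) dP : is_derive t (1 : R) P dP -> P t \in unitmx ->
  is_derive t (1 : R) (fun s => invmx (P s)) (- (invmx (P t) *m dP *m invmx (P t))).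
Proof.
move=> [dPt PE] u.
have cP := derivable_cvg dPt.
have cV : invmx (P (h *: (1 : R) + t)) @[h --> 0^'] --> invmx (P t).
  have : class_C 0 [set A : 'M[R]_n | A \in unitmx] (fun P => invmx P).
    by apply: class_C_invmx => //; [exact: open_unitmx|exact: class_C_id].
  by move=> /class_C_cont/(_ u) /= cI; apply: (cvg_comp _ _ cP cI).
have nu : \forall h \near 0^', P (h *: (1 : R) + t) \in unitmx.
  by have := cP _ (open_nbhs_nbhs (conj (@open_unitmx R n) u)); rewrite /= !nbhs_simpl.
have BB := bilinear_continuous_mulmx R n n n.
have lim : h^-1 *: (invmx (P (h *: (1 : R) + t)) - invmx (P t)) @[h --> 0^'] -->
    - (invmx (P t) *m dP *m invmx (P t)).
  have dP' : h^-1 *: (P (h *: (1 : R) + t) - P t) @[h --> 0^'] --> dP.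
    by rewrite -PE; exact: dPt.
  have H : - (invmx (P (h *: (1 : R) + t)) *m (h^-1 *: (P (h *: (1 : R) + t) - P t)) *m invmx (P t))
      @[h --> 0^'] --> - (invmx (P t) *m dP *m invmx (P t)).
    by apply: cvgN; apply: (bcm_cvg BB); [exact: (bcm_cvg BB)|exact: cvg_cst].
  apply: cvg_trans H; apply: near_eq_cvg; near=> h.
  have uh : P (h *: (1 : R) + t) \in unitmx by near: h.
  rewrite -(scalemxAr h^-1) -(scalemxAl h^-1) -scalerN mulmxBr mulVmx // mulmxBl mul1mx.
  by rewrite -mulmxA mulmxV // mulmx1 opprB.
split; last exact: cvg_lim lim.
by apply/cvg_ex; eexists; exact: lim.
Unshelve. all: by end_near. Qed.

Lemma derive1n2_lcm (V W : normedModType R) (L : V -> W) (J : set R) (f : R -> V) t :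
  linear_continuous_map L -> open J -> class_C 2 J f -> J t ->
  derive1n 2 (fun s => L (f s)) t = L (derive1n 2 f t).
Proof.
move=> LL oJ fC Jt; rewrite /derive1n /= !derive1E.
have E s : J s -> derive1 (fun s => L (f s)) s = L (derive1 f s).
  move=> Js; rewrite !derive1E.
  by case: (is_derive_lcm LL (derivableP (class_C_derivable (v := (1 : R)) fC Js))).
rewrite (near_eq_derive (g := fun s => L (derive1 f s))); last first.
  by apply: filterS (open_nbhs_nbhs (conj oJ Jt)) => z; exact: E.
have f1 := class_C_derive (1 : R) fC.
have -> : derive1 f = 'D_1 f by apply/funext => s; rewrite derive1E.
by case: (is_derive_lcm LL (derivableP (class_C_derivable (v := (1 : R)) f1 Jt))).
Qed.

Lemma derive1n2_bcm (V1 V2 W : normedModType R) (B : V1 -> V2 -> W) (J : set R)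
    (f : R -> V1) (g : R -> V2) t :
  bilinear_continuous_map B -> open J -> class_C 2 J f -> class_C 2 J g -> J t ->
  derive1n 2 (fun s => B (f s) (g s)) t =
  B (derive1n 2 f t) (g t) + 2 *: B (derive1 f t) (derive1 g t) + B (f t) (derive1n 2 g t).
Proof.
move=> BB oJ fC gC Jt; rewrite /derive1n /=.
have dE (V : normedModType R) (k : R -> V) : derive1 k = 'D_1 k.
  by apply/funext => s; rewrite derive1E.
rewrite !dE.
have E s : J s -> 'D_1 (fun s => B (f s) (g s)) s = B ('D_1 f s) (g s) + B (f s) ('D_1 g s).
  move=> Js; by case: (is_derive_bcm BB (derivableP (class_C_derivable (v := (1 : R)) fC Js))
     (derivableP (class_C_derivable (v := (1 : R)) gC Js))).
rewrite (near_eq_derive (g := fun s => B ('D_1 f s) (g s) + B (f s) ('D_1 g s))); last first.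
  by apply: filterS (open_nbhs_nbhs (conj oJ Jt)) => z; exact: E.
have f1 := class_C_derive (1 : R) fC; have g1 := class_C_derive (1 : R) gC.
have df := derivableP (class_C_derivable (v := (1 : R)) fC Jt).
have dg := derivableP (class_C_derivable (v := (1 : R)) gC Jt).
have df1 := derivableP (class_C_derivable (v := (1 : R)) f1 Jt).
have dg1 := derivableP (class_C_derivable (v := (1 : R)) g1 Jt).
case: (is_deriveD (is_derive_bcm BB df1 dg) (is_derive_bcm BB df dg1)) => _ ->.
move: (B _ _) (B _ _) (B _ _) => x y z; rewrite scaler_nat mulr2n !addrA.
by [].
Qed.
End Invmx.

Section RealForm.
Variable R : realType.
Local Notation M := (@SO3 R).
Implicit Types (P Q g c : 'M[R]_(3 + 3)) (q : 'M[R]_3).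

Definition Jr : 'M[R]_(3 + 3) := block_mx 1%:M 0 0 (- 1%:M).

Lemma rformE u v : rform u v = u^T *m Jr *m v.
Proof.
rewrite -{2}[u]vsubmxK -{2}[v]vsubmxK tr_col_mx mul_row_block mul_row_col /rform.
by rewrite !mulmx0 addr0 add0r mulmx1 mulmxN mulmx1 mulNmx.
Qed.

Lemma O33P P : O33 P <-> P^T *m Jr *m P = Jr.
Proof.
split=> [h|h u v]; last first.
  by rewrite !rformE trmx_mul -{2}h !mulmxA.
have E i j (S : 'M[R]_(3 + 3)) : ((delta_mx i 0 : 'cV_(3 + 3))^T *m S *m (delta_mx j 0 : 'cV_(3 + 3))) 0 0 = S i j.
  by rewrite trmx_delta -rowE -colE !mxE.
apply/matrixP => i j; rewrite -[LHS]E -[RHS]E -[in RHS]rformE -h rformE trmx_mul.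
by rewrite !mulmxA.
Qed.

Lemma JrJr : Jr *m Jr = 1%:M.
Proof.
rewrite mulmx_block !mulmx0 !mul0mx !addr0 !add0r mulmx1 mulNmx mulmxN mulmx1 opprK.
by rewrite -scalar_mx_block.
Qed.

Lemma O33_mul P Q : O33 P -> O33 Q -> O33 (P *m Q).
Proof. by move=> h k u v; rewrite -!mulmxA h k. Qed.

Lemma O33_unit P : O33 P -> P \in unitmx.
Proof.
move/O33P => h; have : (Jr *m P^T *m Jr) *m P = 1%:M by rewrite -!mulmxA (mulmxA P^T) h JrJr.
by case/mulmx1_unit.
Qed.

Lemma O33_1 : O33 (1%:M : 'M[R]_(3 + 3)).
Proof. by move=> u v; rewrite !mul1mx. Qed.

Lemma rdiag_mul (g h g' h' : 'M[R]_3) : rdiag g h *m rdiag g' h' = rdiag (g *m g') (h *m h').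
Proof. by rewrite /rdiag mulmx_block !mulmx0 !mul0mx !addr0 !add0r. Qed.

Lemma rdiag_tr (g h : 'M[R]_3) : (rdiag g h)^T = rdiag g^T h^T.
Proof. by rewrite /rdiag tr_block_mx !trmx0. Qed.

Lemma rdiag_Jr (g h : 'M[R]_3) : rdiag g h *m Jr = Jr *m rdiag g h.
Proof.
rewrite /rdiag /Jr !mulmx_block !mulmx0 !mul0mx !addr0 !add0r !mulmx1 !mul1mx.
by rewrite mulmxN mulNmx mulmx1 mul1mx.
Qed.

Lemma rdiag1 : rdiag 1%:M 1%:M = 1%:M :> 'M[R]_(3 + 3).
Proof. by rewrite /rdiag -scalar_mx_block. Qed.

Lemma rdiag_tr_mul (g h : 'M[R]_3) : SO3 g -> SO3 h -> (rdiag g h)^T *m rdiag g h = 1%:M.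
Proof. by move=> [gg _] [hh _]; rewrite rdiag_tr rdiag_mul gg hh rdiag1. Qed.

Lemma O33_rdiag (g h : 'M[R]_3) : SO3 g -> SO3 h -> O33 (rdiag g h).
Proof.
by move=> Sg Sh; apply/O33P; rewrite -mulmxA -rdiag_Jr mulmxA rdiag_tr_mul // mul1mx.
Qed.

Lemma Oo33_O33 P : Oo33 P -> O33 P.
Proof. exact: connected_component_sub. Qed.

Lemma Oo33_1 : Oo33 (1%:M : 'M[R]_(3 + 3)).
Proof. by apply: connected_component_refl; exact: O33_1. Qed.

(** The image of the unit interval is connected, so it stays in the component of its origin. *)
Lemma Oo33_path (f : R -> 'M[R]_(3 + 3)) : (forall s : R, 0 <= s <= 1 -> {for s, continuous f}) ->
  (forall s : R, 0 <= s <= 1 -> O33 (f s)) -> Oo33 (f 0) -> Oo33 (f 1).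
Proof.
move=> fc fO f0.
have seg (s : R) : `[0, 1]%classic s -> 0 <= s <= 1 by rewrite /= in_itv.
have i0 : `[(0 : R), 1]%classic 0 by rewrite /= in_itv /= lexx ler01.
have i1 : `[(0 : R), 1]%classic 1 by rewrite /= in_itv /= lexx ler01.
have cI : connected (f @` `[(0 : R), 1]%classic).
  apply: connected_continuous_connected; first exact: segment_connected.
  by apply: continuous_in_subspaceT => s /set_mem /seg; exact: fc.
apply: (connected_component_trans f0).
apply: (@connected_component_max _ _ _ (f 0)) cI _ _.
- by exists 0.
- by move=> _ [s /seg s01 <-]; exact: fO.
- by exists 1.
Qed.

(** From x = s X x follows |x|^2 = s x^T X x = 0, since the quadratic form of a skew matrix is zero.
    Thus the Cayley transform is defined on all skew matrices. *)
Lemma skew_unit (s : R) (X : 'M[R]_3) : X^T = - X -> 1%:M - s *: X \in unitmx.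
Proof.
move=> Xs; apply: unitmx_ker => x; rewrite mulmxBl mul1mx => /eqP; rewrite subr_eq0 => /eqP xE.
apply: trmx_mul_eq0.
have z : \tr (x^T *m X *m x) = 0.
  have : \tr (x^T *m X *m x) = - \tr (x^T *m X *m x).
    rewrite -{1}mxtrace_tr !trmx_mul trmxK Xs mulmxA.
    by rewrite mulmxN mulNmx linearN.
  by move/eqP; rewrite -addr_eq0 -mulr2n -mulr_natr mulf_eq0 pnatr_eq0 orbF => /eqP.
by rewrite {2}xE -(scalemxAl s) -(scalemxAr s) mxtraceZ mulmxA z mulr0.
Qed.

Lemma Oo33_mul_cayley P (X Y : 'M[R]_3) : X^T = - X -> Y^T = - Y -> Oo33 P ->
  Oo33 (P *m rdiag (cayley X) (cayley Y)).
Proof.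
move=> Xs Ys PO.
have sk (s : R) (Z : 'M[R]_3) : Z^T = - Z -> (s *: Z)^T = - (s *: Z).
  by move=> Zs; rewrite linearZ /= Zs scalerN.
pose f (s : R) := P *m rdiag (cayley (s *: X)) (cayley (s *: Y)).
have -> : P *m rdiag (cayley X) (cayley Y) = f 1 by rewrite /f !scale1r.
have cayC (Z : 'M[R]_3) : Z^T = - Z -> class_C 0 setT (fun s : R => cayley (s *: Z)).
  move=> Zs; have l0 : class_C 0 setT (fun s : R => s *: Z).
    by apply: class_C_lin; exact: lcm_scalel.
  apply: class_C_mulmx openT _ _; last by apply: class_CD openT (class_C_cst _ _ _) l0.
  apply: class_C_invmx openT _ _ => [s _|]; first exact: skew_unit.
  by apply: class_CB openT (class_C_cst _ _ _) l0.
apply: Oo33_path.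
- move=> s _; have : class_C 0 setT f.
    apply: class_C_mulmx openT (class_C_cst _ _ _) _.
    by apply: class_C_block_mx openT (cayC _ Xs) (class_C_cst _ _ _) (class_C_cst _ _ _) (cayC _ Ys).
  by case=> /(_ s I).
- move=> s _; apply: O33_mul; first exact: Oo33_O33.
  apply: O33_rdiag; apply: cayley_SO3; by [exact: sk|exact: skew_unit].
- by rewrite /f !scale0r cayley0 rdiag1 mulmx1.
Qed.

(** In general det (g + 1) is 1 + tr g + (sum of the principal 2 x 2 minors) + det g; by [SO3_cof]
    these minors are the diagonal entries of a rotation. *)
Lemma det_1D (g : 'M[R]_3) : SO3 g -> \det (g + 1%:M) = 2 * (1 + \tr g).
Proof.
move=> Sg; have [_ dg] := Sg; have /matrixP gE := SO3_cof Sg.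
have := (gE e0 e0, gE e1 e1, gE e2 e2); rewrite !mxE /= => -[[h0 h1] h2].
move: dg; rewrite !det3 /mxtrace sum3 !mxE /= => dg.
move: h0 h1 h2 dg; rewrite !addr0; move: (g e0 e0) (g e0 e1) (g e0 e2) (g e1 e0) (g e1 e1)
  (g e1 e2) (g e2 e0) (g e2 e1) (g e2 e2) => a b c d e f x y z h0 h1 h2 dg.
have -> : (a + 1) * ((e + 1) * (z + 1) - f * y) - b * (d * (z + 1) - f * x) + c * (d * y - (e + 1) * x)
  = (a * (e * z - f * y) - b * (d * z - f * x) + c * (d * y - e * x))
  + (e * z - f * y) + (z * a - x * c) + (a * e - b * d) + a + e + z + 1 by ring.
rewrite dg h0; move: h1 h2; lra.
Qed.

(** The rotation by a right angle about axis [i]. A half turn has eigenvalue -1 and so is not a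
    Cayley transform; its square root, the quarter turn, is one. *)
Definition quarterturn (i : 'I_3) : 'M[R]_3 := delta_mx i i + hat (delta_mx 0 i).

Lemma quarterturnP i : [/\ SO3 (quarterturn i), quarterturn i + 1%:M \in unitmx &
  quarterturn i *m quarterturn i = halfturn R i].
Proof.
have SK : SO3 (quarterturn i).
  split.
    move: i; apply: ord3P; apply/matrixP; apply: ord3P; apply: ord3P;
      rewrite !mxE !sum3 !mxE /=; ring.
  by move: i; apply: ord3P; rewrite det3 !mxE /=; ring.
split=> //.
  rewrite unitmxE unitfE det_1D // /mxtrace sum3.
  by apply: lt0r_neq0; move: i {SK}; apply: ord3P; rewrite !mxE /=; lra.
move: i {SK}; apply: ord3P; apply/matrixP; apply: ord3P; apply: ord3P;
  rewrite !mxE !sum3 !mxE /=; ring.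
Qed.

(* If [-1] is an eigenvalue of the rotation [g], it is not one of [D g] for some half turn
   [D] about a coordinate axis, because [g] and the three [D g] have traces adding up to 0. *)
Lemma SO3_cayley_factor (g : 'M[R]_3) : SO3 g -> exists k N : 'M[R]_3,
  [/\ SO3 k, SO3 N, k + 1%:M \in unitmx, N + 1%:M \in unitmx & g = k *m k *m N].
Proof.
move=> Sg; have u (N : 'M[R]_3) : SO3 N -> 1 + \tr N != 0 -> N + 1%:M \in unitmx.
  by move=> SN n0; rewrite unitmxE unitfE det_1D // mulf_neq0.
have [g0|] := eqVneq (1 + \tr g) 0; last first.
  move=> n0; exists 1%:M, g; rewrite !mul1mx; split=> //; [exact: SO3_1| |exact: u].
  by apply: u; [exact: SO3_1|apply: lt0r_neq0; rewrite mxtrace1; lra].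
suff [i hi] : exists i, 1 + \tr (halfturn R i *m g) != 0.
  have [SK kU kk] := quarterturnP i; exists (quarterturn i), (halfturn R i *m g).
  have SH := SO3_halfturn R i.
  split=> //; [exact: SO3_mul|by apply: u => //; exact: SO3_mul|].
  rewrite kk mulmxA; have -> : halfturn R i *m halfturn R i = 1%:M; last by rewrite mul1mx.
  by case: SH => + _; rewrite {1}/halfturn tr_diag_mx.
apply: contrapT => /forallNP h.
have hi i : 1 + \tr (halfturn R i *m g) = 0 by have /negP := h i; rewrite negbK => /eqP.
have := (hi e0, hi e1, hi e2); rewrite /mxtrace !sum3 !halfturnE /= => -[[h0 h1] h2].
by move: g0; rewrite /mxtrace sum3; lra.
Qed.

(** Each factor is a product of three Cayley transforms of skew matrices, and multiplication by
    these stays in the identity component. *)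
Lemma SO3xSO3_sub : @SO3xSO3 R `<=` @Oo33 R.
Proof.
have cay (N : 'M[R]_3) : SO3 N -> N + 1%:M \in unitmx -> exists2 X, X^T = - X & N = cayley X.
  move=> SN u; exists (inv_cayley N); last by rewrite inv_cayleyK.
  by rewrite -(SO3_inv_cayley SN u) hat_skew.
move=> _ [g Sg [h Sh <-]].
have [k [N [Sk SN uk uN ->]]] := SO3_cayley_factor Sg.
have [k' [N' [Sk' SN' uk' uN' ->]]] := SO3_cayley_factor Sh.
have [X Xs ->] := cay _ Sk uk; have [Y Ys ->] := cay _ SN uN.
have [X' Xs' ->] := cay _ Sk' uk'; have [Y' Ys' ->] := cay _ SN' uN'.
rewrite -(rdiag_mul (cayley X *m cayley X) (cayley X' *m cayley X')) -(rdiag_mul (cayley X) (cayley X')).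
do 2! (apply: Oo33_mul_cayley => //).
by rewrite -[rdiag _ _]mul1mx; apply: Oo33_mul_cayley => //; exact: Oo33_1.
Qed.

Definition rnum P q : 'M[R]_3 := ulsubmx P *m q + ursubmx P.
Definition rden P q : 'M[R]_3 := dlsubmx P *m q + drsubmx P.

(* With [w = (q x, x)] a null vector of the form, [P w = (rnum P q x, rden P q x)] is null too. *)
Lemma rden_unit P q : O33 P -> SO3 q -> rden P q \in unitmx.
Proof.
move=> OP [qq _]; apply: unitmx_ker => x x0.
pose w := col_mx (q *m x) x.
have Pw : P *m w = col_mx (rnum P q *m x) (rden P q *m x).
  rewrite -{1}[P]submxK mul_block_col /rnum /rden !mulmxDl !mulmxA.
  by [].
have qx : (q *m x)^T *m (q *m x) = x^T *m x.
  by rewrite trmx_mul mulmxA -(mulmxA x^T) qq mulmx1.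
have := OP w w; rewrite /rform Pw !col_mxKu !col_mxKd x0 mulmx0 subr0 qx subrr.
move=> /(congr1 (fun A => \tr A)); rewrite mxtrace0 => /trmx_mul_eq0 n0.
have : P *m w = 0 by rewrite Pw n0 x0 col_mx0.
move=> /(congr1 (mulmx (invmx P))); rewrite mulKmx ?O33_unit // mulmx0.
by move=> w0; rewrite -(col_mxKd (q *m x) x) -/w w0; apply/matrixP => i j; rewrite !mxE.
Qed.

(** The derivative of the quotient [rnum] by [rden] in the direction [X], with the value of the
    action factored in. *)
Definition rvel P X q : 'M[R]_3 := (rnum X q - rmoebius P q *m rden X q) *m invmx (rden P q).

Lemma lcm_rnum q : linear_continuous_map (rnum^~ q).
Proof.
apply: lcm_mx => a A B.
by rewrite /rnum /ulsubmx /ursubmx !linearP /= mulmxDl -scalemxAl scalerDr addrACA.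
Qed.

Lemma lcm_rden q : linear_continuous_map (rden^~ q).
Proof.
apply: lcm_mx => a A B.
by rewrite /rden /dlsubmx /drsubmx !linearP /= mulmxDl -scalemxAl scalerDr addrACA.
Qed.

Lemma is_derive_rmoebius (c : R -> 'M[R]_(3 + 3)) q : SO3 q -> O33 (c 0) -> derivable c 0 1 ->
  is_derive (0 : R) 1 (fun t => rmoebius (c t) q) (rvel (c 0) (derive1 c 0) q).
Proof.
move=> Sq Oc dc; have u := rden_unit Oc Sq.
have cD : is_derive (0 : R) 1 c (derive1 c 0) by rewrite derive1E; exact: derivableP.
have nD := is_derive_lcm (lcm_rnum q) cD.
have dD := is_derive_invmx (is_derive_lcm (lcm_rden q) cD) u.
have [d1 d2] := is_derive_bcm (bilinear_continuous_mulmx R 3 3 3) nD dD.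
split; first exact: d1.
apply: etrans d2 _.
rewrite /rvel mulmxBl mulmxN /rmoebius /= -/(rnum _ _) -/(rden _ _) !mulmxA.
by [].
Qed.

Lemma rvel_linear P q : linear (fun X => rvel P X q).
Proof.
move=> a X Y; rewrite /rvel (lcmD (lcm_rnum q)) (lcmZ (lcm_rnum q)).
rewrite (lcmD (lcm_rden q)) (lcmZ (lcm_rden q)).
rewrite mulmxDr -(scalemxAr a) opprD addrACA -scalerBr mulmxDl -(scalemxAl a).
by [].
Qed.

(** The action is rational; [Om] is the open set where the denominator is invertible, and it
    contains the required points by [rden_unit]. *)
Lemma rmoebius_smooth d (U : set 'rV[R]_d) (psi : 'rV[R]_d -> 'M[R]_(3 + 3)) : open U ->
  smooth_on U psi -> (forall y, U y -> Oo33 (psi y)) ->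
  exists Om : set ('rV[R]_d * 'M[R]_3)%type, [/\ open Om,
    forall y q, U y -> M q -> Om (y, q) &
    forall a : 'I_3 * 'I_3, smooth_on Om (fun z => rmoebius (psi z.1) z.2 a.1 a.2)].
Proof.
move=> oU sU UG; pose V := [set z : 'rV[R]_d * 'M[R]_3 | U z.1].
have oV : open V.
  by apply: open_comp => // z _; exact: (lcm_fst _ _).2.
have c1 k : class_C k V (fun z => psi z.1).
  have := @class_C_affine R _ _ _ k V U fst psi 0 (lcm_fst _ _).
  under eq_fun do rewrite addr0.
  by apply=> // x; rewrite addr0.
have c2 k : class_C k V (fun z : 'rV[R]_d * 'M[R]_3 => z.2).
  by apply: class_C_lin; exact: lcm_snd.
have sub k m n (L : 'M[R]_(3 + 3) -> 'M[R]_(m, n)) : linear L -> class_C k V (fun z => L (psi z.1)).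
  by move=> Ll; apply: (class_C_lcm (lcm_mx Ll) oV).
have cn k : class_C k V (fun z => rnum (psi z.1) z.2).
  apply: class_CD oV (class_C_mulmx oV (sub _ _ _ _ _) (c2 k)) (sub _ _ _ _ _);
  by move=> a x y; rewrite /ulsubmx /ursubmx !linearP.
have cd k : class_C k V (fun z => rden (psi z.1) z.2).
  apply: class_CD oV (class_C_mulmx oV (sub _ _ _ _ _) (c2 k)) (sub _ _ _ _ _);
  by move=> a x y; rewrite /dlsubmx /drsubmx !linearP.
pose Om := V `&` [set z | rden (psi z.1) z.2 \in unitmx].
have oOm : open Om.
  rewrite openE => z [Vz Dz]; rewrite /interior; apply: filterI; first exact: open_nbhs_nbhs.
  by have := class_C_cont (cd 0%N) Vz (open_nbhs_nbhs (conj (@open_unitmx _ _) Dz)).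
exists Om; split=> //.
  by move=> y q Uy Mq; split=> //; apply: rden_unit => //; apply: Oo33_O33; exact: UG.
move=> [i j] k /=; apply: (class_C_coord _ _ oOm); apply: (class_C_mulmx oOm).
  by apply: class_C_subset (cn k) => z [].
apply: (class_C_invmx oOm) => [z []//|].
by apply: class_C_subset (cd k) => z [].
Qed.

(** The general element of the Lie algebra of O(3,3) when [X1] and [X2] are skew. *)
Definition lie X1 B X2 : 'M[R]_(3 + 3) := block_mx X1 B B^T X2.

Lemma lieP (Z : 'M[R]_(3 + 3)) : Z^T *m Jr + Jr *m Z = 0 ->
  [/\ Z = lie (ulsubmx Z) (ursubmx Z) (drsubmx Z), (ulsubmx Z)^T = - ulsubmx Z &
      (drsubmx Z)^T = - drsubmx Z].
Proof.
move=> ZJ.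
rewrite -{1 2}[Z]submxK tr_block_mx !mulmx_block !mulmx0 !mul0mx !addr0 !add0r in ZJ.
rewrite !mulmx1 !mul1mx !mulmxN !mulNmx !mulmx1 !mul1mx add_block_mx -[0]block_mx0 in ZJ.
have /eq_block_mx[h1 h2 h3 h4] := ZJ; split.
- rewrite -{1}[Z]submxK /lie; congr (block_mx _ _ _ _).
  by apply/eqP; rewrite -subr_eq0; apply/eqP; apply: trmx_inj; rewrite linearB /= trmxK trmx0 -oppr0 -h2 opprD opprK addrC.
- by apply/eqP; rewrite -addr_eq0 h1.
- by move/eqP: h4; rewrite -opprD oppr_eq0 addr_eq0 => /eqP.
Qed.

(** Differentiate P^T J P = J at [c]. As [c] is orthogonal and commutes with [Jr], the matrix
    [Z = c^T *m X] satisfies the linear relation of the Lie algebra. *)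
Lemma tangent_Oo33 c X : SO3xSO3 c -> tangent_at (@Oo33 R) c X ->
  exists X1 B X2, [/\ X = c *m lie X1 B X2, X1^T = - X1 & X2^T = - X2].
Proof.
move=> [g Sg [h Sh <-]] [f [e e0 [fC fO f0 f1]]].
have i0 : `]-e, e[%classic (0 : R) by rewrite /= in_itv /= oppr_lt0 e0.
have fd := derivableP (class_C_derivable (v := (1 : R)) (fC 1%N) i0).
have fdt := is_derive_lcm (@lcm_mx R _ _ _ (@trmx R (3 + 3) (3 + 3))
  (fun a x y => linearP (@trmx R (3 + 3) (3 + 3)) a x y)) fd.
have mulB := bilinear_continuous_mulmx R (3 + 3) (3 + 3) (3 + 3).
have d2 := is_derive_bcm mulB fdt (is_derive_bcm mulB (is_derive_cst (Jr : 'M[R]_(3 + 3)) (0 : R) (1 : R)) fd).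
case: d2 => _; rewrite (near_eq_derive (g := fun=> Jr)); last first.
  have oI : open `]-e, e[%classic by exact: interval_open.
  apply: filterS (open_nbhs_nbhs (conj oI i0)) => s se.
  by rewrite /= mulmxA; apply/O33P; apply: Oo33_O33; exact: fO.
rewrite derive_cst -derive1E f1 /= f0 mul0mx add0r => H.
pose Z := (rdiag g h)^T *m X.
have cc := rdiag_tr_mul Sg Sh.
have XZ : X = rdiag g h *m Z by rewrite /Z mulmxA (mulmx1C cc) mul1mx.
have ZJ : Z^T *m Jr + Jr *m Z = 0.
  rewrite [RHS]H /Z trmx_mul trmxK -(mulmxA X^T) rdiag_Jr; apply: (f_equal2 +%R) => //.
  by rewrite rdiag_tr !mulmxA rdiag_Jr.
have [ZE s1 s2] := lieP ZJ.
by exists (ulsubmx Z), (ursubmx Z), (drsubmx Z); rewrite -ZE.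
Qed.

Lemma rvel_lie (g h : 'M[R]_3) X1 B X2 q : SO3 h -> SO3 q ->
  rvel (rdiag g h) (rdiag g h *m lie X1 B X2) q =
  g *m (X1 *m q + B - q *m B^T *m q - q *m X2) *m h^T.
Proof.
move=> Sh Sq; have [hh _] := Sh; have [_ hh'] := SO3_tr Sh.
rewrite /rvel /rmoebius /rnum /rden /lie /rdiag mulmx_block !mul0mx !addr0 !add0r.
rewrite !(block_mxKul, block_mxKur, block_mxKdl, block_mxKdr) !mul0mx !add0r addr0 SO3_inv //.
congr (_ *m _).
have -> : g *m q *m h^T *m (h *m B^T *m q + h *m X2) = g *m (q *m B^T *m q + q *m X2).
  by rewrite mulmxDr !mulmxA -![_ *m h^T *m h]mulmxA hh !mulmx1 mulmxDr !mulmxA.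
by rewrite -!(mulmxA g) -mulmxDr -mulmxBr opprD addrA.
Qed.
End RealForm.

(** * Cayley charts of SO_3 x SO_3 and O_o(3,3) *)

Section RealCharts.
Variable R : realType.
Local Notation K := (@SO3xSO3 R).
Implicit Types X Y : 'M[R]_3.

Lemma lie_Jr X B Y : X^T = - X -> Y^T = - Y -> (lie X B Y)^T *m Jr R + Jr R *m lie X B Y = 0.
Proof.
move=> Xs Ys; rewrite /lie tr_block_mx trmxK Xs Ys !mulmx_block !mulmx0 !mul0mx !addr0 !add0r.
rewrite !mulmx1 !mul1mx !mulmxN !mulNmx !mulmx1 !mul1mx add_block_mx opprK.
by rewrite !addNr !subrr block_mx0.
Qed.

Definition k_io (y : 'rV[R]_(3 + 3)) := rdiag (hat (lsubmx y)) (hat (rsubmx y)).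
Definition k_ka (Z : 'M[R]_(3 + 3)) : 'rV[R]_(3 + 3) := row_mx (vee (ulsubmx Z)) (vee (drsubmx Z)).

(** The 15 coordinates of the Lie algebra: the two skew blocks and, between them, the flattened
    block [B]. *)
Definition g_io (y : 'rV[R]_(3 + 3 * 3 + 3)) :=
  lie (hat (lsubmx (lsubmx y))) (vec_mx (rsubmx (lsubmx y))) (hat (rsubmx y)).
Definition g_ka (Z : 'M[R]_(3 + 3)) : 'rV[R]_(3 + 3 * 3 + 3) :=
  row_mx (row_mx (vee (ulsubmx Z)) (mxvec (ursubmx Z))) (vee (drsubmx Z)).

Lemma K_unit c : K c -> c \in unitmx.
Proof. by case=> g Sg [h Sh <-]; rewrite block_diag_unit !SO3_unit. Qed.

Lemma K_inv c : K c -> K (invmx c).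
Proof.
move=> Kc; have u := K_unit Kc; case: Kc u => g Sg [h Sh <-] u.
have [Sgt gg] := SO3_tr Sg; have [Sht hh] := SO3_tr Sh.
exists g^T => //; exists h^T => //; apply: (can_inj (mulKmx u)).
by rewrite mulmxV // rdiag_mul gg hh rdiag1.
Qed.

Lemma K_mul c c' : K c -> K c' -> K (c *m c').
Proof.
move=> [g Sg [h Sh <-]] [g' Sg' [h' Sh' <-]]; rewrite rdiag_mul.
by exists (g *m g'); [exact: SO3_mul|exists (h *m h') => //; exact: SO3_mul].
Qed.

Lemma k_chart c : K c -> exists2 r : R, 0 < r & [/\ local_param K (rball r) (cayley_param k_io c),
  forall v, 'D_v (cayley_param k_io c) 0 = 2 *: (k_io v *m c) &
  forall (I : set R) (f : R -> 'M[R]_(3 + 3)), open I -> smooth_on I f -> (forall s, I s -> K (f s)) ->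
    forall t, I t -> f t = c -> exists J (x : R -> 'rV[R]_(3 + 3)),
      [/\ open J, J t, J `<=` I, smooth_on J x /\ x t = 0 &
          forall s, J s -> rball r (x s) /\ f s = cayley_param k_io c (x s)]].
Proof.
move=> Kc; apply: (@cayley_chart _ _ _ k_io k_ka).
- move=> a x y; rewrite /k_io !linearD !linearZ /= !hat_linear /rdiag.
  by rewrite scale_block_mx add_block_mx !scaler0 !addr0.
- move=> a x y; rewrite /k_ka /ulsubmx /drsubmx !linearP /= !vee_linear.
  by rewrite scale_row_mx add_row_mx.
- by move=> y; rewrite /k_ka /k_io /rdiag block_mxKul block_mxKdr !hatK hsubmxK.
- exact: K_unit.
- exists 1 => // y _ _; apply: K_mul => //.
  have u (z : 'rV[R]_3) : 1%:M - hat z \in unitmx.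
    by have := skew_unit 1 (hat_skew z); rewrite scale1r.
  rewrite /k_io /rdiag cayley_block_diag //.
  have S (z : 'rV[R]_3) : SO3 (cayley (hat z)).
    by apply: cayley_SO3; [exact: hat_skew|exact: u].
  by exists (cayley (hat (lsubmx y))) => //; exists (cayley (hat (rsubmx y))).
- move=> P KP; have [g Sg [h Sh <-]] := K_mul KP (K_inv Kc).
  rewrite /rdiag {1}(scalar_mx_block 3 3 1) add_block_mx !addr0 block_diag_unit => /andP[ug uh].
  rewrite inv_cayley_block_diag // /k_ka block_mxKul block_mxKdr /k_io /rdiag row_mxKl row_mxKr.
  by rewrite !SO3_inv_cayley.
Qed.

Lemma g_chart c : Oo33 c -> exists2 r : R, 0 < r & [/\ local_param (@Oo33 R) (rball r) (cayley_param g_io c),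
  forall v, 'D_v (cayley_param g_io c) 0 = 2 *: (g_io v *m c) &
  forall (I : set R) (f : R -> 'M[R]_(3 + 3)), open I -> smooth_on I f -> (forall s, I s -> Oo33 (f s)) ->
    forall t, I t -> f t = c -> exists J (x : R -> 'rV[R]_(3 + 3 * 3 + 3)),
      [/\ open J, J t, J `<=` I, smooth_on J x /\ x t = 0 &
          forall s, J s -> rball r (x s) /\ f s = cayley_param g_io c (x s)]].
Proof.
move=> Gc.
have lio : linear g_io.
  move=> a x y; rewrite /g_io !linearD !linearZ /= !hat_linear /lie.
  by rewrite scale_block_mx add_block_mx linearD linearZ.
have Oc := O33_unit (Oo33_O33 Gc).
have ioJ y : (g_io y)^T *m Jr R + Jr R *m g_io y = 0 by apply: lie_Jr; exact: hat_skew.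
apply: (@cayley_chart _ _ _ g_io g_ka) => //.
- move=> a x y; rewrite /g_ka /ulsubmx /ursubmx /drsubmx !linearP /= !vee_linear.
  by rewrite !(scale_row_mx, add_row_mx).
- move=> y; rewrite /g_ka /g_io /lie block_mxKul block_mxKur block_mxKdr !hatK vec_mxK.
  by rewrite !hsubmxK.
- exists 1 => // y _ yu.
  (* A path from [c] to the point of the chart; it stays in [O33] by [cayley_form], hence in the
     identity component. *)
  pose f (s : R) := cayley (s *: g_io y) *m c.
  have -> : cayley (g_io y) *m c = f 1 by rewrite /f scale1r.
  apply: Oo33_path.
  + move=> s s01; pose U := [set s : R | 1%:M - s *: g_io y \in unitmx].
    have l0 (W : set R) : class_C 0 W (fun s : R => s *: g_io y).
      by apply: class_C_lin; exact: lcm_scalel.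
    have oU : open U.
      rewrite (_ : U = (fun s : R => 1%:M - s *: g_io y) @^-1` [set A : 'M[R]_(3 + 3) | A \in unitmx]) //.
      apply: open_comp; last exact: open_unitmx.
      move=> z _; have : class_C 0 setT (fun s : R => 1%:M - s *: g_io y).
        by apply: class_CB openT (class_C_cst _ _ _) (l0 _).
      by case=> /(_ z I).
    have : class_C 0 U f.
      apply: (class_C_mulmx oU _ (class_C_cst _ _ _)); apply: (class_C_mulmx oU).
        apply: (class_C_invmx oU) => //.
        by apply: class_CB oU (class_C_cst _ _ _) (l0 _).
      by apply: class_CD oU (class_C_cst _ _ _) (l0 _).
    by case=> /(_ s (yu s s01)).
  + move=> s s01; apply: O33_mul; last exact: Oo33_O33.
    apply/O33P; apply: cayley_form; first exact: yu.
    by rewrite linearZ /= -(scalemxAl s) -(scalemxAr s) -scalerDr ioJ scaler0.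
  + by rewrite /f scale0r cayley0 mul1mx.
- move=> P GP u; have PP : O33 (P *m invmx c).
    apply: O33_mul; first exact: Oo33_O33.
    by move=> v w; rewrite -(Oo33_O33 Gc (invmx c *m v)) !mulKVmx.
  have /lieP[ZE s1 s2] := inv_cayley_form u ((O33P _).1 PP).
  by rewrite [RHS]ZE /g_io /g_ka !row_mxKl !row_mxKr mxvecK !veeK.
Qed.
End RealCharts.

(** * Geodesics in SO_3 x SO_3 *)

Section SO3Curves.
Variable R : realType.
Local Notation M := (@SO3 R).

Definition body_velocity (g : R -> 'M[R]_3) (t : R) := (g t)^T *m derive1 g t.

(** Skewness is the derivative of g^T g = 1. In the derivative of g^T g' the term g'^T g' equals a^T
    a, which is symmetric, so the symmetry of the whole is decided by g^T g''. *)
Lemma body_velocityP (J : set R) (g : R -> 'M[R]_3) t :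
  open J -> smooth_on J g -> (forall s, J s -> M (g s)) -> J t ->
  let a := body_velocity g in
  [/\ (a t)^T = - a t, derive1 g t = g t *m a t &
    is_derive t (1 : R) a ((a t)^T *m a t + (g t)^T *m derive1n 2 g t)].
Proof.
move=> oJ sg Sg Jt a.
have mulB := bilinear_continuous_mulmx R 3 3 3.
have Lt : linear_continuous_map (@trmx R 3 3) by apply: lcm_mx => s A B; rewrite linearP.
have gD : is_derive t (1 : R) g (derive1 g t).
  by rewrite derive1E; exact: derivableP (class_C_derivable (sg 1%N) Jt).
have g'D : is_derive t (1 : R) (derive1 g) (derive1n 2 g t).
  have sg1 : class_C 1 J (derive1 g).
    rewrite (_ : derive1 g = 'D_1 g); last by apply/funext => s; rewrite derive1E.
    exact: class_C_derive (sg 2%N).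
  by rewrite /derive1n /= [X in is_derive _ _ _ X]derive1E; exact: derivableP (class_C_derivable sg1 Jt).
have [gg gg'] : (g t)^T *m g t = 1%:M /\ g t *m (g t)^T = 1%:M.
  by have [h _] := Sg t Jt; split=> //; exact: mulmx1C.
have g'E : derive1 g t = g t *m a t by rewrite /a mulmxA gg' mul1mx.
split=> //.
  have [_] := is_derive_bcm mulB (is_derive_lcm Lt gD) gD.
  rewrite (near_eq_derive (g := fun=> 1%:M)); last first.
    by apply: filterS (open_nbhs_nbhs (conj oJ Jt)) => s Js; case: (Sg s Js).
  rewrite derive_cst => /esym/eqP; rewrite addr_eq0 => /eqP H.
  by rewrite /a /body_velocity trmx_mul trmxK H.
have := is_derive_bcm mulB (is_derive_lcm Lt gD) g'D.
have -> : (derive1 g t)^T *m derive1 g t = (a t)^T *m a t.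
  by rewrite g'E trmx_mul mulmxA -(mulmxA (a t)^T) gg mulmx1.
by [].
Qed.

Lemma derive0_cst (I : set R) m n (f : R -> 'M[R]_(m, n)) : is_interval I ->
  (forall t, I t -> is_derive t (1 : R) f 0) -> forall s t, I s -> I t -> f s = f t.
Proof.
move=> iI f0.
suff H s t : I s -> I t -> s < t -> f s = f t.
  by move=> s t Is It; have [/H->|/H->|->] := ltgtP s t.
move=> Is It st; apply/matrixP => i j.
have J u : s <= u <= t -> I u by move=> sut; exact: iI sut.
have fd u : s <= u <= t -> is_derive u (1 : R) (fun u => f u i j) 0.
  move=> /J Iu; have := is_derive_lcm (lcm_coord R i j) (f0 u Iu).
  by rewrite mxE.
have [||u _] := @MVT_segment R (fun u => f u i j) (fun=> 0) s t (ltW st).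
- by move=> u; rewrite in_itv /= => /andP[su ut]; apply: fd; rewrite !ltW.
- apply: derivable_within_continuous => u; rewrite in_itv /= => sut.
  by case: (fd u sut).
by rewrite mul0r => /eqP; rewrite subr_eq0 => /eqP.
Qed.
End SO3Curves.

(** * Integrals of the velocity fields over SO_3 *)

Section RealPart.
Variables (R : realType) (mu : {measure set (borel 'M[R]_3) -> \bar R}).
Hypothesis vol : volume_measure (@SO3 R) (@rip R) mu.
Local Notation M := (@SO3 R).
Local Notation K := (@SO3xSO3 R).
Local Notation Int := (Int M mu).
Local Notation kin := (kinetic (@Oo33 R) M (@rmoebius R) (@rip R) mu).
Implicit Types (a b X q B : 'M[R]_3).

Lemma ripDl x y z : rip (x + y) z = rip x z + rip y z :> R.
Proof. by rewrite /rip linearD mulmxDl linearD. Qed.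
Lemma ripDr x y z : rip z (x + y) = rip z x + rip z y :> R.
Proof. by rewrite /rip mulmxDr linearD. Qed.
Lemma ripNl x z : rip (- x) z = - rip x z :> R.
Proof. by rewrite /rip linearN mulNmx linearN. Qed.
Lemma ripNr x z : rip z (- x) = - rip z x :> R.
Proof. by rewrite /rip mulmxN linearN. Qed.
Lemma ripZr s x z : rip z (s *: x) = s * rip z x :> R.
Proof. by rewrite /rip -scalemxAr linearZ. Qed.
Lemma ripZl s x z : rip (s *: x) z = s * rip x z :> R.
Proof. by rewrite /rip linearZ -scalemxAl linearZ. Qed.
Lemma ripC x y : rip x y = rip y x :> R.
Proof. by rewrite /rip -mxtrace_tr trmx_mul trmxK. Qed.
Lemma rip_mulr x y q : rip (x *m q) y = rip x (y *m q^T) :> R.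
Proof. by rewrite /rip trmx_mul -mulmxA mxtrace_mulC mulmxA. Qed.
Lemma rip_mull x y q : rip (q *m x) y = rip x (q^T *m y) :> R.
Proof. by rewrite /rip trmx_mul mulmxA. Qed.

Lemma delta_mulmx (i j k l : 'I_3) (A : 'M[R]_3) :
  delta_mx i j *m A *m delta_mx k l = A j k *: delta_mx i l :> 'M[R]_3.
Proof.
apply/matrixP => m n; rewrite !mxE (bigD1 k) //= big1 => [|k' kk]; last first.
  by rewrite [delta_mx _ _ _ _]mxE (negbTE kk) mulr0.
rewrite addr0 mxE (bigD1 j) //= big1 => [|k' kk]; last first.
  by rewrite mxE (negbTE kk) andbF mul0r.
by rewrite !mxE !eqxx andbT addr0; case: (m == i); case: (n == l); rewrite ?(mul0r, mul1r, mulr0, mulr1).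
Qed.

Lemma rip_delta i j (x y z : 'M[R]_3) :
  rip (x *m delta_mx i j *m y) z = (x^T *m z *m y^T) i j.
Proof.
rewrite rip_mulr rip_mull mulmxA /rip trmx_delta mxtrace_mulC.
rewrite /mxtrace (bigD1 i) //= big1 => [|k ki].
  rewrite mxE (bigD1 j) //= big1 => [|k kj]; last by rewrite [delta_mx _ _ _ _]mxE (negbTE kj) mulr0.
  by rewrite [delta_mx _ _ _ _]mxE !eqxx mulr1 !addr0.
by rewrite mxE big1 // => l _; rewrite [delta_mx _ _ _ _]mxE (negbTE ki) andbF mulr0.
Qed.

(** The sum over matrix units splits into two traces, so every quadratic term in which a skew matrix
    stands alone on one side has mean 0. *)
Lemma sum_rip_delta (x y z t : 'M[R]_3) :
  \sum_i \sum_j rip (x *m delta_mx i j *m y) (z *m delta_mx i j *m t) = \tr (x^T *m z) * \tr (t *m y^T).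
Proof.
rewrite /mxtrace mulr_suml; apply: eq_bigr => i _.
rewrite mulr_sumr; apply: eq_bigr => j _; rewrite rip_delta.
rewrite !mulmxA -(mulmxA _ t) mxE (bigD1 j) //= big1 => [|k kj].
  rewrite addr0 mxE (bigD1 i) //= big1 => [|k ki]; last by rewrite [delta_mx _ _ _ _]mxE (negbTE ki) mulr0.
  by rewrite [delta_mx _ _ _ _]mxE !eqxx mulr1 addr0.
rewrite mxE big1 ?mul0r // => l _; rewrite [delta_mx _ _ _ _]mxE (negbTE kj) andbF mulr0.
by [].
Qed.

(** The velocity field of [c *m lie X1 B X2] up to the isometry [x |-> g *m x *m h^T]. *)
Definition field_at X1 B X2 q : 'M[R]_3 := X1 *m q + B - q *m B^T *m q - q *m X2.

(** On SO_3 the four squares are constant, and products with q B^T q lose two factors q by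
    orthogonality. The pairing of X1 q with q X2 has mean 0 by traces, and -2 <q B^T q, B> has mean
    -2/3 |B|^2; so 4/3 = 2 - 2/3. *)
Lemma Int_field_sqr X1 B X2 : X1^T = - X1 -> X2^T = - X2 ->
  Int (fun q => rip (field_at X1 B X2 q) (field_at X1 B X2 q)) =
  Int (fun=> 1) * (rip X1 X1 + rip X2 X2 + 4 / 3 * rip B B).
Proof.
move=> s1 s2.
pose L q := 2 * (rip (X1 *m q) B - rip (q *m X2) B - rip X1 (q *m B^T) + rip X2 (B^T *m q)).
pose Q p q := - (2 * (rip (X1 *m p) (q *m X2) + rip (p *m B^T *m q) B)).
pose k := rip X1 X1 + rip X2 X2 + 2 * rip B B.
have E q : M q -> rip (field_at X1 B X2 q) (field_at X1 B X2 q) = k + L q + Q q q.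
  move=> Sq; have [qq _] := Sq; have [_ qq'] := SO3_tr Sq.
  rewrite /field_at !(ripDl, ripDr, ripNl, ripNr).
  have h1 : rip (X1 *m q) (X1 *m q) = rip X1 X1 by rewrite rip_mulr -mulmxA qq' mulmx1.
  have h2 : rip (q *m X2) (q *m X2) = rip X2 X2 by rewrite rip_mull mulmxA qq mul1mx.
  have h3 : rip (q *m B^T *m q) (q *m B^T *m q) = rip B B.
    rewrite rip_mulr -!mulmxA qq' mulmx1 rip_mull mulmxA qq mul1mx.
    by rewrite /rip trmxK mxtrace_mulC.
  have h4 : rip (X1 *m q) (q *m B^T *m q) = rip X1 (q *m B^T).
    by rewrite rip_mulr -!mulmxA qq' mulmx1.
  have h5 : rip (q *m X2) (q *m B^T *m q) = rip X2 (B^T *m q).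
    by rewrite rip_mull !mulmxA qq mul1mx.
  rewrite (ripC B) (ripC B (q *m X2)) (ripC B (q *m B^T *m q)) (ripC _ (X1 *m q)) (ripC (q *m X2) (X1 *m q)).
  rewrite (ripC (q *m B^T *m q) (q *m X2)) h1 h2 h3 h4 h5 /k /L /Q; ring.
rewrite (eq_Int mu E) (@Int_poly2 _ mu vol k L Q).
- congr (_ * _).
  have -> : \sum_i \sum_j Q (delta_mx i j) (delta_mx i j) = - 2 * rip B B.
    have t1 := sum_rip_delta X1 1%:M 1%:M X2.
    rewrite trmx1 !mulmx1 (skew_tr (X := X2)) // mulr0 in t1.
    have t2 : \sum_i \sum_j rip (delta_mx i j *m B^T *m delta_mx i j) B = rip B B.
      rewrite {2}/rip /mxtrace exchange_big; apply: eq_bigr => j _ /=.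
      rewrite mxE; apply: eq_bigr => i _; rewrite delta_mulmx ripZl.
      by have := rip_delta i j 1%:M 1%:M B; rewrite !trmx1 !mul1mx !mulmx1 => ->.
    have QE i j : Q (delta_mx i j) (delta_mx i j) =
        - 2 * rip (X1 *m delta_mx i j *m 1%:M) (1%:M *m delta_mx i j *m X2)
        + - 2 * rip (delta_mx i j *m B^T *m delta_mx i j) B.
      rewrite mulmx1 mul1mx /Q; ring.
    under eq_bigr do under eq_bigr do rewrite QE.
    under eq_bigr do rewrite big_split -!mulr_sumr; rewrite big_split -!mulr_sumr t1 t2 /=; ring.
  by rewrite /k; field.
- move=> s x y; rewrite /L !(mulmxDl, mulmxDr) -!(scalemxAl s) -!(scalemxAr s) -?(scalemxAl s).
  rewrite !(ripDl, ripDr, ripZl, ripZr); ring.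
- move=> z s x y; rewrite /Q !(mulmxDl, mulmxDr) -!(scalemxAl s) -!(scalemxAr s) -?(scalemxAl s).
  rewrite !(ripDl, ripDr, ripZl, ripZr); ring.
- move=> z s x y; rewrite /Q !(mulmxDl, mulmxDr) -!(scalemxAl s) -!(scalemxAr s) -?(scalemxAl s).
  rewrite !(ripDl, ripDr, ripZl, ripZr); ring.
Qed.

(** By [hat_mul], the sum over [i] contributes - u B w^T + w_j (u B)_j for each [j]; summing over
    the three values of [j] gives -3 + 1 = -2 copies of u B w^T. *)
Lemma sum_rip_hat (u w : 'rV[R]_3) B :
  \sum_i \sum_j rip (B^T *m delta_mx i j) (hat (u *m delta_mx i j) *m (hat w)^T) =
  - 2 * (u *m B *m w^T) 0 0.
Proof.
under eq_bigr do under eq_bigr do rewrite -[X in rip X _]mulmx1 rip_delta trmxK trmx1 mulmx1.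
  have N j : hat (delta_mx 0 j) *m (hat w)^T =
      - (w^T *m delta_mx 0 j - w 0 j *: 1%:M).
    rewrite hat_skew mulmxN hat_mul.
  have -> : ((delta_mx 0 j : 'rV[R]_3) *m w^T) 0 0 = w 0 j by rewrite -rowE !mxE.
  by [].
have ud i j : u *m delta_mx i j = u 0 i *: delta_mx 0 j.
    apply/rowP => k; rewrite !mxE (bigD1 i) //= big1 ?addr0 => [|l li].
      by rewrite mxE !eqxx.
    by rewrite [delta_mx _ _ _ _]mxE (negbTE li) mulr0.
  have h0 : hat 0 = 0 :> 'M[R]_3.
    exact: lin0 (@hat_linear R).
  have hZ s y : hat (s *: y) = s *: hat y :> 'M[R]_3.
    by have := hat_linear s y 0; rewrite h0 !addr0.
  have uN j : \sum_i (B *m (hat (u *m delta_mx i j) *m (hat w)^T)) i j =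
      - ((u *m B *m w^T) 0 0 - w 0 j * (u *m B) 0 j).
    transitivity ((u *m B *m (hat (delta_mx 0 j) *m (hat w)^T)) 0 j).
      rewrite -mulmxA mxE; apply: eq_bigr => i _.
      by rewrite ud hZ -(scalemxAl (u 0 i)) -(scalemxAr (u 0 i)) mxE.
    rewrite N mulmxN mulmxBr -scalemxAr mulmx1 mulmxA.
    have mB (A C : 'rV[R]_3) : (- (A - C)) 0 j = - (A 0 j - C 0 j) by rewrite !mxE.
    rewrite mB; apply/(f_equal -%R)/(f_equal2 +%R); last first.
      by rewrite [(_ *: (_ : 'rV_3)) 0 j]mxE.
    by rewrite [LHS]mxE big_ord1 [delta_mx _ _ _ _]mxE !eqxx mulr1.
  rewrite exchange_big /=; under eq_bigr do rewrite uN.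
  have -> : (u *m B *m w^T) 0 0 = \sum_j w 0 j * (u *m B) 0 j.
    by rewrite mxE; apply: eq_bigr => j _; rewrite [w^T _ _]mxE mulrC.
  rewrite !sum3; ring.
Qed.

(** The cubic pairing of q B^T q with hat(u) q hat(w)^T becomes quadratic by [hat_conj]; the other
    terms in [B] are linear in [q] and integrate to 0, and those in [X1], [X2] are constant or die
    by traces. The constant 4/3 is the coefficient -2, times the -2 of [sum_rip_hat], times the
    second moment 1/3. *)
Lemma Int_field_acc X1 B X2 (u w : 'rV[R]_3) a2 b2 : X1^T = - X1 -> X2^T = - X2 ->
  Int (fun q => rip (field_at X1 B X2 q)
    (a2 *m q + 2 *: (hat u *m q *m (hat w)^T) + q *m b2^T)) =
  Int (fun=> 1) * (rip X1 a2 - rip X2 b2^T + 4 / 3 * (u *m B *m w^T) 0 0).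
Proof.
move=> s1 s2.
pose L q := rip B (a2 *m q) + 2 * rip B (hat u *m q *m (hat w)^T) + rip B (q *m b2^T)
   - rip (q *m B^T) a2 - rip (B^T *m q) b2^T.
pose Q p q := 2 * rip (X1 *m p) (hat u *m q *m (hat w)^T) + rip (X1 *m p) (q *m b2^T)
   - rip (p *m X2) (a2 *m q) - 2 * rip (p *m X2) (hat u *m q *m (hat w)^T)
   - 2 * rip (B^T *m p) (hat (u *m q) *m (hat w)^T).
have E q : M q -> rip (field_at X1 B X2 q)
    (a2 *m q + 2 *: (hat u *m q *m (hat w)^T) + q *m b2^T) =
    (rip X1 a2 - rip X2 b2^T) + L q + Q q q.
  move=> Sq; have [qq _] := Sq; have [_ qq'] := SO3_tr Sq.
  rewrite /field_at !(ripDl, ripDr, ripNl, ripNr, ripZr).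
  have h1 : rip (X1 *m q) (a2 *m q) = rip X1 a2 by rewrite rip_mulr -mulmxA qq' mulmx1.
  have h2 : rip (q *m X2) (q *m b2^T) = rip X2 b2^T by rewrite rip_mull mulmxA qq mul1mx.
  have h3 : rip (q *m B^T *m q) (a2 *m q) = rip (q *m B^T) a2.
    by rewrite rip_mulr -!mulmxA qq' mulmx1.
  have h4 : rip (q *m B^T *m q) (q *m b2^T) = rip (B^T *m q) b2^T.
    by rewrite -mulmxA rip_mull mulmxA qq mul1mx.
  have h5 : rip (q *m B^T *m q) (hat u *m q *m (hat w)^T) = rip (B^T *m q) (hat (u *m q) *m (hat w)^T).
    by rewrite -(mulmxA q) rip_mull !mulmxA hat_conj.
  rewrite h1 h2 h3 h4 h5 /L /Q; ring.
rewrite (eq_Int mu E) (@Int_poly2 _ mu vol _ L Q).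
- congr (_ * (_ + _)).
  have -> : \sum_i \sum_j Q (delta_mx i j) (delta_mx i j) = 4 * (u *m B *m w^T) 0 0.
    have T x y z t := sum_rip_delta x y z t.
    have t1 := sum_rip_delta X1 1%:M (hat u) (hat w)^T.
    have t2 := sum_rip_delta X1 1%:M 1%:M b2^T.
    have t3 := sum_rip_delta 1%:M X2 a2 1%:M.
    have t4 := sum_rip_delta 1%:M X2 (hat u) (hat w)^T.
    have tr1 : \tr X1^T = 0 by rewrite mxtrace_tr skew_tr.
    have tr2 : \tr X2^T = 0 by rewrite mxtrace_tr skew_tr.
    have tru : \tr (hat u) = 0 by rewrite skew_tr ?hat_skew.
    have trw : \tr (hat w)^T = 0 by rewrite mxtrace_tr skew_tr ?hat_skew.
    rewrite !trmx1 ?mulmx1 ?mul1mx trw mulr0 in t1.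
    rewrite !trmx1 ?mulmx1 tr1 mul0r in t2.
    rewrite !trmx1 ?mulmx1 ?mul1mx tr2 mulr0 in t3.
    rewrite !trmx1 ?mul1mx tru mul0r in t4.
    have t5 : \sum_i \sum_j rip (B^T *m delta_mx i j) (hat (u *m delta_mx i j) *m (hat w)^T) =
        - 2 * (u *m B *m w^T) 0 0.
      exact: sum_rip_hat.
    have QE i j : Q (delta_mx i j) (delta_mx i j) =
        2 * rip (X1 *m delta_mx i j *m 1%:M) (hat u *m delta_mx i j *m (hat w)^T)
        + rip (X1 *m delta_mx i j *m 1%:M) (1%:M *m delta_mx i j *m b2^T)
        + - 1 * rip (1%:M *m delta_mx i j *m X2) (a2 *m delta_mx i j *m 1%:M)
        + - 2 * rip (1%:M *m delta_mx i j *m X2) (hat u *m delta_mx i j *m (hat w)^T)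
        + - 2 * rip (B^T *m delta_mx i j) (hat (u *m delta_mx i j) *m (hat w)^T).
      rewrite !mulmx1 !mul1mx /Q; ring.
    under eq_bigr do under eq_bigr do rewrite QE.
    under eq_bigr do rewrite !big_split -!mulr_sumr.
    rewrite !big_split -!mulr_sumr /= t1 t2 t3 t4 t5; ring.
  by field.
- move=> s x y; rewrite /L !(mulmxDl, mulmxDr) -!(scalemxAr s) -!(scalemxAl s).
  rewrite !(ripDl, ripDr, ripZl, ripZr); ring.
- move=> z s x y; rewrite /Q !(mulmxDl, mulmxDr) -!(scalemxAl s) -!(scalemxAr s) -?(scalemxAl s).
  rewrite !(ripDl, ripDr, ripZl, ripZr); ring.
- move=> z s x y; rewrite /Q.
  have hl : hat (u *m (s *: x + y)) = s *: hat (u *m x) + hat (u *m y).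
    by rewrite mulmxDr -(scalemxAr s) hat_linear.
  rewrite hl !(mulmxDl, mulmxDr) -!(scalemxAl s) -!(scalemxAr s) -?(scalemxAl s).
  rewrite !(ripDl, ripDr, ripZl, ripZr); ring.
Qed.

Local Notation pr := (fun (a : 'I_3 * 'I_3) (q : 'M[R]_3) => q a.1 a.2).
Local Notation lag := (lagrange_form M (@rmoebius R) mu pr (@rvel R)).
Let cM := @SO3_compact R.
Let muM := let: And3 a _ _ := SO3_volume_facts vol in a.
Let V0 := let: And3 _ a _ := SO3_volume_facts vol in a.

Lemma rip_ge0 x : 0 <= rip x x :> R.
Proof. by rewrite rip_sum sumr_ge0 // => a _; rewrite -expr2 sqr_ge0. Qed.

Lemma rvel_K (c X : 'M[R]_(3 + 3)) : K c -> tangent_at (@Oo33 R) c X -> exists X1 B X2,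
  [/\ X = c *m lie X1 B X2, X1^T = - X1, X2^T = - X2 & forall q, M q ->
  rvel c X q = ulsubmx c *m field_at X1 B X2 q *m (drsubmx c)^T].
Proof.
move=> Kc tX; have [X1 [B [X2 [XE s1 s2]]]] := tangent_Oo33 Kc tX.
exists X1, B, X2; split=> // q Sq; case: Kc XE => g Sg [h Sh <-] ->.
by rewrite rvel_lie // /rdiag block_mxKul block_mxKdr.
Qed.

Lemma rip_conj (g h x y : 'M[R]_3) : SO3 g -> SO3 h -> rip (g *m x *m h^T) (g *m y *m h^T) = rip x y.
Proof.
move=> [gg _] [hh _]; rewrite rip_mulr trmxK -(mulmxA (g *m y)) hh mulmx1.
by rewrite rip_mull mulmxA gg mul1mx.
Qed.

Lemma K_SO3 (c : 'M[R]_(3 + 3)) : K c ->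
  [/\ SO3 (ulsubmx c), SO3 (drsubmx c) & c = rdiag (ulsubmx c) (drsubmx c)].
Proof. by case=> g Sg [h Sh <-]; rewrite /rdiag block_mxKul block_mxKdr. Qed.

Lemma nondegenerate_K c : K c -> nondegenerate_at (@Oo33 R) M mu pr (@rvel R) c.
Proof.
move=> Kc X tX; have [X1 [B [X2 [XE s1 s2 vE]]]] := rvel_K Kc tX.
have [Sg Sh _] := K_SO3 Kc.
rewrite (eq_Int mu (h := fun q => rip (field_at X1 B X2 q) (field_at X1 B X2 q))); last first.
  move=> q Mq; rewrite -(rip_conj _ _ Sg Sh) -vE // rip_sum.
  by apply: eq_bigr => a _; rewrite expr2.
rewrite Int_field_sqr // => /eqP; rewrite mulf_eq0 gt_eqF //= => /eqP h0.
have p1 := rip_ge0 X1; have p2 := rip_ge0 X2; have p3 := rip_ge0 B.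
have z1 : X1 = 0 by apply: trmx_mul_eq0; rewrite -/(rip _ _); lra.
have z2 : X2 = 0 by apply: trmx_mul_eq0; rewrite -/(rip _ _); lra.
have z3 : B = 0 by apply: trmx_mul_eq0; rewrite -/(rip _ _); lra.
by rewrite XE z1 z2 z3 /lie trmx0 block_mx0 mulmx0.
Qed.

Lemma rgeodesic_eqP (S : set 'M[R]_(3 + 3)) d (U : set 'rV[R]_d) psi (J : set R)
    (x : R -> 'rV[R]_d) (c : R -> 'M[R]_(3 + 3)) t :
  S `<=` @Oo33 R -> local_param S U psi ->
  open J -> smooth_on J x -> (forall s, J s -> U (x s) /\ c s = psi (x s)) -> J t -> K (c t) ->
  (forall k, derive1n 2 x t 0 k + \sum_i \sum_j christoffel kin psi (x t) k i j
     * derive1 x t 0 i * derive1 x t 0 j = 0) <->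
  (forall l, lag c t (partial l psi (x t)) = 0).
Proof.
move=> SG pP oJ sx Jx Jt Kc.
have nd := nondegenerate_K Kc.
pose kap (b : 'I_(3 + 3) * 'I_(3 + 3)) (X : 'M[R]_(3 + 3)) : R := X b.1 b.2.
have h1 (a : 'I_3 * 'I_3) : linear_continuous_map (pr a) by exact: lcm_coord.
have h2 (b : 'I_(3 + 3) * 'I_(3 + 3)) : linear_continuous_map (kap b) by exact: lcm_coord.
have h3 (X : 'M[R]_(3 + 3)) : (forall b : 'I_(3 + 3) * 'I_(3 + 3), kap b X = 0) -> X = 0.
  by move=> X0; apply/matrixP => i j; rewrite mxE; exact: (X0 (i, j)).
have h4 (c' : R -> 'M[R]_(3 + 3)) q : M q -> Oo33 (c' 0) -> derivable c' 0 1 ->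
    is_derive (0 : R) 1 (fun t => rmoebius (c' t) q) (rvel (c' 0) (derive1 c' 0) q).
  by move=> Mq Gc dc; apply: is_derive_rmoebius => //; exact: Oo33_O33.
exact: (geodesic_eqP cM muM h1 (@rip_sum R) h2 h3 h4
  (@rvel_linear R) (@rmoebius_smooth R) SG pP oJ sx Jx Jt nd).
Qed.

Section RealCurve.
Variables (I : set R) (c : R -> 'M[R]_(3 + 3)).
Hypotheses (oI : open I) (cS : smooth_on I c) (cK : forall s, I s -> K (c s)).
Let g s := ulsubmx (c s).
Let h s := drsubmx (c s).

Lemma smooth_ulsubmx : smooth_on I g.
Proof.
move=> k; apply: (class_C_lcm _ oI (cS k)); apply: lcm_mx => a x y.
by rewrite /ulsubmx !linearP.
Qed.

Lemma smooth_drsubmx : smooth_on I h.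
Proof.
move=> k; apply: (class_C_lcm _ oI (cS k)); apply: lcm_mx => a x y.
by rewrite /drsubmx !linearP.
Qed.

Let Sg s : I s -> M (g s). Proof. by move=> /cK /K_SO3[]. Qed.
Let Sh s : I s -> M (h s). Proof. by move=> /cK /K_SO3[]. Qed.

(* The last term, which couples the two factors, is the integral of
   [- 2 tr (q^T B q^T hat(a) q hat(b)^T)], where [q^T hat(a) q = hat(a q)]. *)
Lemma lagrange_K t X1 B X2 : I t -> X1^T = - X1 -> X2^T = - X2 ->
  let a := vee (body_velocity g t) in let b := vee (body_velocity h t) in
  lag c t (c t *m lie X1 B X2) =
  Int (fun=> 1) * (rip X1 ((g t)^T *m derive1n 2 g t) - rip X2 ((h t)^T *m derive1n 2 h t)^T
    + 4 / 3 * (a *m B *m b^T) 0 0).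
Proof.
move=> It s1 s2 a b.
have [as_ g'E _] := body_velocityP oI smooth_ulsubmx Sg It.
have [bs h'E _] := body_velocityP oI smooth_drsubmx Sh It.
have [gg gg'] : (g t)^T *m g t = 1%:M /\ g t *m (g t)^T = 1%:M.
  by have [h1 _] := Sg It; split=> //; exact: mulmx1C.
have [hh hh'] : (h t)^T *m h t = 1%:M /\ h t *m (h t)^T = 1%:M.
  by have [h1 _] := Sh It; split=> //; exact: mulmx1C.
rewrite -(Int_field_acc _ _ _ _ _ s1 s2); apply: eq_Int => q Mq.
rewrite (veeK as_) (veeK bs).
set acc := _ + _ + _.
have vE : rvel (c t) (c t *m lie X1 B X2) q = g t *m field_at X1 B X2 q *m (h t)^T.
  have [g0 Sg0 [h0 Sh0 cE]] := cK It.
  by rewrite /g /h -cE rvel_lie // /rdiag block_mxKul block_mxKdr.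
rewrite -(rip_conj _ acc (Sg It) (Sh It)) rip_sum vE.
apply: eq_bigr => e _; apply: (f_equal2 *%R); first by [].
have actE s : I s -> rmoebius (c s) q e.1 e.2 = (g s *m q *m (h s)^T) e.1 e.2.
  move=> Is; have [_ _ ->] := K_SO3 (cK Is); rewrite -/(g s) -/(h s).
  rewrite /rmoebius /rdiag !(block_mxKul, block_mxKur, block_mxKdl, block_mxKdr).
  by rewrite !mul0mx addr0 add0r SO3_inv //; exact: Sh.
rewrite (derive1n2_eq oI It actE).
have Lt : linear_continuous_map (@trmx R 3 3) by apply: lcm_mx => s A C; rewrite linearP.
have Lq : linear_continuous_map (mulmxr q : 'M[R]_3 -> 'M[R]_3).
  by apply: lcm_mx => s A C; rewrite linearP.
have gq : class_C 2 I (fun s => g s *m q) by exact: (class_C_lcm Lq oI (smooth_ulsubmx 2%N)).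
have hT : class_C 2 I (fun s => (h s)^T) by exact: (class_C_lcm Lt oI (smooth_drsubmx 2%N)).
have mulB := bilinear_continuous_mulmx R 3 3 3.
have E2 := derive1n2_bcm mulB oI gq hT It.
have gh : class_C 2 I (fun s => g s *m q *m (h s)^T) by exact: (class_C_bcm mulB oI gq hT).
rewrite (derive1n2_lcm (lcm_coord R e.1 e.2) oI gh It) E2.
rewrite (derive1n2_lcm Lq oI (smooth_ulsubmx 2%N) It) (derive1n2_lcm Lt oI (smooth_drsubmx 2%N) It).
have gD := derivableP (class_C_derivable (v := (1 : R)) (smooth_ulsubmx 1%N) It).
have hD := derivableP (class_C_derivable (v := (1 : R)) (smooth_drsubmx 1%N) It).
have -> : derive1 (fun s => g s *m q) t = derive1 g t *m q.
  by rewrite !derive1E; case: (is_derive_lcm Lq gD).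
have -> : derive1 (fun s => (h s)^T) t = (derive1 h t)^T.
  by rewrite !derive1E; case: (is_derive_lcm Lt hD).
move: (derive1n 2 g t) (derive1n 2 h t) @acc => g2 h2 acc.
rewrite g'E h'E /acc !mulmxDr !mulmxDl trmx_mul -(scalemxAr 2) -(scalemxAl 2) /=.
move: (body_velocity g t) (body_velocity h t) => a' b'.
have e1 : g t *m ((g t)^T *m g2 *m q) *m (h t)^T = g2 *m q *m (h t)^T.
  by rewrite !mulmxA gg' mul1mx.
have e3 : g t *m (q *m ((h t)^T *m h2)^T) *m (h t)^T = g t *m q *m h2^T.
  by rewrite trmx_mul trmxK -!mulmxA hh' mulmx1.
by rewrite e1 e3 !mulmxA.
Qed.
End RealCurve.
End RealPart.

(** * Geodesics of SO_3 x SO_3 that are geodesics of O_o(3,3) *)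

Section PartB.
Variables (R : realType) (mu : {measure set (borel 'M[R]_3) -> \bar R}).
Hypothesis vol : volume_measure (@SO3 R) (@rip R) mu.
Local Notation M := (@SO3 R).
Local Notation K := (@SO3xSO3 R).
Local Notation kin := (kinetic (@Oo33 R) M (@rmoebius R) (@rip R) mu).
Local Notation pr := (fun (a : 'I_3 * 'I_3) (q : 'M[R]_3) => q a.1 a.2).
Local Notation lag := (lagrange_form M (@rmoebius R) mu pr (@rvel R)).

(** The symmetric matrices form the orthogonal complement of the skew ones. *)
Lemma rip_hat_sym (N : 'M[R]_3) : (forall l, rip (hat (delta_mx 0 l)) N = 0) -> N^T = N.
Proof.
move=> h; have := (h e0, h e1, h e2); rewrite /rip /mxtrace !sum3 !mxE !sum3 !mxE /=.
case=> [[h0 h1] h2].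
by apply/matrixP; apply: ord3P; apply: ord3P; rewrite mxE //; lra.
Qed.

Variables (I : set R) (c : R -> 'M[R]_(3 + 3)).
Hypothesis Kc : geodesic K kin I c.
Let oI : open I. Proof. by case: Kc => -[]. Qed.
Let iI : is_interval I. Proof. by case: Kc => -[]. Qed.
Let cS : smooth_on I c. Proof. by case: Kc => -[]. Qed.
Let cK s : I s -> K (c s). Proof. by case: Kc => -[_ _ _ h] _; exact: h. Qed.
Let g s := ulsubmx (c s).
Let h s := drsubmx (c s).
Let V0 := let: And3 _ a _ := SO3_volume_facts vol in a.
Let Sg s : I s -> M (g s). Proof. by move=> /cK /K_SO3[]. Qed.
Let Sh s : I s -> M (h s). Proof. by move=> /cK /K_SO3[]. Qed.
Let sg : smooth_on I g. Proof. exact: smooth_ulsubmx. Qed.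
Let sh : smooth_on I h. Proof. exact: smooth_drsubmx. Qed.
Let u s := vee (body_velocity g s).
Let w s := vee (body_velocity h s).

Let conj_hat (x : 'M[R]_3) y : ((2 *: (x^T *m hat y *m x))^T = - (2 *: (x^T *m hat y *m x)))%R.
Proof. by rewrite linearZ /= !trmx_mul trmxK hat_skew mulNmx mulmxN scalerN mulmxA. Qed.

Let cE t : I t -> c t = rdiag (g t) (h t). Proof. by move=> /cK /K_SO3[]. Qed.

(** The differential of the chart at its centre produces vectors translated on the right, while
    [lagrange_K] expects left translates; conjugation by the orthogonal matrix [c t] preserves the
    shape [lie]. *)
Let lie_conj t X B Y : I t ->
  2 *: (lie X B Y *m c t) = c t *m lie (2 *: ((g t)^T *m X *m g t)) (2 *: ((g t)^T *m B *m h t))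
     (2 *: ((h t)^T *m Y *m h t)).
Proof.
move=> It; have [_ gg] := SO3_tr (Sg It); have [_ hh] := SO3_tr (Sh It).
rewrite cE // /lie /rdiag !mulmx_block !mul0mx !mulmx0 !addr0 !add0r scale_block_mx.
rewrite -!(scalemxAr 2) !mulmxA gg hh !mul1mx linearZ /= !trmx_mul trmxK -(scalemxAr 2) !mulmxA hh.
by rewrite mul1mx.
Qed.

(** Directions of the subgroup have [B = 0], so the geodesic equation says that g^T g'' and h^T h''
    are orthogonal to all skew matrices. *)
Lemma K_geodesic_sym t : I t -> let a2 := (g t)^T *m derive1n 2 g t in
  let b2 := (h t)^T *m derive1n 2 h t in a2^T = a2 /\ b2^T = b2.
Proof.
move=> It a2 b2.
have [r r0 [lp D lift]] := k_chart (cK It).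
have [J [x [oJ Jt JI [sx xt] Jx]]] := lift I c oI cS cK t It erefl.
have [_ geo] := Kc.
have := (rgeodesic_eqP vol (@SO3xSO3_sub R) lp oJ sx Jx Jt (cK It)).1
  (fun k => geo _ _ _ lp J x oJ JI sx Jx t k Jt).
rewrite xt => L.
have L' y z : (exists l, delta_mx 0 l = row_mx y z) ->
    rip (2 *: ((g t)^T *m hat y *m g t)) a2 - rip (2 *: ((h t)^T *m hat z *m h t)) b2^T = 0.
  case=> l lE; have := L l; rewrite /partial D lE /k_io row_mxKl row_mxKr.
  have -> : rdiag (hat y) (hat z) = lie (hat y) 0 (hat z) by rewrite /rdiag /lie trmx0.
  rewrite lie_conj // (lagrange_K vol oI cS cK _ It) ?conj_hat //.
  rewrite mulmx0 mul0mx scaler0 mulmx0 mul0mx [(0 : 'M[R]_1) 0 0]mxE mulr0 addr0 => /eqP.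
  by rewrite mulf_eq0 (gt_eqF V0) /= => /eqP.
have sym (x' : 'M[R]_3) (N : 'M[R]_3) : SO3 x' ->
    (forall l, rip (2 *: (x'^T *m hat (delta_mx 0 l) *m x')) N = 0) -> N^T = N.
  move=> Sx hN; have [xx _] := Sx; have [_ xx'] := SO3_tr Sx.
  have : (x' *m N *m x'^T)^T = x' *m N *m x'^T.
    apply: rip_hat_sym => l; have := hN l.
    rewrite ripZl rip_mulr rip_mull trmxK mulmxA => /eqP.
    by rewrite mulf_eq0 pnatr_eq0 /= => /eqP.
  rewrite !trmx_mul trmxK => H.
  have : x'^T *m (x' *m (N^T *m x'^T)) *m x' = x'^T *m (x' *m N *m x'^T) *m x' by rewrite H.
  by rewrite !mulmxA xx !mul1mx -!mulmxA xx !mulmx1.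
have hat0 : hat 0 = 0 :> 'M[R]_3.
  exact: lin0 (@hat_linear R).
split; first apply: (sym (g t)); first exact: Sg.
- move=> l; have := L' (delta_mx 0 l) 0.
  rewrite hat0 mulmx0 mul0mx scaler0 {2}/rip trmx0 mul0mx mxtrace0 subr0; apply.
  by exists (lshift 3 l); rewrite delta_mx_lshift.
- suff : (b2^T)^T = b2^T by rewrite trmxK.
  apply: (sym (h t)); first exact: Sh.
  move=> l; have := L' 0 (delta_mx 0 l).
  rewrite hat0 mulmx0 mul0mx scaler0 {1}/rip trmx0 mul0mx mxtrace0 sub0r => H.
  apply/eqP; rewrite -oppr_eq0; apply/eqP; apply: H.
  by exists (rshift 3 l); rewrite delta_mx_rshift.
Qed.


Let mulB := bilinear_continuous_mulmx R 3 3 3.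
Let Lt : linear_continuous_map (@trmx R 3 3).
Proof. by apply: lcm_mx => s A B; rewrite linearP. Qed.

(* The derivative of the body velocity is skew, like the body velocity itself, and symmetric. *)
Lemma body_velocity_cst (f : R -> 'M[R]_3) : smooth_on I f -> (forall s, I s -> M (f s)) ->
  (forall t, I t -> ((f t)^T *m derive1n 2 f t)^T = (f t)^T *m derive1n 2 f t) ->
  forall s t, I s -> I t -> body_velocity f s = body_velocity f t.
Proof.
move=> sf Sf symf; apply: derive0_cst => // t It.
have [_ _ aD] := body_velocityP oI sf Sf It.
set D := _ + _ in aD.
have Ds : D^T = D by rewrite /D linearD /= trmx_mul trmxK symf.
have Dn : D^T = - D.
  case: (is_derive_lcm Lt aD) => _ <-; case: (is_deriveN aD) => _ <-.
  apply: near_eq_derive; apply: filterS (open_nbhs_nbhs (conj oI It)) => s Is.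
  by have [h1 _ _] := body_velocityP oI sf Sf Is.
suff D0 : D = 0 by rewrite -D0.
move: Dn; rewrite Ds => /eqP; rewrite -addr_eq0 -mulr2n -scaler_nat scaler_eq0 pnatr_eq0 /=.
by move/eqP.
Qed.

Lemma body_velocity0_cst (f : R -> 'M[R]_3) : smooth_on I f -> (forall s, I s -> M (f s)) ->
  (forall t, I t -> body_velocity f t = 0) -> forall s t, I s -> I t -> f s = f t.
Proof.
move=> sf Sf f0; apply: derive0_cst => // t It.
have [_ f'E _] := body_velocityP oI sf Sf It.
have := derivableP (class_C_derivable (v := (1 : R)) (sf 1%N) It).
by rewrite -derive1E f'E f0 // mulmx0.
Qed.

Lemma cst_body_velocity0 (f : R -> 'M[R]_3) x : (forall t, I t -> f t = x) ->
  forall t, I t -> body_velocity f t = 0.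
Proof.
move=> fx t It; rewrite /body_velocity derive1E.
rewrite (near_eq_derive (g := fun=> x)) ?derive_cst ?mulmx0 //.
by apply: filterS (open_nbhs_nbhs (conj oI It)) => s; exact: fx.
Qed.

(** Tested on the matrix units in the block [B], the geodesic equation makes every product of an
    entry of u g^T with an entry of h w^T vanish; hence one of these vectors is zero, and [g], [h]
    are invertible. *)
Lemma geodesic_Oo33_velocity t : geodesic (@Oo33 R) kin I c -> I t -> u t = 0 \/ w t = 0.
Proof.
move=> [_ geo] It; have Gc s : I s -> Oo33 (c s) by move=> /cK /SO3xSO3_sub.
have [r r0 [lp D lift]] := g_chart (Gc t It).
have [J [x [oJ Jt JI [sx xt] Jx]]] := lift I c oI cS Gc t It erefl.
have := (rgeodesic_eqP vol (fun _ h => h) lp oJ sx Jx Jt (cK It)).1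
  (fun k => geo _ _ _ lp J x oJ JI sx Jx t k Jt).
rewrite xt => L.
have hat0 : hat 0 = 0 :> 'M[R]_3.
  exact: lin0 (@hat_linear R).
have uw k l : (u t *m (g t)^T) 0 k * (h t *m (w t)^T) l 0 = 0.
  (* The number, among the 15 coordinates of the chart, of the entry (k, l) of the block [B]. *)
  have := L (lshift 3 (rshift 3 (mxvec_index k l))); rewrite /partial D.
  rewrite delta_mx_lshift delta_mx_rshift /g_io !row_mxKl !row_mxKr hat0 vec_mx_delta.
  rewrite lie_conj // !mulmx0 !mul0mx !scaler0 (lagrange_K vol oI cS cK _ It) ?trmx0 ?oppr0 //.
  rewrite /rip trmx0 !mul0mx mxtrace0 subr0 add0r => /eqP.
  rewrite mulf_eq0 (gt_eqF V0) /= mulf_eq0 mulf_eq0 invr_eq0 !pnatr_eq0 /=.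
  rewrite -(scalemxAr 2) -(scalemxAl 2) [X in X == _]mxE mulf_eq0 pnatr_eq0 /= => /eqP H.
  rewrite -[RHS]H -/(u t) -/(w t) !mulmxA -(mulmxA _ (h t)).
  rewrite [RHS]mxE (bigD1 l) //= big1 => [|m ml].
    rewrite addr0; congr (_ * _).
    by rewrite [RHS]mxE (bigD1 k) //= big1 => [|m mk]; rewrite [delta_mx _ _ _ _]mxE ?eqxx ?(negbTE mk) ?mulr0 ?addr0 ?mulr1.
  rewrite [X in X * _]mxE big1 ?mul0r // => m' _.
  by rewrite [delta_mx _ _ _ _]mxE (negbTE ml) andbF mulr0.
have [gg _] := Sg It; have [hh _] := Sh It.
have [[k ku]|nk] := pselect (exists k, (u t *m (g t)^T) 0 k != 0).
  right; apply: trmx_inj; rewrite trmx0 -[LHS]mul1mx -hh -mulmxA.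
  have -> : h t *m (w t)^T = 0.
    apply/matrixP => l j; rewrite ord1 [RHS]mxE; apply/eqP; have /eqP := uw k l.
    by rewrite mulf_eq0 (negbTE ku).
  by rewrite mulmx0.
left; rewrite -[LHS]mulmx1 -gg mulmxA.
have -> : u t *m (g t)^T = 0.
  apply/rowP => k; rewrite [RHS]mxE; apply: contrapT => /eqP k0; apply: nk.
  by exists k.
by rewrite mul0mx.
Qed.

(** Body velocities of a geodesic of the subgroup are constant, so if one vanishes at a single time,
    its factor does not move. Conversely, for a tangent vector [lie X1 B X2] met in an arbitrary
    chart, [X1] and [X2] pair with symmetric matrices and [B] is multiplied by a zero velocity. *)
Lemma geodesic_Oo33_iff : geodesic (@Oo33 R) kin I c <->
  (exists2 h : 'M[R]_3, SO3 h & c @` I `<=` [set rdiag g h | g in @SO3 R]) \/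
  (exists2 g : 'M[R]_3, SO3 g & c @` I `<=` [set rdiag g h | h in @SO3 R]).
Proof.
have sym := K_geodesic_sym.
have va s t (Is : I s) (It : I t) := body_velocity_cst sg Sg (fun t It => (sym t It).1) Is It.
have vb s t (Is : I s) (It : I t) := body_velocity_cst sh Sh (fun t It => (sym t It).2) Is It.
have vee0 (N : 'M[R]_3) : N^T = - N -> vee N = 0 -> N = 0.
  move=> Ns N0; rewrite -(veeK Ns) N0.
  exact: lin0 (@hat_linear R).
split=> [geo|H].
  have [[t0 It0]|I0] := pselect (exists t, I t); last first.
    (* On the empty interval the inclusion is vacuous, whatever the rotation. *)
    left; exists 1%:M; first exact: SO3_1.
    by move=> ? [t It _]; case: I0; exists t.
  have [ag _ _] := body_velocityP oI sg Sg It0.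
  have [ah _ _] := body_velocityP oI sh Sh It0.
  case: (geodesic_Oo33_velocity geo It0) => [/(vee0 _ ag)|/(vee0 _ ah)] a0.
    right; exists (g t0); first exact: Sg.
    move=> _ [t It <-]; exists (h t); first exact: Sh.
    rewrite [RHS]cE // (@body_velocity0_cst g sg Sg _ t0 t) // => s Is.
    by rewrite (va s t0).
  left; exists (h t0); first exact: Sh.
  move=> _ [t It <-]; exists (g t); first exact: Sg.
  rewrite [RHS]cE // (@body_velocity0_cst h sh Sh _ t0 t) // => s Is.
  by rewrite (vb s t0).
have uw t : I t -> u t = 0 \/ w t = 0.
  have veez : vee 0 = 0 :> 'rV[R]_3.
    by apply/rowP; apply: ord3P; rewrite !mxE /= ?mxE.
  move=> It; case: H => -[x Sx cx]; [right|left]; rewrite -veez; congr vee.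
    apply: (@cst_body_velocity0 h x) => // s Is.
    have : (c @` I) (c s) by exists s.
    by move/cx => [y _ cy]; rewrite /h -cy /rdiag block_mxKdr.
  apply: (@cst_body_velocity0 g x) => // s Is.
  have : (c @` I) (c s) by exists s.
  by move/cx => [y _ cy]; rewrite /g -cy /rdiag block_mxKul.
split; first by split=> // t /cK /SO3xSO3_sub.
move=> d U psi lp J x oJ JI sx Jx t k Jt.
have It := JI t Jt.
move: k; apply: (rgeodesic_eqP vol (fun _ h => h) lp oJ sx Jx Jt (cK It)).2 => l.
have [Ut cx] := Jx t Jt.
have tX := tangent_param (fun _ h => h) lp (delta_mx 0 l) Ut.
rewrite -cx in tX.
have [X1 [B [X2 [XE s1 s2]]]] := tangent_Oo33 (cK It) tX.
rewrite /partial XE (lagrange_K vol oI cS cK _ It) //.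
have skewsym (X N : 'M[R]_3) : X^T = - X -> N^T = N -> rip X N = 0.
  move=> Xs Ns; have : rip X N = - rip X N.
    rewrite {1}/rip -mxtrace_tr trmx_mul trmxK Ns mxtrace_mulC -[X in X *m _]opprK -Xs.
    by rewrite mulNmx linearN.
  by move/eqP; rewrite -addr_eq0 -mulr2n -mulr_natr mulf_eq0 pnatr_eq0 orbF => /eqP.
have [sa sb] := sym t It.
have E1 := skewsym X1 _ s1 sa.
have E2 : rip X2 ((h t)^T *m derive1n 2 h t)^T = 0 by apply: (skewsym X2) => //; rewrite sb.
have E3 : (u t *m B *m (w t)^T) 0 0 = 0.
  by case: (uw t It) => ->; rewrite ?trmx0 ?mulmx0 ?mul0mx mxE.
apply: etrans (f_equal2 *%R erefl (f_equal2 +%R (f_equal2 +%R E1 (f_equal -%R E2)) (f_equal2 *%R erefl E3))) _.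
by rewrite mulr0 subr0 addr0 mulr0.
Qed.
End PartB.

(** * Quaternions *)

Section Quaternion.
Variable R : realType.
Definition qc (a : 'I_4) (x : quat R) : R := nth 0 [:: q0 x; q1 x; q2 x; q3 x] a.
Definition qof (v : 'rV[R]_4) : quat R :=
  Quat (v 0 0) (v 0 1) (v 0 (inord 2)) (v 0 (inord 3)).
(* The quaternions 1, i, j, k. *)
Definition qe (a : 'I_4) : quat R := qof (delta_mx 0 a).

Lemma sum4 (V : nmodType) (F : 'I_4 -> V) :
  \sum_i F i = F 0 + F 1 + F (inord 2) + F (inord 3).
Proof.
rewrite !big_ord_recl big_ord0 addr0 !addrA; congr (_ + F _ + F _ + F _);
  by apply: val_inj; rewrite /= ?inordK.
Qed.

Lemma ord4P (P : 'I_4 -> Prop) : P 0 -> P 1 -> P (inord 2) -> P (inord 3) -> forall i, P i.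
Proof.
move=> P0 P1 P2 P3 [[|[|[|[|//]]]] h].
- by rewrite (_ : Ordinal h = 0) //; exact: val_inj.
- by rewrite (_ : Ordinal h = 1) //; exact: val_inj.
- by rewrite (_ : Ordinal h = inord 2) //; apply: val_inj; rewrite /= inordK.
- by rewrite (_ : Ordinal h = inord 3) //; apply: val_inj; rewrite /= inordK.
Qed.

Lemma qcE (x : quat R) : [/\ qc 0 x = q0 x, qc 1 x = q1 x, qc (inord 2) x = q2 x & qc (inord 3) x = q3 x].
Proof. by rewrite /qc !inordK. Qed.

Lemma qcP (x y : quat R) : (forall a, qc a x = qc a y) -> x = y.
Proof.
move=> h; have [a0 a1 a2 a3] := qcE x; have [b0 b1 b2 b3] := qcE y.
by apply: quatP; [rewrite -a0 -b0|rewrite -a1 -b1|rewrite -a2 -b2|rewrite -a3 -b3].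
Qed.

Lemma qc_linear a : linear (qc a : quat R -> R^o).
Proof.
move: a; apply: ord4P => s x y.
- by have [-> _ _ _] := qcE x; have [-> _ _ _] := qcE y; have [-> _ _ _] := qcE (s *: x + y).
- by have [_ -> _ _] := qcE x; have [_ -> _ _] := qcE y; have [_ -> _ _] := qcE (s *: x + y).
- by have [_ _ -> _] := qcE x; have [_ _ -> _] := qcE y; have [_ _ -> _] := qcE (s *: x + y).
- by have [_ _ _ ->] := qcE x; have [_ _ _ ->] := qcE y; have [_ _ _ ->] := qcE (s *: x + y).
Qed.

Lemma qc_qof a v : qc a (qof v) = v 0 a.
Proof. by move: a; apply: ord4P; have [h0 h1 h2 h3] := qcE (qof v); rewrite ?h0 ?h1 ?h2 ?h3. Qed.

Lemma qof_linear : linear qof.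
Proof. by move=> s v w; apply: qcP => a; rewrite (qc_linear a) !qc_qof !mxE. Qed.

Lemma qc_sum a (I : Type) (r : seq I) (F : I -> quat R) :
  qc a (\sum_(i <- r) F i) = \sum_(i <- r) qc a (F i).
Proof.
by apply: (big_morph (qc a)); [exact: linD (qc_linear a)|exact: lin0 (qc_linear a)].
Qed.

Lemma quat_sum (x : quat R) : x = \sum_a qc a x *: qe a.
Proof.
apply: qcP => b; rewrite qc_sum (bigD1 b) //= big1 => [|a ab]; rewrite (linZ (qc_linear b)) qc_qof mxE.
  by rewrite !eqxx addr0 /GRing.scale /= mulr1.
by rewrite eq_sym (negbTE ab) andbF scaler0.
Qed.

Lemma ler_qc a (x : quat R) : `|qc a x| <= `|x|.
Proof.
rewrite -[`|x|]/(Num.sqrt (sqnormq x)) -sqrtr_sqr ler_sqrt ?sqnormq_ge0 // /sqnormq.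
have [h0 h1 h2 h3] := qcE x.
have p0 := sqr_ge0 (q0 x); have p1 := sqr_ge0 (q1 x); have p2 := sqr_ge0 (q2 x); have p3 := sqr_ge0 (q3 x).
by move: a; apply: ord4P; rewrite ?h0 ?h1 ?h2 ?h3; lra.
Qed.

Lemma lcm_bounded (V W : normedModType R) (L : V -> W) k :
  linear L -> (forall x : V, `|L x| <= k * `|x|) -> linear_continuous_map L.
Proof.
move=> Ll Lk; split=> // x; apply/cvgrPdist_le => e e0.
have k0 : 0 < `|k| + 1 by rewrite ltr_wpDl.
near=> y; have -> : L x - L y = L (x - y).
  by rewrite addrC -scaleN1r -Ll scaleN1r addrC.
apply: le_trans (Lk _) _; apply: (@le_trans _ _ ((`|k| + 1) * `|x - y|)).
  by apply: ler_wpM2r => //; apply: le_trans (ler_norm k) _; rewrite lerDl.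
rewrite mulrC -ler_pdivlMr //.
by near: y; apply: cvgr_dist_le; [exact: cvg_id|rewrite divr_gt0].
Unshelve. all: by end_near. Qed.

Lemma lcm_qc a : linear_continuous_map (qc a : quat R -> R).
Proof. by apply: (@lcm_bounded _ _ _ 1) => [|x]; [exact: qc_linear|rewrite mul1r ler_qc]. Qed.

Lemma lcm_quat (W : normedModType R) (L : quat R -> W) : linear L -> linear_continuous_map L.
Proof.
move=> Ll; split=> // x.
have LE : L = fun y => \sum_a qc a y *: L (qe a).
  apply/funext => y; rewrite {1}[y]quat_sum (big_morph L (linD Ll) (lin0 Ll)).
  by apply: eq_bigr => a _; rewrite (linZ Ll).
have : class_C 0 setT (fun y : quat R => \sum_a qc a y *: L (qe a)).
  apply: (class_C_sum _ openT) => a _.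
  by apply: (class_C_bcm (bilinear_continuous_scaler W) openT _ (class_C_cst _ _ _));
    apply: class_C_lin; exact: lcm_qc.
by rewrite -LE => /class_C_cont; apply.
Qed.

(** Expanding the left factor in the basis reduces the product to a sum of scalings of the linear
    maps [y |-> qe a * y]. *)
Lemma bilinear_continuous_mulq : bilinear_continuous_map (fun x y : quat R => x * y).
Proof.
have l1 (x : quat R) : linear (fun y => x * y).
  by move=> s y z; apply: quatP => /=; ring.
have l2 (y : quat R) : linear (fun x : quat R => x * y).
  by move=> s x z; apply: quatP => /=; ring.
split=> // -[x y].
have E u v : u * v = \sum_a qc a u *: (qe a * v).
  have -> : u * v = \sum_a (qc a u *: qe a) * v by rewrite -mulr_suml -quat_sum.
  by apply: eq_bigr => a _; have := l2 v (qc a u) (qe a) 0; rewrite mul0r !addr0.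
have EE : (fun z : quat R * quat R => z.1 * z.2) = fun z => \sum_a qc a z.1 *: (qe a * z.2).
  by apply/funext => z; rewrite E.
have : class_C 0 setT (fun z : quat R * quat R => \sum_a qc a z.1 *: (qe a * z.2)).
  apply: (class_C_sum _ openT) => a _.
  apply: (class_C_bcm (bilinear_continuous_scaler _) openT).
    by apply: class_C_lin; exact: lcm_comp (lcm_qc a) (lcm_fst _ _).
  by apply: class_C_lin; exact: lcm_comp (lcm_quat (l1 (qe a))) (lcm_snd _ _).
by rewrite -EE => /class_C_cont; apply.
Qed.

Lemma scaleqAl s (x y : quat R) : (s *: x) * y = s *: (x * y).
Proof. by apply: quatP => /=; ring. Qed.
Lemma scaleqAr s (x y : quat R) : x * (s *: y) = s *: (x * y).
Proof. by apply: quatP => /=; ring. Qed.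

(* Left multiplication as a matrix acting on columns; inverses, Cayley transforms and charts of
   quaternions are obtained from those of matrices through this embedding. *)
Definition qmx (x : quat R) : 'M[R]_4 := \matrix_(i, j) qc i (x * qe j).
(** The first column of [qmx x] holds the coordinates of [x * 1], so reading it recovers [x]. *)
Definition unqmx (A : 'M[R]_4) : quat R := qof (\row_i A i 0).

Lemma qmx_linear : linear qmx.
Proof. by move=> s x y; apply/matrixP => i j; rewrite !mxE mulrDl scaleqAl (qc_linear i). Qed.

Lemma unqmx_linear : linear unqmx.
Proof. by move=> s A B; rewrite /unqmx -qof_linear; congr qof; apply/rowP => i; rewrite !mxE. Qed.

Lemma qmxK : cancel qmx unqmx.
Proof.
move=> x; apply: qcP => a; rewrite qc_qof !mxE; congr qc.
rewrite (_ : qe 0 = 1) ?mulr1 //; apply: quatP; rewrite /= !mxE //=.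
- by rewrite -val_eqE /= inordK.
- by rewrite -val_eqE /= inordK.
Qed.

Lemma qmxM x y : qmx (x * y) = qmx x *m qmx y.
Proof.
apply/matrixP => i j; rewrite !mxE -mulrA [y * _]quat_sum mulr_sumr qc_sum.
apply: eq_bigr => k _; rewrite scaleqAr !mxE.
by rewrite (linZ (qc_linear i)) /GRing.scale /= mulrC.
Qed.

Lemma qmx1 : qmx 1 = 1%:M.
Proof. by apply/matrixP => i j; rewrite !mxE mul1r qc_qof mxE eqxx. Qed.

Lemma qmxD x y : qmx (x + y) = qmx x + qmx y. Proof. exact: linD qmx_linear _ _. Qed.
Lemma qmxN x : qmx (- x) = - qmx x. Proof. exact: linN qmx_linear _. Qed.
Lemma qmx0 : qmx 0 = 0. Proof. exact: lin0 qmx_linear. Qed.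

Lemma qmx_inv x : x != 0 -> qmx x \in unitmx /\ invmx (qmx x) = qmx x^-1.
Proof.
move=> x0; have xx : qmx x *m qmx x^-1 = 1%:M by rewrite -qmxM divrr ?qmx1.
have [u _] := mulmx1_unit xx; split=> //.
by apply: (can_inj (mulKmx u)); rewrite mulmxV.
Qed.

Lemma class_C_mulq (V : normedModType R) k (U : set V) (f g : V -> quat R) : open U ->
  class_C k U f -> class_C k U g -> class_C k U (fun z : V => f z * g z).
Proof. by move=> oU; exact: (class_C_bcm bilinear_continuous_mulq). Qed.

Lemma class_C_invq (V : normedModType R) k (U : set V) (f : V -> quat R) : open U ->
  (forall z : V, U z -> f z != 0) -> class_C k U f -> class_C k U (fun z : V => (f z)^-1).
Proof.
move=> oU f0 fC.
apply: (class_C_eq (f := fun z => unqmx (invmx (qmx (f z)))) oU).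
  by move=> z Uz; have [_ ->] := qmx_inv (f0 z Uz); rewrite qmxK.
apply: (class_C_lcm (lcm_mx unqmx_linear) oU); apply: (class_C_invmx oU).
  by move=> z /f0 /qmx_inv[].
exact: (class_C_lcm (lcm_quat qmx_linear) oU).
Qed.

Lemma is_derive_invq (f : R -> quat R) (t : R) df : is_derive t (1 : R) f df -> f t != 0 ->
  is_derive t (1 : R) (fun s => (f s)^-1) (- ((f t)^-1 * df * (f t)^-1)).
Proof.
move=> fD f0; have [u iE] := qmx_inv f0.
have D := is_derive_invmx (is_derive_lcm (lcm_quat qmx_linear) fD) u.
have [d1 d2] := is_derive_lcm (lcm_mx unqmx_linear) D.
have E : \forall s \near t, unqmx (invmx (qmx (f s))) = (f s)^-1.
  have cf : {for t, continuous f}.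
    by apply: differentiable_continuous; apply/derivable1_diffP; case: fD.
  have : \forall s \near t, f s != 0 by exact: cvgr_neq0 cf f0.
  apply: filterS => s s0; by have [_ ->] := qmx_inv s0; rewrite qmxK.
split.
  by apply: near_eq_derivable E d1.
transitivity ('D_1 (fun s : R => unqmx (invmx (qmx (f s)))) t).
  by apply/esym; exact: near_eq_derive.
apply: etrans d2 _.
by rewrite /= iE (linN unqmx_linear) -!qmxM qmxK.
Qed.

Lemma sqnormqM (x y : quat R) : sqnormq (x * y) = sqnormq x * sqnormq y.
Proof. by case: x y => [a b c d] [e f g h]; rewrite /sqnormq /=; ring. Qed.

Lemma sqnormqV (x : quat R) : x != 0 -> sqnormq x^-1 = (sqnormq x)^-1.
Proof.
move=> x0; have n0 : sqnormq x != 0 by apply: contra_neq x0 => /sqnormq_eq0.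
apply: (mulfI n0); rewrite -sqnormqM divrr // divff // /sqnormq /=.
by rewrite expr1n !expr0n /= !addr0.
Qed.

Lemma conjqM (x y : quat R) : conjq (x * y) = conjq y * conjq x.
Proof. by apply: quatP => /=; ring. Qed.

Lemma conjq_linear : linear (@conjq R).
Proof. by move=> s x y; apply: quatP => /=; ring. Qed.

Lemma conjqK : involutive (@conjq R).
Proof. by case=> a b c d; rewrite /conjq /= !opprK. Qed.

Lemma mulq_conj (x : quat R) : conjq x * x = sqnormq x *: (1 : quat R) /\
  x * conjq x = sqnormq x *: (1 : quat R).
Proof. by split; apply: quatP; rewrite /sqnormq /=; ring. Qed.

Lemma Sp1P (q : quat R) : Sp1 q <-> sqnormq q = 1.
Proof.
rewrite /Sp1 /=; have [-> _] := mulq_conj q; split=> [/(congr1 (@q0 R)) /=|->].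
  by rewrite mulr1.
by rewrite scale1r.
Qed.

Lemma Sp1_conj (q : quat R) : Sp1 q -> [/\ Sp1 (conjq q), q * conjq q = 1, q != 0 & q^-1 = conjq q].
Proof.
move=> /Sp1P q1; have [h1 h2] := mulq_conj q.
rewrite q1 scale1r in h1; rewrite q1 scale1r in h2.
have q0 : q != 0 by apply: contraTneq (oner_neq0 (quat R)) => q0; rewrite -h2 q0 mul0r eqxx.
split=> //; first by rewrite /Sp1 /= conjqK.
by rewrite -[LHS]mulr1 -h2 mulKr.
Qed.

Lemma Sp1_mul (p q : quat R) : Sp1 p -> Sp1 q -> Sp1 (p * q).
Proof. by move=> /Sp1P h1 /Sp1P h2; apply/Sp1P; rewrite sqnormqM h1 h2 mulr1. Qed.

Lemma Sp1_1 : Sp1 (1 : quat R).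
Proof. by apply/Sp1P; rewrite /sqnormq /= expr1n !expr0n /= !addr0. Qed.

Lemma Sp1_compact : compact (@Sp1 R).
Proof.
pose A : set 'rV[R]_4 := qof @^-1` (@Sp1 R).
have qofc : linear_continuous_map qof by apply: lcm_mx; exact: qof_linear.
have -> : @Sp1 R = qof @` A.
  apply/seteqP; split=> [x Sx|_ [v Av <-] //].
  have xE : qof (\row_a qc a x) = x by apply: qcP => a; rewrite qc_qof mxE.
  by exists (\row_a qc a x) => //; rewrite /A /= xE.
apply: continuous_compact; first by apply: continuous_subspaceT; exact: qofc.2.
have AE : A = (fun v : 'rV[R]_4 => \sum_a v 0 a ^+ 2) @^-1` [set (1 : R)].
  by apply/seteqP; split=> v; rewrite /A /= sum4; [move/Sp1P|move=> h; apply/Sp1P].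
apply: bounded_closed_compact.
  exists 1; split; first exact: num_real.
  move=> x x1 v; rewrite AE /= => v1; apply: le_trans (ltW x1).
  apply: ler_mx_norm => // i j; rewrite ord1.
  rewrite -sqrtr_sqr -[leRHS]sqrtr1 ler_sqrt // -v1 (bigD1 j) //= lerDl.
  by apply: sumr_ge0 => k _; exact: sqr_ge0.
rewrite AE; apply: preimage_closed; last first.
  exact: accessible_closed_set1 (hausdorff_accessible (@norm_hausdorff _ _)) _.
move=> v _; have : class_C 0 setT (fun v : 'rV[R]_4 => \sum_a v 0 a ^+ 2).
  apply: (class_C_sum _ openT) => a _; rewrite (_ : (fun v : 'rV[R]_4 => _) = fun v => v 0 a * v 0 a).
    by apply: class_CM openT _ _; apply: class_C_coord openT (class_C_id _ _).
  by apply/funext => u; rewrite expr2.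
by case=> /(_ v I).
Qed.
End Quaternion.

(** * The group Sp_1 *)

(** [L] identifies [S] with its image. On the image of [psi], [L \o L'] is the identity, so
    derivatives of [psi] are recovered from those of [L' \o psi], and open sets are pulled back by
    [L]. *)
Lemma local_param_transfer (R : realType) (E E' : normedModType R) (L : E -> E') (L' : E' -> E)
    (S : set E) d (U : set 'rV[R]_d) (psi : 'rV[R]_d -> E') :
  linear_continuous_map L -> linear_continuous_map L' -> cancel L L' ->
  local_param (L @` S) U psi -> local_param S U (fun y => L' (psi y)).
Proof.
move=> lL lL' LK psiP; have [oU sU iU dU imU] := psiP.
have LK' y : U y -> L (L' (psi y)) = psi y.
  by move=> Uy; have [x _ <-] := local_param_image psiP Uy; rewrite LK.
split=> //.
- by move=> k; exact: class_C_lcm.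
- move=> x y /set_mem Ux /set_mem Uy h; apply: iU; rewrite ?inE //.
  by rewrite -(LK' x Ux) h LK'.
- move=> x v Ux D0; apply: dU (Ux) _.
  have [_ DL'] := is_derive_lcm lL' (derivableP (class_C_derivable (v := v) (sU 1%N) Ux)).
  have [_ E2] := is_derive_lcm (lcm_comp lL lL') (derivableP (class_C_derivable (v := v) (sU 1%N) Ux)).
  transitivity ('D_v ((L \o L') \o psi) x).
    apply: near_eq_derive; apply: filterS (open_nbhs_nbhs (conj oU Ux)) => y Uy.
    by rewrite /= LK'.
  by rewrite E2 /= -DL' /comp D0 (lcm0 lL).
- move=> U' oU' U'U; have [W oW WE] := imU U' oU' U'U.
  exists (L @^-1` W); first by apply: open_comp => // x _; exact: lL.2.
  apply/seteqP; split=> [_ [y U'y <-]|x [Sx Wx]].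
    have : (psi @` U') (psi y) by exists y.
    rewrite WE => -[[x Sx xE] Wy]; split; first by rewrite -xE LK.
    by rewrite /preimage /= LK' //; exact: U'U.
  have : (psi @` U') (L x) by rewrite WE; split=> //; exists x.
  by case=> y U'y yE; exists y => //; rewrite yE LK.
Qed.

(** Quaternionic objects are embedded into real matrices by [L], charted there by the Cayley
    transform and brought back by [L']. *)
Lemma embedded_cayley_chart (R : realType) (E : normedModType R) n d
    (L : E -> 'M[R]_n) (L' : 'M[R]_n -> E) (io : 'rV[R]_d -> 'M[R]_n) (ka : 'M[R]_n -> 'rV[R]_d)
    (S : set E) (p : E) :
  linear_continuous_map L -> linear L' -> cancel L L' -> linear io -> linear ka -> cancel io ka ->
  L p \in unitmx ->
  (forall y, 1%:M - io y \in unitmx -> (L @` S) (cayley (io y) *m L p)) ->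
  (forall q, S q -> L q *m invmx (L p) + 1%:M \in unitmx ->
    io (ka (inv_cayley (L q *m invmx (L p)))) = inv_cayley (L q *m invmx (L p))) ->
  exists2 r : R, 0 < r & [/\ local_param S (rball r) (fun y => L' (cayley_param io (L p) y)),
  L' (cayley_param io (L p) 0) = p,
  forall v, 'D_v (fun y => L' (cayley_param io (L p) y)) 0 = 2 *: L' (io v *m L p) &
  forall (I : set R) (c : R -> E), open I -> smooth_on I c -> (forall s, I s -> S (c s)) ->
    forall t, I t -> c t = p -> exists J (x : R -> 'rV[R]_d),
      [/\ open J, J t, J `<=` I, smooth_on J x /\ x t = 0 &
          forall s, J s -> rball r (x s) /\ c s = L' (cayley_param io (L p) (x s))]].
Proof.
move=> lL lL' LK lio lka iok up cayS Scay.
have lcL' := lcm_mx lL'.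
have [||r r0 [lp D lift]] := @cayley_chart R n d io ka (L @` S) (L p) lio lka iok up.
- exists 1 => // y _ /(_ 1); rewrite ler01 lexx scale1r => /(_ isT); exact: cayS.
- by move=> _ [q Sq <-]; exact: Scay.
have U0 : rball r (0 : 'rV[R]_d) by rewrite /rball /= normr0.
exists r => //; split.
- exact: (local_param_transfer lL lcL' LK lp).
- by rewrite cayley_param0 ?LK.
- move=> v; have [oU sU _ _ _] := lp.
  have [_] := is_derive_lcm lcL' (derivableP (class_C_derivable (v := v) (sU 1%N) U0)).
  by rewrite D (lcmZ lcL').
- move=> I c oI cC cS t It ct.
  have LcS s : I s -> (L @` S) (L (c s)) by move=> /cS; exists (c s).
  have LcC : smooth_on I (fun s => L (c s)) by move=> k; exact: (class_C_lcm lL oI (cC k)).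
  have [J [x [oJ Jt JI sx Jx]]] := lift I (fun s => L (c s)) oI LcC LcS t It (congr1 L ct).
  by exists J, x; split=> // s Js; have [h1 h2] := Jx s Js; rewrite -h2 LK.
Qed.

Section Sp1Charts.
Variable R : realType.
Local Notation M := (@Sp1 R).

Definition qim (y : 'rV[R]_3) : quat R := Quat 0 (y 0 e0) (y 0 e1) (y 0 e2).
Definition qimv (x : quat R) : 'rV[R]_3 := \row_i nth 0 [:: q1 x; q2 x; q3 x] i.

Lemma qim_linear : linear qim.
Proof. by move=> s x y; apply: quatP; rewrite /= ?mxE //; ring. Qed.

Lemma qimv_linear : linear qimv.
Proof. by move=> s x y; apply/rowP; apply: ord3P; rewrite !mxE. Qed.

Lemma qimK : cancel qim qimv.
Proof. by move=> y; apply/rowP; apply: ord3P; rewrite !mxE. Qed.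

Lemma qimvK x : q0 x = 0 -> qim (qimv x) = x.
Proof. by move=> x0; apply: quatP; rewrite /= ?mxE. Qed.

Lemma q0_conj (x : quat R) : conjq x = - x <-> q0 x = 0.
Proof.
split=> [/(congr1 (@q0 R)) /= /eqP|x0].
  by rewrite -addr_eq0 -mulr2n mulrn_eq0 => /eqP.
by apply: quatP; rewrite //= x0 oppr0.
Qed.

Lemma qmx_unit x : (@qmx R x \in unitmx) = (x != 0).
Proof.
apply/idP/idP => [u|/qmx_inv[]//]; apply: contraTneq u => ->.
by rewrite qmx0 unitmxE det0 unitr0.
Qed.

Lemma qmx_cayley (x : quat R) : 1 - x != 0 -> cayley (qmx x) = qmx ((1 - x)^-1 * (1 + x)).
Proof. by move=> x1; rewrite /cayley -qmx1 -qmxN -!qmxD qmxM; have [_ ->] := qmx_inv x1. Qed.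

Lemma qmx_inv_cayley (x : quat R) : x + 1 != 0 ->
  inv_cayley (qmx x) = qmx ((x - 1) * (x + 1)^-1).
Proof. by move=> x1; rewrite /inv_cayley -qmx1 -qmxN -!qmxD qmxM; have [_ ->] := qmx_inv x1. Qed.

(** For imaginary [x], [1 - x] and [1 + x] are conjugate to each other, hence of equal norm. *)
Lemma cayley_Sp1 y : Sp1 ((1 - qim y)^-1 * (1 + qim y)).
Proof.
have n0 : sqnormq (1 - qim y) = sqnormq (1 + qim y) by rewrite /sqnormq /=; ring.
have n1 : 0 < sqnormq (1 + qim y).
  rewrite /sqnormq /= addr0 expr1n.
  have := sqr_ge0 (0 + y 0 e0); have := sqr_ge0 (0 + y 0 e1); have := sqr_ge0 (0 + y 0 e2).
  by move: (_ ^+ 2) (_ ^+ 2) (_ ^+ 2) => a b c; lra.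
have u : 1 - qim y != 0.
  by apply: contraTneq n1 => h; rewrite -n0 h /sqnormq /= !expr0n /= !addr0 ltxx.
by apply/Sp1P; rewrite sqnormqM sqnormqV // n0 mulVf // gt_eqF.
Qed.

Lemma qimB_neq0 y : 1 - qim y != 0.
Proof. by apply/eqP => /(congr1 (@q0 R)) /= /eqP; rewrite subr0 oner_eq0. Qed.

(** The real part of (x - 1) (x + 1)^-1 is (|x|^2 - 1) / |x + 1|^2. *)
Lemma inv_cayley_Sp1 (x : quat R) : Sp1 x -> x + 1 != 0 -> q0 ((x - 1) * (x + 1)^-1) = 0.
Proof.
move=> /Sp1P x1 u; rewrite -[(x + 1)^-1]/(scaleq _ _) scaleqAr /=.
apply/eqP; rewrite mulf_eq0; apply/orP; right; apply/eqP.
by transitivity (sqnormq x - 1); [rewrite /sqnormq; ring|rewrite x1 subrr].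
Qed.

Lemma Sp1_unit p : M p -> qmx p \in unitmx.
Proof. by move=> /Sp1_conj[_ _ p0 _]; rewrite qmx_unit. Qed.

Lemma Sp1_chart p : M p -> exists2 r : R, 0 < r & [/\
  local_param M (rball r) (fun y => unqmx (cayley_param (fun y => qmx (qim y)) (qmx p) y)),
  unqmx (cayley_param (fun y => qmx (qim y)) (qmx p) 0) = p &
  forall v, 'D_v (fun y => unqmx (cayley_param (fun y => qmx (qim y)) (qmx p) y)) 0 = 2 *: (qim v * p)].
Proof.
move=> Mp; have [_ pp p0 pV] := Sp1_conj Mp.
have [_ ipE] := qmx_inv p0.
have [||||||r r0 [h1 h2 h3 _]] := @embedded_cayley_chart R (quat R) 4 3 (@qmx R) (@unqmx R)
  (fun y => qmx (qim y)) (fun A => qimv (unqmx A)) M p (lcm_quat (@qmx_linear R))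
  (@unqmx_linear R) (@qmxK R).
- by move=> s x y; rewrite qim_linear qmx_linear.
- by move=> s x y; rewrite unqmx_linear qimv_linear.
- by move=> y; rewrite qmxK qimK.
- exact: Sp1_unit.
- move=> y _; rewrite qmx_cayley ?qimB_neq0 // -qmxM.
  by exists ((1 - qim y)^-1 * (1 + qim y) * p) => //; apply: Sp1_mul => //; exact: cayley_Sp1.
- move=> q Mq; rewrite ipE -qmxM -qmx1 -qmxD qmx_unit => u.
  rewrite qmx_inv_cayley // qmxK qimvK //; apply: inv_cayley_Sp1 => //.
  by apply: Sp1_mul => //; rewrite pV; case: (Sp1_conj Mp).
by exists r => //; split=> // v; rewrite h3 -qmxM qmxK.
Qed.
End Sp1Charts.

(** * Invariant integration on Sp_1 *)

Section Sp1Integral.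
Variables (R : realType) (mu : {measure set (borel (quat R)) -> \bar R}).
Hypothesis vol : volume_measure (@Sp1 R) (@qip R) mu.
Local Notation M := (@Sp1 R).
Local Notation Int := (Int M mu).

Lemma qipE (x y : quat R) : qip x y = \sum_a qc a x * qc a y.
Proof.
rewrite sum4; have [-> -> -> ->] := qcE x; have [-> -> -> ->] := qcE y.
by rewrite /qip /=; ring.
Qed.

Lemma qip_isometry p : M p -> isometry_of M (@qip R) (fun q => p * q) (fun q => conjq p * q).
Proof.
move=> Mp; have [Mp' pp _ _] := Sp1_conj Mp; have pp' : conjq p * p = 1 by [].
split.
- exact: bcm_lcml (bilinear_continuous_mulq R) p.
- exact: bcm_lcml (bilinear_continuous_mulq R) (conjq p).
- by split=> q; rewrite mulrA ?pp ?pp' mul1r.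
- by move=> x y; rewrite /qip conjqM -mulrA (mulrA (conjq p)) pp' mul1r.
- move=> q; split=> [|Mpq]; first exact: Sp1_mul.
  by rewrite -[q]mul1r -pp' -mulrA; exact: Sp1_mul.
Qed.

Lemma Sp1_volume_facts : [/\ (mu M < +oo)%E, 0 < Int (fun=> 1) &
  forall p f, M p -> cont_on M f -> Int (fun q => f (p * q)) = Int f].
Proof.
have [r r0 [lp p0 D]] := Sp1_chart (Sp1_1 R).
set psi := (fun y => _) in lp p0 D.
have U00 : rball r (0 : 'rV[R]_3) by rewrite /rball /= normr0.
(* The differential at the identity is twice an isometry onto the imaginary quaternions. *)
have gE : gram (fun=> @qip R) psi 0 = 4%:M.
  apply/matrixP => i j; rewrite !mxE /partial !D !mulr1.
  by move: i j; apply: ord3P; apply: ord3P; rewrite /qip /= !mxE /=; ring.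
have g0 : 0 < \det (gram (fun=> @qip R) psi 0) by rewrite gE det_scalar exprn_gt0.
have tr p : M p -> exists T T', isometry_of M (@qip R) T T' /\ T (psi 0) = p.
  move=> Mp; exists (fun q => p * q), (fun q => conjq p * q); split; first exact: qip_isometry.
  by rewrite (p0 : psi 0 = 1) mulr1.
have [fin pos inv] := homogeneous_volume vol (@Sp1_compact R) (lcm_qc R) qipE lp U00 g0 tr.
by split=> // p f /qip_isometry iT; exact: inv iT.
Qed.

Let cM := @Sp1_compact R.
Let muM := let: And3 a _ _ := Sp1_volume_facts in a.
Let Int_mul := let: And3 _ _ a := Sp1_volume_facts in a.

Lemma Sp1_qe a : M (qe R a).
Proof. by move: a; apply: ord4P; apply/Sp1P; rewrite /sqnormq /= !mxE -!val_eqE /= ?inordK //=; ring. Qed.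

(** Invariance under left translation by -1, a unit quaternion. *)
Lemma Int_odd f : cont_on M f -> (forall q, M q -> f (- q) = - f q) -> Int f = 0.
Proof.
move=> fc fN; have M1 : M (-1) by apply/Sp1P; rewrite /sqnormq /=; ring.
have := Int_mul M1 fc; rewrite (eq_Int mu (h := fun q => - f q)); last first.
  by move=> q Mq; rewrite mulN1r fN.
rewrite (IntN cM muM) //; move: (Int f) => x; lra.
Qed.

(** Translation by 1, i, j, k and addition. This plays the role of second moments: the quadratic
    expressions met below become constant after this averaging. *)
Lemma Int_avg f k : cont_on M f -> (forall q, M q -> \sum_a f (qe R a * q) = k) ->
  4 * Int f = k * Int (fun=> 1).
Proof.
move=> fc fk; have fcm a : cont_on M (fun q => f (qe R a * q)).
  move=> q Mq; apply: continuous_comp; last by apply: fc; exact: Sp1_mul (Sp1_qe a) Mq.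
  exact: (bcm_lcml (bilinear_continuous_mulq R) (qe R a)).2.
rewrite -(Int_cst cM muM) -(eq_Int mu fk) (Int_sum cM muM) => [|a _]; last exact: fcm.
rewrite (eq_bigr (fun=> Int f)) => [|a _]; last by rewrite Int_mul //; exact: Sp1_qe.
by rewrite sumr_const card_ord mulr_natl.
Qed.
End Sp1Integral.

(** * The group Sp(1,1) *)

Section QMat.
Variable R : realType.
Local Notation M := (@Sp1 R).
Local Notation K := (@Sp1xSp1 R).

Lemma sum2 (V : nmodType) (F : 'I_2 -> V) : \sum_i F i = F 0 + F 1.
Proof. by rewrite !big_ord_recl big_ord0 addr0; congr (_ + F _); exact: val_inj. Qed.

Lemma ord2P (P : 'I_2 -> Prop) : P 0 -> P 1 -> forall i, P i.
Proof.
move=> P0 P1 [[|[|//]] h].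
- by rewrite (_ : Ordinal h = 0) //; exact: val_inj.
- by rewrite (_ : Ordinal h = 1) //; exact: val_inj.
Qed.

Definition qmat_of (a b c d : quat R) : qmat R :=
  \matrix_(i, j) if i == 0 then (if j == 0 then a else b) else (if j == 0 then c else d).

Lemma qmatP (P Q : qmat R) : P 0 0 = Q 0 0 -> P 0 1 = Q 0 1 -> P 1 0 = Q 1 0 -> P 1 1 = Q 1 1 -> P = Q.
Proof. by move=> *; apply/matrixP; apply: ord2P; apply: ord2P. Qed.

Lemma entry_linear i j : linear (fun P : qmat R => (P i j : quat R)).
Proof. by move=> s P Q; rewrite [LHS]mxE; congr (_ + _); rewrite mxE. Qed.

Lemma lcm_entry i j : linear_continuous_map (fun P : qmat R => (P i j : quat R)).
Proof.
apply: (@lcm_bounded _ _ _ _ 1); first exact: entry_linear.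
move=> P; rewrite mul1r -[leRHS]/(normqm P) /normqm (bigD1 i) //= (bigD1 j) //= -addrA lerDl.
by rewrite addr_ge0 // ?sumr_ge0 // => k _; rewrite ?sumr_ge0.
Qed.

Definition qmat_mx (P : qmat R) : 'M[R]_(4 + 4) :=
  block_mx (qmx (P 0 0)) (qmx (P 0 1)) (qmx (P 1 0)) (qmx (P 1 1)).
Definition mx_qmat (A : 'M[R]_(4 + 4)) : qmat R :=
  qmat_of (unqmx (ulsubmx A)) (unqmx (ursubmx A)) (unqmx (dlsubmx A)) (unqmx (drsubmx A)).

Lemma lcm_qmat_mx : linear_continuous_map qmat_mx.
Proof.
split=> [s P Q|P].
  by rewrite /qmat_mx scale_block_mx add_block_mx -!qmx_linear -!entry_linear.
have eC i j : class_C 0 setT (fun P : qmat R => qmx (P i j)).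
  by apply: (class_C_lcm (lcm_quat (@qmx_linear R)) openT); apply: class_C_lin; exact: lcm_entry.
have := class_C_block_mx openT (eC 0 0) (eC 0 1) (eC 1 0) (eC 1 1).
by move=> /class_C_cont; apply.
Qed.

Lemma mx_qmat_linear : linear mx_qmat.
Proof.
move=> s A B; apply: qmatP; rewrite entry_linear !mxE /= -unqmx_linear; congr unqmx;
  by rewrite /ulsubmx /ursubmx /dlsubmx /drsubmx !linearP.
Qed.

Lemma qmat_mxK : cancel qmat_mx mx_qmat.
Proof.
by move=> P; apply: qmatP; rewrite !mxE /= /qmat_mx ?(block_mxKul, block_mxKur, block_mxKdl, block_mxKdr) qmxK.
Qed.

Lemma qmat_mx_qdiag (g h : quat R) : qmat_mx (qdiag g h) = block_mx (qmx g) 0 0 (qmx h).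
Proof. by rewrite /qmat_mx !mxE /= qmx0. Qed.

Lemma mx_qmat_diag (g h : quat R) : mx_qmat (block_mx (qmx g) 0 0 (qmx h)) = qdiag g h.
Proof. by rewrite -qmat_mx_qdiag qmat_mxK. Qed.

Definition qio (y : 'rV[R]_(3 + 3)) : 'M[R]_(4 + 4) :=
  block_mx (qmx (qim (lsubmx y))) 0 0 (qmx (qim (rsubmx y))).
Definition qka (A : 'M[R]_(4 + 4)) : 'rV[R]_(3 + 3) :=
  row_mx (qimv (unqmx (ulsubmx A))) (qimv (unqmx (drsubmx A))).

(** The Cayley charts of the two factors are run as a single block diagonal Cayley transform of real
    8 x 8 matrices. *)
Lemma Sp1xSp1_chart (g h : quat R) : M g -> M h -> exists2 r : R, 0 < r & exists psi, [/\
  local_param K (rball r) psi, psi 0 = qdiag g h,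
  forall v, 'D_v psi 0 = qdiag (2 *: (qim (lsubmx v) * g)) (2 *: (qim (rsubmx v) * h)) &
  forall (I : set R) (c : R -> qmat R), open I -> smooth_on I c -> (forall s, I s -> K (c s)) ->
    forall t, I t -> c t = qdiag g h -> exists J (x : R -> 'rV[R]_(3 + 3)),
      [/\ open J, J t, J `<=` I, smooth_on J x /\ x t = 0 &
          forall s, J s -> rball r (x s) /\ c s = psi (x s)]].
Proof.
move=> Mg Mh; have [_ _ g0 gV] := Sp1_conj Mg; have [_ _ h0 hV] := Sp1_conj Mh.
have [ug igE] := qmx_inv g0; have [uh ihE] := qmx_inv h0.
have up : qmat_mx (qdiag g h) \in unitmx by rewrite qmat_mx_qdiag block_diag_unit ug uh.
have iE : invmx (qmat_mx (qdiag g h)) = block_mx (qmx g^-1) 0 0 (qmx h^-1).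
  apply: (can_inj (mulKmx up)); rewrite mulmxV // qmat_mx_qdiag mulmx_block.
  by rewrite !mulmx0 !mul0mx !addr0 !add0r -!qmxM !divrr // qmx1 -scalar_mx_block.
have [|||||r r0 [h1 h2 h3 h4]] := @embedded_cayley_chart R (qmat R) (4 + 4) (3 + 3) qmat_mx mx_qmat
  qio qka K (qdiag g h) lcm_qmat_mx mx_qmat_linear qmat_mxK _ _ _ up.
- move=> s x y; rewrite /qio !linearP /= !qim_linear !qmx_linear.
  by rewrite scale_block_mx add_block_mx !scaler0 !addr0.
- move=> s A B; rewrite /qka /ulsubmx /drsubmx !linearP /= !unqmx_linear !qimv_linear.
  by rewrite scale_row_mx add_row_mx.
- by move=> y; rewrite /qka /qio block_mxKul block_mxKdr !qmxK !qimK hsubmxK.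
- move=> y _; pose cq z := (1 - qim z)^-1 * (1 + qim z) : quat R.
  have u z : 1%:M - qmx (qim z) \in (unitmx : {pred 'M[R]_4}).
    by rewrite -qmx1 -qmxN -qmxD qmx_unit qimB_neq0.
  exists (qdiag (cq (lsubmx y) * g) (cq (rsubmx y) * h)).
    exists (cq (lsubmx y) * g); first by apply: Sp1_mul => //; exact: cayley_Sp1.
    by exists (cq (rsubmx y) * h) => //; apply: Sp1_mul => //; exact: cayley_Sp1.
  rewrite !qmat_mx_qdiag /qio cayley_block_diag // !qmx_cayley ?qimB_neq0 //.
  by rewrite mulmx_block !mulmx0 !mul0mx !addr0 !add0r !qmxM.
- move=> _ [g' Mg' [h' Mh' <-]]; rewrite iE !qmat_mx_qdiag mulmx_block.
  rewrite !mulmx0 !mul0mx !addr0 !add0r -!qmxM => u.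
  have := u; rewrite (scalar_mx_block 4 4 1) add_block_mx !addr0 block_diag_unit.
  rewrite -qmx1 -!qmxD !qmx_unit => /andP[u1 u2].
  rewrite inv_cayley_block_diag -?qmx1 -?qmxD ?qmx_unit // !qmx_inv_cayley //.
  rewrite /qio /qka block_mxKul block_mxKdr !qmxK row_mxKl row_mxKr.
  have M1 p q : M p -> M q -> M (p * q^-1).
    by move=> Mp Mq; apply: Sp1_mul => //; have [? _ _ ->] := Sp1_conj Mq.
  by rewrite !qimvK //; apply: inv_cayley_Sp1 => //; exact: M1.
exists r => //; exists (fun y => mx_qmat (cayley_param qio (qmat_mx (qdiag g h)) y)).
split=> // v; rewrite h3 qmat_mx_qdiag /qio mulmx_block !mulmx0 !mul0mx !addr0 !add0r -!qmxM.
rewrite mx_qmat_diag; apply: qmatP; rewrite (linZ (@entry_linear _ _)) !mxE /= ?scaler0 //.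
Qed.

Definition qnum (P : qmat R) (q : quat R) : quat R := P 0 0 * q + P 0 1.
Definition qden (P : qmat R) (q : quat R) : quat R := P 1 0 * q + P 1 1.

(** The vector (q, 1) is null for the form, so its image (num, den) is null too; if den = 0 then num
    = 0, against the invertibility of [P]. *)
Lemma qden_neq0 P q : Sp11 P -> M q -> qden P q != 0.
Proof.
move=> [[Q [_ QP]] PJ] /Sp1P q1; apply/eqP => d0.
pose u : 'cV[quat R]_2 := \col_i if i == 0 then q else 1.
have E0 : (P *m u) 0 0 = qnum P q by rewrite mxE sum2 !mxE /= mulr1.
have E1 : (P *m u) 1 0 = 0 by rewrite mxE sum2 !mxE /= mulr1.
have := PJ u u; rewrite /qform E0 E1 !mxE /= mulr0 subr0 mulr1.
have [-> _] := mulq_conj (qnum P q); have [-> _] := mulq_conj q.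
rewrite q1 scale1r => /(congr1 (@q0 R)) /=; rewrite mulr1 subrr => n0.
have P0 : P *m u = 0.
  apply/matrixP => i j; rewrite ord1 [RHS]mxE; move: i; apply: ord2P; last exact: E1.
  by rewrite E0; exact: sqnormq_eq0.
have : u 1 0 = 0 by rewrite -[u]mul1mx -QP -mulmxA P0 mulmx0 mxE.
by rewrite mxE /= => /eqP; rewrite oner_eq0.
Qed.

Definition qvel (P X : qmat R) (q : quat R) : quat R :=
  (qnum X q - qmoebius P q * qden X q) * (qden P q)^-1.

Lemma qnum_linear q : linear (qnum^~ q).
Proof. by move=> s P Q; rewrite /qnum !entry_linear mulrDl scaleqAl scalerDr addrACA. Qed.
Lemma qden_linear q : linear (qden^~ q).
Proof. by move=> s P Q; rewrite /qden !entry_linear mulrDl scaleqAl scalerDr addrACA. Qed.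

Lemma lcm_qmat_row i q : linear_continuous_map (fun P : qmat R => P i 0 * q + P i 1).
Proof.
split; first by move=> s P Q; rewrite !entry_linear mulrDl scaleqAl scalerDr addrACA.
have : class_C 0 setT (fun P : qmat R => P i 0 * q + P i 1).
  have eC j : class_C 0 setT (fun P : qmat R => (P i j : quat R)).
    by apply: class_C_lin; exact: lcm_entry.
  apply: (class_CD openT _ (eC 1)).
  exact: (class_C_mulq openT (eC 0) (class_C_cst _ _ _)).
by move=> h P; exact: (class_C_cont h).
Qed.

Lemma is_derive_qmoebius (c : R -> qmat R) q : M q -> Sp11 (c 0) -> derivable c 0 1 ->
  is_derive (0 : R) 1 (fun t => qmoebius (c t) q) (qvel (c 0) (derive1 c 0) q).
Proof.
move=> Mq Gc dc; have u := qden_neq0 Gc Mq.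
have cD : is_derive (0 : R) 1 c (derive1 c 0) by rewrite derive1E; exact: derivableP.
have nD := is_derive_lcm (lcm_qmat_row 0 q) cD.
have dD := is_derive_invq (is_derive_lcm (lcm_qmat_row 1 q) cD) u.
have [d1 d2] := is_derive_bcm (bilinear_continuous_mulq R) nD dD.
split; first exact: d1.
apply: etrans d2 _.
rewrite /qvel mulrBl mulrN /qmoebius /= -/(qnum _ _) -/(qden _ _) !mulrA.
by [].
Qed.

Lemma qvel_linear P q : linear (fun X => qvel P X q).
Proof.
move=> s X Y; rewrite /qvel qnum_linear qden_linear mulrDr scaleqAr opprD addrACA -scalerBr.
by rewrite mulrDl scaleqAl.
Qed.

Lemma qmoebius_smooth d (U : set 'rV[R]_d) (psi : 'rV[R]_d -> qmat R) : open U ->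
  smooth_on U psi -> (forall y, U y -> Sp11 (psi y)) ->
  exists Om : set ('rV[R]_d * quat R)%type, [/\ open Om,
    forall y q, U y -> M q -> Om (y, q) &
    forall a, smooth_on Om (fun z => qc a (qmoebius (psi z.1) z.2))].
Proof.
move=> oU sU UG; pose V := [set z : 'rV[R]_d * quat R | U z.1].
have oV : open V.
  by apply: open_comp => // z _; exact: (lcm_fst _ _).2.
have c1 k : class_C k V (fun z => psi z.1).
  have := @class_C_affine R _ _ _ k V U fst psi 0 (lcm_fst _ _).
  under eq_fun do rewrite addr0.
  by apply=> // x; rewrite addr0.
have c2 k : class_C k V (fun z : 'rV[R]_d * quat R => z.2).
  by apply: class_C_lin; exact: lcm_snd.
have ce k i j : class_C k V (fun z => psi z.1 i j : quat R).
  by apply: (class_C_lcm (lcm_entry i j) oV (c1 k)).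
have cr k i : class_C k V (fun z => psi z.1 i 0 * z.2 + psi z.1 i 1).
  exact: (class_CD oV (class_C_mulq oV (ce k i 0) (c2 k)) (ce k i 1)).
pose Om := V `&` [set z | qden (psi z.1) z.2 != 0].
have oOm : open Om.
  rewrite openE => z [Vz Dz]; rewrite /interior; apply: filterI; first exact: open_nbhs_nbhs.
  exact: (cvgr_neq0 _ (class_C_cont (cr 0%N 1) Vz) Dz).
exists Om; split=> //.
  by move=> y q Uy Mq; split=> //; apply: qden_neq0 => //; exact: UG.
move=> a k; apply: (class_C_lcm (lcm_qc R a) oOm); apply: (class_C_mulq oOm).
  by apply: class_C_subset (cr k 0) => z [].
apply: (class_C_invq oOm) => [z []//|].
by apply: class_C_subset (cr k 1) => z [].
Qed.

Lemma qcoord_eq0 (X : qmat R) : (forall b : 'I_2 * 'I_2 * 'I_4, qc b.2 (X b.1.1 b.1.2) = 0) -> X = 0.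
Proof.
move=> h; apply/matrixP => i j; rewrite [RHS]mxE; apply: qcP => a.
by rewrite (h (i, j, a)) (lin0 (@qc_linear R a)).
Qed.

Lemma lcm_qcoord (b : 'I_2 * 'I_2 * 'I_4) :
  linear_continuous_map (fun X : qmat R => qc b.2 (X b.1.1 b.1.2)).
Proof. exact: lcm_comp (lcm_qc R b.2) (lcm_entry b.1.1 b.1.2). Qed.

Lemma Sp1xSp1_sub : K `<=` @Sp11 R.
Proof.
move=> _ [g Mg [h Mh <-]]; have [_ gg _ _] := Sp1_conj Mg; have [_ hh _ _] := Sp1_conj Mh.
have gg' : conjq g * g = 1 by []. have hh' : conjq h * h = 1 by [].
have dM (a b c d : quat R) : (qdiag a b : 'M[quat R]_2) *m qdiag c d = qdiag (a * c) (b * d).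
  by apply: qmatP; rewrite !mxE sum2 !mxE /= ?(mulr0, mul0r, addr0, add0r).
have d1 : qdiag 1 1 = 1%:M :> 'M[quat R]_2 by apply: qmatP; rewrite !mxE.
split; first by exists (qdiag (conjq g) (conjq h)); rewrite !dM gg hh gg' hh' d1.
move=> u v; rewrite /qform !mxE !sum2 !mxE /= !mul0r addr0 add0r addr0 add0r.
by rewrite !conjqM -!mulrA (mulrA (conjq g)) gg' (mulrA (conjq h)) hh' !mul1r.
Qed.

(** Differentiate the values of the form on pairs of basis vectors: the pairs (0, 0) and (1, 1) make
    the diagonal entries imaginary after translation, and (0, 1) ties the off-diagonal entries
    together. *)
Lemma tangent_Sp11 (g h : quat R) X : M g -> M h -> tangent_at (@Sp11 R) (qdiag g h) X ->
  exists x1 z x2, [/\ X = qmat_of (g * x1) (g * z) (h * conjq z) (h * x2), q0 x1 = 0 & q0 x2 = 0].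
Proof.
move=> Mg Mh [f [e e0 [fC fG f0 f1]]].
have [_ gg _ _] := Sp1_conj Mg; have [_ hh _ _] := Sp1_conj Mh.
have i0 : `]-e, e[%classic (0 : R) by rewrite /= in_itv /= oppr_lt0 e0.
have fD : is_derive (0 : R) (1 : R) f X.
  by rewrite -f1 derive1E; exact: derivableP (class_C_derivable (v := (1 : R)) (fC 1%N) i0).
have eD i j : is_derive (0 : R) (1 : R) (fun s => f s i j : quat R) (X i j) by have := is_derive_lcm (lcm_entry i j) fD.
have cD i j : is_derive (0 : R) (1 : R) (fun s => conjq (f s i j)) (conjq (X i j)).
  by have := is_derive_lcm (lcm_quat (@conjq_linear R)) (eD i j).
have mB := bilinear_continuous_mulq R.
have pD i j := is_deriveB (is_derive_bcm mB (cD 0 i) (eD 0 j)) (is_derive_bcm mB (cD 1 i) (eD 1 j)).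
have rel i j : conjq (X 0 i) * f 0 0 j + conjq (f 0 0 i) * X 0 j -
    (conjq (X 1 i) * f 0 1 j + conjq (f 0 1 i) * X 1 j) = 0.
  case: (pD i j) => _ <-.
  pose bv (k : 'I_2) : 'cV[quat R]_2 := delta_mx k 0.
  rewrite (near_eq_derive (g := fun=> qform (bv i) (bv j))) ?derive_cst //.
  have oI : open `]-e, e[%classic by exact: interval_open.
  apply: filterS (open_nbhs_nbhs (conj oI i0)) => s se.
  have [_ /(_ (bv i) (bv j)) <-] := fG s se.
  have bE k l : (f s *m bv k) l 0 = f s l k.
    by rewrite mxE sum2 !mxE !andbT; move: k; apply: ord2P; rewrite /= ?mulr0 ?mulr1 ?addr0 ?add0r.
  by rewrite /qform !bE.
rewrite f0 in rel.
have r00 := rel 0 0; have r01 := rel 0 1; have r11 := rel 1 1.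
rewrite !mxE /= in r00 r01 r11.
have c0 : conjq 0 = 0 :> quat R by apply: quatP; rewrite /= ?oppr0.
rewrite c0 !(mulr0, mul0r, addr0, add0r, subr0, sub0r) in r00 r01 r11.
exists (conjq g * X 0 0), (conjq g * X 0 1), (conjq h * X 1 1); split.
- apply: qmatP; rewrite [RHS]mxE /= ?mulrA ?gg ?hh ?mul1r //.
  have -> : conjq g * X 0 1 = conjq (X 1 0) * h by apply/eqP; rewrite -subr_eq0 r01.
  by rewrite conjqM conjqK mulrA hh mul1r.
- by apply/q0_conj; apply/eqP; rewrite conjqM conjqK -addr_eq0 r00.
- apply/q0_conj; apply/eqP; rewrite conjqM conjqK -addr_eq0.
  by rewrite -oppr_eq0 r11.
Qed.

Lemma qvel_K (g h : quat R) (a b c d : quat R) q : M g -> M h -> M q ->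
  qvel (qdiag g h) (qmat_of (g * a) (g * b) (h * c) (h * d)) q =
  g * (a * q + b - q * c * q - q * d) * conjq h.
Proof.
move=> Mg Mh Mq; have [_ hh _ hV] := Sp1_conj Mh; have hh' : conjq h * h = 1 by [].
rewrite /qvel /qnum /qden /qmoebius !mxE /= mul0r !addr0 add0r hV.
have -> : g * q * conjq h * (h * c * q + h * d) = g * (q * c * q + q * d).
  by rewrite mulrDr !mulrA -![_ * conjq h * h]mulrA hh' !mulr1 mulrDr !mulrA.
by congr (_ * _); rewrite -!(mulrA g) -mulrDr -mulrBr opprD addrA.
Qed.
End QMat.

(** * Geodesics in Sp_1 x Sp_1 *)

Section PartA.
Variables (R : realType) (mu : {measure set (borel (quat R)) -> \bar R}).
Hypothesis vol : volume_measure (@Sp1 R) (@qip R) mu.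
Local Notation M := (@Sp1 R).
Local Notation K := (@Sp1xSp1 R).
Local Notation Int := (Int M mu).
Local Notation kin := (kinetic (@Sp11 R) M (@qmoebius R) (@qip R) mu).
Local Notation lag := (lagrange_form M (@qmoebius R) mu (@qc R) (@qvel R)).
Let cM := @Sp1_compact R.
Let muM := let: And3 a _ _ := Sp1_volume_facts vol in a.
Let V0 := let: And3 _ a _ := Sp1_volume_facts vol in a.

Lemma qip_linearl z : linear (fun x => qip x z : R^o).
Proof. by move=> s x y; rewrite /qip /GRing.scale /=; ring. Qed.
Lemma qip_linearr z : linear (fun x => qip z x : R^o).
Proof. by move=> s x y; rewrite /qip /GRing.scale /=; ring. Qed.

Lemma qip_ge0 (x : quat R) : qip x x = sqnormq x.
Proof. by rewrite /qip /sqnormq /=; ring. Qed.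

Lemma qip_Sp1 (p x y : quat R) : M p -> qip (p * x) (p * y) = qip x y /\ qip (x * p) (y * p) = qip x y.
Proof.
move=> Mp; have [_ pp _ _] := Sp1_conj Mp; have pp' : conjq p * p = 1 by [].
have q0C (a b : quat R) : q0 (a * b) = q0 (b * a) by rewrite /=; ring.
split; first by rewrite /qip conjqM -mulrA (mulrA (conjq p)) pp' mul1r.
by rewrite /qip conjqM -mulrA q0C -!mulrA pp mulr1.
Qed.

Lemma qip_conj (g h x y : quat R) : M g -> M h -> qip (g * x * conjq h) (g * y * conjq h) = qip x y.
Proof.
move=> Mg Mh; have [Mh' _ _ _] := Sp1_conj Mh.
by have [_ ->] := qip_Sp1 (g * x) (g * y) Mh'; have [-> _] := qip_Sp1 x y Mg.
Qed.

Definition qfield x1 z x2 q : quat R := x1 * q + z - q * conjq z * q - q * x2.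

Lemma cont_qip (f f' : quat R -> quat R) :
  class_C 0 setT f -> class_C 0 setT f' -> cont_on M (fun q => qip (f q) (f' q)).
Proof.
move=> fC fC'; apply: class_C_cont_on.
rewrite (_ : (fun q => _) = fun q => \sum_a qc a (f q) * qc a (f' q)); last first.
  by apply/funext => q; rewrite qipE.
apply: (class_C_sum _ openT) => a _.
have F := class_C_lcm (lcm_qc R a) openT fC; have F' := class_C_lcm (lcm_qc R a) openT fC'.
by have := class_CM openT F F'.
Qed.

Ltac class_C_qpoly := repeat first
  [ exact: class_C_cst | exact: class_C_id | exact: openT
  | apply: class_CB | apply: class_CD | apply: class_CN | apply: class_C_mulq].

Lemma qeE : [/\ qe R 0 = Quat 1 0 0 0, qe R 1 = Quat 0 1 0 0, qe R (inord 2) = Quat 0 0 1 0 &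
  qe R (inord 3) = Quat 0 0 0 1].
Proof. by split; rewrite /qe /qof !mxE -!val_eqE /= !inordK. Qed.

(** Conjugation by 1, i, j, k changes the signs of the imaginary coordinates so that they cancel in
    the sum. *)
Lemma sum_conj_qe (x : quat R) : \sum_a conjq (qe R a) * x * qe R a = (4 * q0 x) *: (1 : quat R).
Proof.
case: x => a b c d; rewrite sum4; have [-> -> -> ->] := qeE.
by apply: quatP => /=; ring.
Qed.

Lemma sum_qe_qe (x : quat R) : \sum_a qe R a * x * qe R a = - 2 *: conjq x.
Proof.
case: x => a b c d; rewrite sum4; have [-> -> -> ->] := qeE.
by apply: quatP => /=; ring.
Qed.

(** The part [A] from [x1], [x2] is odd and the part [B] from [z] is even, so their pairing has
    integral 0. After averaging over 1, i, j, k, the cross term of [A] carries the real part of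
    [x1], which is 0. That of [B] adds 4 |z|^2 to 8 |z|^2 by [sum_qe_qe], and 12 / 4 = 3. *)
Lemma Int_qfield_sqr x1 z x2 : q0 x1 = 0 -> q0 x2 = 0 ->
  Int (fun q => qip (qfield x1 z x2 q) (qfield x1 z x2 q)) =
  Int (fun=> 1) * (sqnormq x1 + sqnormq x2 + 3 * sqnormq z).
Proof.
move=> i1 i2.
pose A q := x1 * q - q * x2; pose B q := z - q * conjq z * q.
have E q : qip (qfield x1 z x2 q) (qfield x1 z x2 q) =
    (qip (A q) (A q) + qip (B q) (B q)) + 2 * qip (A q) (B q).
  rewrite (_ : qfield x1 z x2 q = A q + B q); last by rewrite /qfield /A /B [RHS]addrAC addrA.
  by move: (A q) (B q) => a b; rewrite /qip /=; ring.
have cA : class_C 0 setT A by rewrite /A; class_C_qpoly.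
have cB : class_C 0 setT B by rewrite /B; class_C_qpoly.
have cAA := cont_qip cA cA; have cBB := cont_qip cB cB; have cAB := cont_qip cA cB.
under eq_Int do rewrite E.
have c2 : cont_on M (fun q => 2 * qip (A q) (B q)).
  by apply: cont_onM => //; exact: cont_on_cst.
rewrite (IntD cM muM (cont_onD cAA cBB) c2) (IntD cM muM cAA cBB) (IntZ cM muM 2 cAB).
have odd : Int (fun q => qip (A q) (B q)) = 0.
  apply: (Int_odd vol) => // q _.
  have -> : A (- q) = - A q by rewrite /A mulrN mulNr opprB opprK addrC.
  have -> : B (- q) = B q by rewrite /B mulrN !mulNr opprK.
  by rewrite (linN (@qip_linearl _)).
have c4 : 4 != 0 :> R by rewrite pnatr_eq0.
have eA : 4 * Int (fun q => qip (A q) (A q)) = 4 * (sqnormq x1 + sqnormq x2) * Int (fun=> 1).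
  apply: (Int_avg vol) => // q Mq.
  have Ea a : qip (A (qe R a * q)) (A (qe R a * q)) = sqnormq x1 + sqnormq x2 -
      2 * q0 (conjq q * (conjq (qe R a) * conjq x1 * qe R a) * q * x2).
    have Mp := Sp1_mul (@Sp1_qe R a) Mq; set p := qe R a * q in Mp *.
    have [_ h1] := qip_Sp1 x1 x1 Mp; have [h2 _] := qip_Sp1 x2 x2 Mp.
    have -> : qip (A p) (A p) = qip (x1 * p) (x1 * p) + qip (p * x2) (p * x2) - 2 * qip (x1 * p) (p * x2).
      by rewrite /A; move: (x1 * p) (p * x2) => u v; rewrite /qip /=; ring.
    by rewrite h1 h2 !qip_ge0 /qip /p !conjqM !mulrA.
  rewrite (eq_bigr _ (fun a _ => Ea a)) sumrB sumr_const card_ord -mulr_sumr.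
  rewrite (_ : \sum_a _ = q0 (conjq q * (\sum_a conjq (qe R a) * conjq x1 * qe R a) * q * x2)); last first.
    by rewrite mulr_sumr !mulr_suml (big_morph (@q0 R) (fun _ _ => erefl) (erefl : q0 0 = 0)).
  rewrite sum_conj_qe /= i1; ring.
have eB : 4 * Int (fun q => qip (B q) (B q)) = 12 * sqnormq z * Int (fun=> 1).
  apply: (Int_avg vol) => // q Mq.
  have Ea a : qip (B (qe R a * q)) (B (qe R a * q)) = 2 * sqnormq z -
      2 * q0 (conjq z * (qe R a * (q * conjq z) * qe R a) * q).
    have Mp := Sp1_mul (@Sp1_qe R a) Mq; set p := qe R a * q in Mp *.
    have h1 : qip (p * conjq z * p) (p * conjq z * p) = sqnormq z.
      have [_ ->] := qip_Sp1 (p * conjq z) (p * conjq z) Mp.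
      by have [-> _] := qip_Sp1 (conjq z) (conjq z) Mp; rewrite qip_ge0 /sqnormq /=; ring.
    have -> : qip (B p) (B p) = qip z z + qip (p * conjq z * p) (p * conjq z * p) - 2 * qip z (p * conjq z * p).
      by rewrite /B; move: (p * conjq z * p) => v; rewrite /qip /=; ring.
    by rewrite h1 qip_ge0 /qip /p !mulrA; ring.
  rewrite (eq_bigr _ (fun a _ => Ea a)) sumrB sumr_const card_ord -mulr_sumr.
  rewrite (_ : \sum_a _ = q0 (conjq z * (\sum_a qe R a * (q * conjq z) * qe R a) * q)); last first.
    by rewrite mulr_sumr !mulr_suml (big_morph (@q0 R) (fun _ _ => erefl) (erefl : q0 0 = 0)).
  rewrite sum_qe_qe scaleqAr scaleqAl conjqM conjqK !mulrA.
  have -> : conjq z * z * conjq q * q = sqnormq z *: (1 : quat R).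
    by rewrite -mulrA; have -> : conjq q * q = 1 by []; rewrite mulr1; have [-> _] := mulq_conj z.
  by rewrite /=; ring.
rewrite odd mulr0 addr0; apply: (mulfI c4); rewrite mulrDr eA eB; ring.
Qed.

Lemma nondegenerate_qK P : K P -> nondegenerate_at (@Sp11 R) M mu (@qc R) (@qvel R) P.
Proof.
move=> [g Mg [h Mh <-]] X tX; have [x1 [z [x2 [-> i1 i2]]]] := tangent_Sp11 Mg Mh tX.
rewrite (eq_Int mu (h := fun q => qip (qfield x1 z x2 q) (qfield x1 z x2 q))); last first.
  move=> q Mq; rewrite qvel_K // -/(qfield _ _ _ _) -(qip_conj _ _ Mg Mh) qipE.
  by apply: eq_bigr => a _; rewrite expr2.
rewrite Int_qfield_sqr // => /eqP; rewrite mulf_eq0 (gt_eqF V0) /= => /eqP h0.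
have p1 := sqnormq_ge0 x1; have p2 := sqnormq_ge0 x2; have p3 := sqnormq_ge0 z.
have -> : x1 = 0 by apply: sqnormq_eq0; lra.
have -> : x2 = 0 by apply: sqnormq_eq0; lra.
have -> : z = 0 by apply: sqnormq_eq0; lra.
by apply: qmatP; rewrite !mxE /= ?(lin0 (@conjq_linear R)) ?mulr0.
Qed.

Lemma qgeodesic_eqP (S : set (qmat R)) d (U : set 'rV[R]_d) psi (J : set R)
    (x : R -> 'rV[R]_d) (c : R -> qmat R) t :
  S `<=` @Sp11 R -> local_param S U psi ->
  open J -> smooth_on J x -> (forall s, J s -> U (x s) /\ c s = psi (x s)) -> J t -> K (c t) ->
  (forall k, derive1n 2 x t 0 k + \sum_i \sum_j christoffel kin psi (x t) k i j
     * derive1 x t 0 i * derive1 x t 0 j = 0) <->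
  (forall l, lag c t (partial l psi (x t)) = 0).
Proof.
move=> SG pP oJ sx Jx Jt Kc.
exact: (geodesic_eqP cM muM (@lcm_qc R) (@qipE R) (@lcm_qcoord R) (@qcoord_eq0 R)
  (@is_derive_qmoebius R) (@qvel_linear R) (@qmoebius_smooth R) SG pP oJ sx Jx Jt (nondegenerate_qK Kc)).
Qed.

Variables (I : set R) (c : R -> qmat R).
Hypotheses (oI : open I) (cS : smooth_on I c) (cK : forall s, I s -> K (c s)).
Let g s : quat R := c s 0 0.
Let h s : quat R := c s 1 1.
Let sg : smooth_on I g.
Proof. by move=> k; have := class_C_lcm (lcm_entry R 0 0) oI (cS k). Qed.
Let sh : smooth_on I h.
Proof. by move=> k; have := class_C_lcm (lcm_entry R 1 1) oI (cS k). Qed.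

Let cE s : I s -> [/\ M (g s), M (h s) & c s = qdiag (g s) (h s)].
Proof. by move=> /cK [g' Mg [h' Mh E]]; rewrite /g /h -E !mxE. Qed.

(** The acceleration of the curve [s |-> g s * q * conjq (h s)], by the Leibniz rule. *)
Definition qacc t q : quat R := derive1n 2 g t * q * conjq (h t)
  + 2 *: (derive1 g t * q * conjq (derive1 h t)) + g t * q * conjq (derive1n 2 h t).

Definition qlag t X := Int (fun q => qip (qvel (c t) X q) (qacc t q)).

Lemma lag_qlag t X : I t -> lag c t X = qlag t X.
Proof.
move=> It; apply: eq_Int => q Mq; rewrite qipE; apply: eq_bigr => a _.
apply: (f_equal2 *%R); first by [].
have actE s : I s -> qc a (qmoebius (c s) q) = qc a (g s * q * conjq (h s)).
  move=> Is; have [_ Mh ->] := cE Is; have [_ _ _ hV] := Sp1_conj Mh.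
  by rewrite /qmoebius !mxE /= mul0r addr0 add0r hV.
rewrite (derive1n2_eq oI It actE).
have Lq : linear_continuous_map (fun x : quat R => x * q) := bcm_lcmr (bilinear_continuous_mulq R) q.
have Lc := lcm_quat (@conjq_linear R).
have gq : class_C 2 I (fun s => g s * q) by exact: (class_C_lcm Lq oI (sg 2%N)).
have hT : class_C 2 I (fun s => conjq (h s)) by exact: (class_C_lcm Lc oI (sh 2%N)).
have mulB := bilinear_continuous_mulq R.
have E2 := derive1n2_bcm mulB oI gq hT It.
have gh : class_C 2 I (fun s => g s * q * conjq (h s)) by exact: (class_C_bcm mulB oI gq hT).
rewrite (derive1n2_lcm (lcm_qc R a) oI gh It) E2.
rewrite (derive1n2_lcm Lq oI (sg 2%N) It) (derive1n2_lcm Lc oI (sh 2%N) It).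
have gD := derivableP (class_C_derivable (v := (1 : R)) (sg 1%N) It).
have hD := derivableP (class_C_derivable (v := (1 : R)) (sh 1%N) It).
have -> : derive1 (fun s => g s * q) t = derive1 g t * q.
  by rewrite !derive1E; case: (is_derive_lcm Lq gD).
have -> : derive1 (fun s => conjq (h s)) t = conjq (derive1 h t).
  by rewrite !derive1E; case: (is_derive_lcm Lc hD).
by [].
Qed.

Let qvelE t X : I t -> qvel (c t) X =
  fun q => (X 0 0 * q + X 0 1 - g t * q * (h t)^-1 * (X 1 0 * q + X 1 1)) * (h t)^-1.
Proof.
move=> It; apply/funext => q; have [_ _ ->] := cE It.
by rewrite /qvel /qnum /qden /qmoebius !mxE /= mul0r addr0 add0r.
Qed.

Let cont_qlag t X : I t -> cont_on M (fun q => qip (qvel (c t) X q) (qacc t q)).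
Proof.
move=> It; apply: cont_qip; first by rewrite qvelE //; class_C_qpoly.
rewrite /qacc; apply: (class_CD openT); last by class_C_qpoly.
apply: (class_CD openT); first by class_C_qpoly.
by apply: (class_C_bcm (bilinear_continuous_scaler _) openT); class_C_qpoly.
Qed.

(** Linearity on all quaternionic matrices lets the diagonal and the off-diagonal part of a tangent
    vector be treated separately. *)
Lemma qlag_linear t : I t -> linear (qlag t : qmat R -> R^o).
Proof.
move=> It s X Y; rewrite /qlag.
rewrite (eq_Int mu (h := fun q => s * qip (qvel (c t) X q) (qacc t q) + qip (qvel (c t) Y q) (qacc t q))); last first.
  by move=> q _; rewrite qvel_linear (@qip_linearl _).
have cX := @cont_qlag t X It; have cY := @cont_qlag t Y It.
rewrite (IntD cM muM) // ?(IntZ cM muM) //.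
by apply: cont_onM => //; exact: cont_on_cst.
Qed.

(* [z - q z^* q] is even in [q], whereas the acceleration of [c(t) * q] is odd. *)
Lemma qlag_off t z : I t -> qlag t (qmat_of 0 (g t * z) (h t * conjq z) 0) = 0.
Proof.
move=> It; have [Mg Mh cE'] := cE It; apply: (Int_odd vol); first exact: cont_qlag.
have vE q : M q -> qvel (c t) (qmat_of 0 (g t * z) (h t * conjq z) 0) q =
    g t * (z - q * conjq z * q) * conjq (h t).
  move=> Mq; rewrite {1}cE' -[in X in qmat_of X](mulr0 (g t)) -[X in qmat_of _ _ _ X](mulr0 (h t)).
  by rewrite qvel_K // mul0r add0r mulr0 subr0.
move=> q Mq; have MN : M (- q) by move: Mq => /Sp1P q1; apply/Sp1P; rewrite -q1 /sqnormq /=; ring.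
rewrite !vE // mulrN !mulNr opprK.
have -> : qacc t (- q) = - qacc t q.
  by rewrite /qacc !mulrN !mulNr scalerN -!opprD.
by rewrite (linN (@qip_linearr _)).
Qed.

Hypothesis Kgeo : geodesic K kin I c.

(** The geodesic equation in the Cayley chart of the subgroup gives the vanishing on a basis; by
    linearity it holds on every vector tangent to the subgroup. *)
Lemma qlag_diag t x1 x2 : I t -> q0 x1 = 0 -> q0 x2 = 0 ->
  qlag t (qdiag (g t * x1) (h t * x2)) = 0.
Proof.
move=> It i1 i2; have [Mg Mh cE'] := cE It.
have [r r0 [psi [lp psi0 D lift]]] := Sp1xSp1_chart Mg Mh.
have [J [x [oJ Jt JI [sx xt] Jx]]] := lift I c oI cS cK t It cE'.
have [_ geo] := Kgeo.
have := (qgeodesic_eqP (@Sp1xSp1_sub R) lp oJ sx Jx Jt (cK It)).1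
  (fun k => geo _ _ _ lp J x oJ JI sx Jx t k Jt).
rewrite xt => L.
pose X (v : 'rV[R]_(3 + 3)) := qdiag (2 *: (qim (lsubmx v) * g t)) (2 *: (qim (rsubmx v) * h t)).
have lX : linear X.
  move=> s v w; apply: qmatP; rewrite entry_linear !mxE /= ?scaler0 ?addr0 //.
    by rewrite linearP qim_linear mulrDl scaleqAl scalerDr !scalerA mulrC.
  by rewrite linearP qim_linear mulrDl scaleqAl scalerDr !scalerA mulrC.
have Xe l : qlag t (X (delta_mx 0 l)) = 0 by rewrite -lag_qlag //; have := L l; rewrite /partial D.
have X0 v : qlag t (X v) = 0.
  have lq := qlag_linear It.
  rewrite (row_sum_delta v) (big_morph X (linD lX) (lin0 lX)).
  rewrite (big_morph (qlag t) (linD lq) (lin0 lq)) big1 // => l _.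
  by rewrite (linZ lX) (linZ lq) Xe scaler0.
have im (p y : quat R) : M p -> q0 y = 0 -> exists v, 2 *: (qim v * p) = p * y.
  (* Right translates are turned into left translates by conjugation, which preserves imaginary
     quaternions; 1/2 compensates the factor 2 of the Cayley differential. *)
  move=> Mp y0; exists (qimv (2^-1 *: (p * y * conjq p))).
  have [_ _ _ _] := Sp1_conj Mp; have pp : conjq p * p = 1 by [].
  rewrite qimvK; first by rewrite scaleqAl scalerA divff ?pnatr_eq0 // scale1r -mulrA pp mulr1.
  by case: y y0 => a b c' d /= ->; ring.
have [v1 E1] := im _ _ Mg i1; have [v2 E2] := im _ _ Mh i2.
by rewrite -E1 -E2; have := X0 (row_mx v1 v2); rewrite /X row_mxKl row_mxKr.
Qed.

(** A tangent vector met in an arbitrary chart of the large group is the sum of a part tangent to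
    the subgroup, handled by the hypothesis on [c], and of an off-diagonal part, handled by
    parity. *)
Lemma Sp1xSp1_geodesic : geodesic (@Sp11 R) kin I c.
Proof.
split; first by case: Kgeo => -[? ? ? ?] _; split=> // t /cK /Sp1xSp1_sub.
move=> d U psi lp J x oJ JI sx Jx t k Jt; have It := JI t Jt.
move: k; apply: (qgeodesic_eqP (fun _ h => h) lp oJ sx Jx Jt (cK It)).2 => l.
have [Ut cx] := Jx t Jt.
have tX := tangent_param (fun _ h => h) lp (delta_mx 0 l) Ut.
rewrite -cx in tX; have [Mg Mh cE'] := cE It; rewrite cE' in tX.
have [x1 [z [x2 [XE i1 i2]]]] := tangent_Sp11 Mg Mh tX.
rewrite lag_qlag // /partial XE.
have -> : qmat_of (g t * x1) (g t * z) (h t * conjq z) (h t * x2) =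
    qdiag (g t * x1) (h t * x2) + qmat_of 0 (g t * z) (h t * conjq z) 0.
  by apply: qmatP; rewrite [RHS]mxE !mxE /= ?addr0 ?add0r.
by rewrite (linD (qlag_linear It)) qlag_diag // qlag_off // addr0.
Qed.
End PartA.

Theorem corollary1 (R : realType)
    (muSp : {measure set (borel (quat R)) -> \bar R})
    (muSO : {measure set (borel 'M[R]_3) -> \bar R}) :
  volume_measure (@Sp1 R) (@qip R) muSp ->
  volume_measure (@SO3 R) (@rip R) muSO ->
  let gSp := kinetic (@Sp11 R) (@Sp1 R) (@qmoebius R) (@qip R) muSp in
  let gO := kinetic (@Oo33 R) (@SO3 R) (@rmoebius R) (@rip R) muSO in
  totally_geodesic (@Sp1xSp1 R) (@Sp11 R) gSp /\
  forall (I : set R) (c : R -> 'M[R]_(3 + 3)),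
    geodesic (@SO3xSO3 R) gO I c ->
    (geodesic (@Oo33 R) gO I c <->
     (exists2 h : 'M[R]_3, SO3 h & c @` I `<=` [set rdiag g h | g in @SO3 R]) \/
     (exists2 g : 'M[R]_3, SO3 g & c @` I `<=` [set rdiag g h | h in @SO3 R])).
Proof.
move=> volSp volSO gSp gO; split=> [|I c Kc]; last exact: geodesic_Oo33_iff.
split; first exact: Sp1xSp1_sub.
move=> I c Kc; have [[oI _ cS cK] _] := Kc.
exact: Sp1xSp1_geodesic.
Qed.
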